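(* Let $\Theta$ be a completely random measure on $\Psi$ with no deterministic component such that: (i) $\Theta$ has $K_{fix}<\infty$ fixed-location atoms $\theta_{fix,k}\,\delta_{\psi_{fix,k}}$, $k=1,\dots,K_{fix}$, where the $\psi_{fix,k}\in\Psi$ are deterministic and distinct and the weights $\theta_{fix,k}\sim F_{fix,k}(d\theta)$ are independent across $k$, each $F_{fix,k}$ being a probability distribution on $\mathbb{R}_+$; (ii) the ordinary component of $\Theta$ has rate measure $\mu(d\theta\times d\psi)=\nu(d\theta)\cdot G(d\psi)$, where $G$ is a diffuse (atomless) probability distribution on $\Psi$ and $\nu$ is a $\sigma$-finite measure on $\mathbb{R}_+$ with $\nu(\mathbb{R}_+)=\infty$. Write $\Theta=\sum_{k=1}^\infty\theta_k\delta_{\psi_k}$ (fixed-location and ordinary atoms together). Conditional on $\Theta$, let $X=\sum_{k=1}^\infty x_k\delta_{\psi_k}$, where the $x_k$ are independent and $x_k$ has probability mass function $h(\cdot\mid\theta_k)$ on $\{0,1,2,\dots\}$. Suppose $$\sum_{x=1}^\infty\int_{\mathbb{R}_+}\nu(d\theta)\,h(x\mid\theta)<\infty .$$ Let $\Theta_{post}$ be a random measure with the distribution of $\Theta\mid X$. Then $\Theta_{post}$ is a completely random measure with the following three parts. 1. For each $k\in\{1,\dots,K_{fix}\}$, $\Theta_{post}$ has a fixed-location atom at $\psi_{fix,k}$ whose weight $\theta_{post,fix,k}$ is distributed according to the finite-dimensional Bayesian posterior $F_{post,fix,k}(d\theta)$ arising from prior $F_{fix,k}$, likelihood $h$, and observation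 $X(\{\psi_{fix,k}\})$. 2. Let $\{x_{new,k}\delta_{\psi_{new,k}}:k\in\{1,\dots,K_{new}\}\}$ be the atoms of $X$ that are not at the fixed locations of the prior of $\Theta$ (their number $K_{new}$ is finite by the summability assumption). For each such $k$, $\Theta_{post}$ has a fixed-location atom at $\psi_{new,k}$ with random weight $\theta_{post,new,k}$, whose distribution $F_{post,new,k}(d\theta)$ is proportional to $\nu(d\theta)\,h(x_{new,k}\mid\theta)$. 3. The ordinary component of $\Theta_{post}$ has weight rate measure $\nu_{post}(d\theta):=\nu(d\theta)\,h(0\mid\theta)$ (with location distribution $G$).
   Context: $\Psi$ is a measurable space (of ''traits'') whose $\sigma$-algebra contains all singletons; $\mathbb{R}_+$ denotes the non-negative reals with the Borel $\sigma$-algebra. A random measure $\Theta$ on $\Psi$ is completely random (a CRM) if $\Theta(A_1),\dots,\Theta(A_K)$ are independent for all disjoint measurable $A_1,\dots,A_K$. A CRM with no deterministic component is an independent sum $\Theta=\Theta_{fix}+\Theta_{ord}$. The fixed-location component is $\Theta_{fix}=\sum_k\theta_{fix,k}\delta_{\psi_{fix,k}}$ with deterministic distinct locations and independent non-negative random weights. The ordinary component with ($\sigma$-finite) rate measure $\mu$ on $\mathbb{R}_+\times\Psi$ is $\Theta_{ord}=\sum_k\theta_{ord,k}\delta_{\psi_{ord,k}}$, where $\{(\theta_{ord,k},\psi_{ord,k})\}_k$ are the points of a Poisson point process with rate (mean) measure $\mu$. When $\mu(d\theta\times d\psi)=\nu(d\theta)G(d\psi)$, $\nu$ is called the weight rate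 measure. For each $\theta$, $h(\cdot\mid\theta)$ is a probability mass function on $\{0,1,2,\dots\}$, measurable in $\theta$. In $\Theta=\sum_k\theta_k\delta_{\psi_k}$ the pairs $(\theta_k,\psi_k)$ list all fixed-location pairs and all points of the Poisson process; the locations are almost surely distinct. If $x_k=0$, then $X$ has no atom at $\psi_k$. *)

(* Defs.v *)
From HB Require Import structures.
From mathcomp Require Import all_boot all_order all_algebra.
From mathcomp Require Import all_classical all_reals all_analysis.
From mathcomp Require Import measurable_realfun.

Set Implicit Arguments.
Unset Strict Implicit.
Unset Printing Implicit Defensive.

Import Order.TTheory GRing.Theory Num.Theory.
Import numFieldNormedType.Exports.

Local Open Scope classical_set_scope.
Local Open Scope ring_scope.
Local Open Scope ereal_scope.

(** The nonnegative half-line of weights is embedded in [R]: measures of weights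
    are Borel measures on [R] that do not charge the negative numbers. *)

Section measure_space.
Context d (T : measurableType d) (R : realType).

Definition measures : Type := {measure set T -> \bar R}.

HB.instance Definition _ := gen_eqMixin measures.
HB.instance Definition _ := gen_choiceMixin measures.
HB.instance Definition _ := isPointed.Build measures mzero.

Definition ev (m : measures) (A : set T) : \bar R :=
  (m : {measure set T -> \bar R}) A.

Definition atom (m : measures) (p : T) : Prop := 0 < ev m [set p].

Definition atom_count (m : measures) (A : set T) (B : set (\bar R)) : \bar R :=
  counting [set p | [/\ A p, atom m p & B (ev m [set p])]].

(** The sigma-algebra on measures makes the masses [m A] measurable, and also
    the number of atoms in [A] whose mass lies in [B].  For finite measures on a
    countably generated space the latter are measurable functions of the former.
    They are added because [T] is only assumed to have measurable singletons,
    and then the masses alone need not reveal the individual atoms (e.g. for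
    the countable-cocountable sigma-algebra), nor do they when every mass is
    infinite. *)
Definition measures_generator : set_system measures :=
  [set E | (exists A, measurable A /\
              preimage_set_system setT (ev ^~ A) measurable E) \/
           (exists A B, [/\ measurable A, measurable B &
              preimage_set_system setT (fun m => atom_count m A B)
                measurable E])].

Definition measure_space : measurableType measures_generator.-sigma :=
  g_sigma_algebraType measures_generator.

End measure_space.

Section probability_notions.
Context d (Omega : measurableType d) (R : realType) (P : probability Omega R).

(** Meant for families of sigma-algebras: these contain [setT], so the product
    rule for the whole family covers all subfamilies. *)
Definition mutually_independent (I : finType) (F : I -> set_system Omega) :=
  forall E : I -> set Omega, (forall i, F i (E i)) ->
    P (\bigcap_(i in [set: I]) E i) = (\prod_(i : I) fine (P (E i)))%R%:E.

Definition sigma_fun d' (T : measurableType d') (f : Omega -> T)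
    : set_system Omega :=
  preimage_set_system setT f measurable.

Definition sigma_family d' (T : measurableType d') (J : Type) (D : set J)
    (f : J -> Omega -> T) : set_system Omega :=
  <<s [set E | exists j, D j /\ sigma_fun (f j) E] >>.

Definition regular_conditional_distribution d1 (S : measurableType d1)
    d2 (T : measurableType d2) (X : Omega -> S) (Y : Omega -> T)
    (kappa : R.-pker S ~> T) :=
  forall C D, measurable C -> measurable D ->
    P (X @^-1` D `&` Y @^-1` C) = \int[P]_(w in X @^-1` D) kappa (X w) C.

Definition point_count (T : Type) (p : nat -> Omega -> T) (S : set T)
    (w : Omega) : \bar R :=
  counting [set k | S (p k w)].

(** [p] enumerates the points of a Poisson point process with mean measure
    [mu]; all indices are used, so [mu] must have infinite mass.
    The second argument of [poisson_prob] is a dummy. A count whose mean is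
    infinite is almost surely infinite. *)
Definition poisson_points d' (T : measurableType d')
    (mu : set T -> \bar R) (p : nat -> Omega -> T) :=
  (forall (S : set T) (n : nat), measurable S ->
     P [set w | point_count p S w = n%:R%:E] =
       if mu S \is a fin_num then poisson_prob (fine (mu S)) 0%N [set n]
       else 0) /\
  (forall (K : nat) (S : 'I_K -> set T), (forall i, measurable (S i)) ->
     trivIset setT S ->
     mutually_independent (fun i => sigma_fun (point_count p (S i)))).

End probability_notions.

Section crm.
Context dPsi (Psi : measurableType dPsi) (R : realType).
Context d (Omega : measurableType d) (P : probability Omega R).

Definition completely_random (Theta : Omega -> measure_space Psi R) :=
  measurable_fun setT Theta /\
  forall (K : nat) (A : 'I_K -> set Psi), (forall i, measurable (A i)) ->
    trivIset setT A ->
    mutually_independent P (fun i => sigma_fun (fun w => ev (Theta w) (A i))).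

Definition atomic_sum (I : choiceType) (a : I -> R) (p : I -> Psi)
    (m : measure_space Psi R) :=
  forall A, measurable A -> ev m A = \esum_(i in [set: I]) ((a i)%:E * \d_(p i) A).

(** The atoms [(theta i, psi i)] of a completely random measure without
    deterministic component: [i = inl k] are the fixed-location ones (locations
    [psi_fix], weight laws [F]) and [i = inr k] the ordinary ones (rate measure
    [mu]). *)
Record crm_atoms (I : finType) (psi_fix : I -> Psi)
    (F : I -> probability (measurableTypeR R) R)
    (mu : set (measurableTypeR R * Psi) -> \bar R)
    (theta : I + nat -> Omega -> measurableTypeR R)
    (psi : I + nat -> Omega -> Psi) : Prop := CrmAtoms {
  crm_theta_measurable : forall i, measurable_fun setT (theta i) ;
  crm_psi_measurable : forall i, measurable_fun setT (psi i) ;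
  crm_theta_ge0 : forall i, {ae P, forall w, (0 <= theta i w)%R} ;
  crm_psi_fix_inj : injective psi_fix ;
  crm_psi_fix : forall k w, psi (inl k) w = psi_fix k ;
  crm_theta_fix : forall k B, measurable B ->
    P (theta (inl k) @^-1` B) = F k B ;
  crm_poisson : poisson_points P mu
    (fun k w => (theta (inr k) w, psi (inr k) w)) ;
  (* the fixed-location weights and the Poisson process (index [None]) are
     jointly independent *)
  crm_indep : mutually_independent P (fun j : option I =>
    if j is Some k then sigma_fun (theta (inl k))
    else sigma_family measurable (@point_count _ Omega R _
           (fun k w => (theta (inr k) w, psi (inr k) w)))) ;
  crm_distinct : {ae P, forall w, injective (psi ^~ w)}
}.

(** Given all the pairs [(theta i, psi i)], the [x i] are independent and [x i]
    has probability mass function [h ^~ (theta i)]. *)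
Definition conditionally_independent_marks (I : choiceType)
    (theta : I -> Omega -> measurableTypeR R) (psi : I -> Omega -> Psi)
    (h : nat -> R -> R) (x : I -> Omega -> nat) :=
  (forall i, measurable_fun setT (x i)) /\
  forall (s : seq I) (n : I -> nat) (E : set Omega), uniq s ->
    sigma_family setT (fun i w => (theta i w, psi i w)) E ->
    P (E `&` [set w | forall i, i \in s -> x i w = n i]) =
      \int[P]_(w in E) (\prod_(i <- s) h (n i) (theta i w))%R%:E.

End crm.

(** [Q] is the law of a completely random measure with the given fixed-location
    component ([psi_fix], [F]) and ordinary component ([mu]). *)
Definition crm_law dPsi (Psi : measurableType dPsi) (R : realType)
    (Q : set (measure_space Psi R) -> \bar R)
    (I : finType) (psi_fix : I -> Psi)
    (F : I -> probability (measurableTypeR R) R)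
    (mu : set (measurableTypeR R * Psi) -> \bar R) : Prop :=
  exists d (Omega : measurableType d) (P : probability Omega R)
    (Theta : Omega -> measure_space Psi R)
    (theta : I + nat -> Omega -> measurableTypeR R)
    (psi : I + nat -> Omega -> Psi),
  [/\ forall C, measurable C -> P (Theta @^-1` C) = Q C,
      completely_random P Theta,
      crm_atoms P psi_fix F mu theta psi &
      {ae P, forall w, atomic_sum (theta ^~ w) (psi ^~ w) (Theta w)}].

(** [Q] is the probability measure proportional to [l(t) m(dt)]; when [m] is a
    prior distribution and [l] the likelihood of the observation, this is
    Bayes' rule. *)
Definition is_posterior (R : realType)
    (m : {measure set (measurableTypeR R) -> \bar R}) (l : R -> R)
    (Q : probability (measurableTypeR R) R) :=
  let Z := \int[m]_t (l t)%:E in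
  0 < Z < +oo /\
  forall B, measurable B -> Q B = (fine Z)^-1%:E * \int[m]_(t in B) (l t)%:E.

Definition join_families (I J T : Type) (f : I -> T) (g : J -> T) (i : I + J) : T :=
  match i with inl a => f a | inr b => g b end.

(* Main.v *)
Require Import Defs.
From HB Require Import structures.
From mathcomp Require Import all_boot all_order all_algebra.
From mathcomp Require Import all_classical all_reals all_analysis.
From mathcomp Require Import measurable_realfun.
From mathcomp Require Import finmap ring lra.

Set Implicit Arguments.
Unset Strict Implicit.
Unset Printing Implicit Defensive.

Import Order.TTheory GRing.Theory Num.Theory.
Import numFieldNormedType.Exports.

Local Open Scope classical_set_scope.
Local Open Scope ring_scope.
Local Open Scope ereal_scope.

(** Given the weights and locations of all atoms, the marks [x] are independent.
    The ordinary atoms form a Poisson process, and marking its points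
    independently splits it into independent Poisson processes, one for each
    value [n] of the mark, with rates [h n t * nu(dt) * G(dp)]. The points with
    mark [0] leave no trace in [X]; they are independent of [X] and form the
    ordinary component of the posterior, with rate [h 0 t * nu(dt) * G(dp)].
    The points with a nonzero mark have a finite total rate, hence are finitely
    many; given their locations and marks, their weights are independent with
    densities proportional to [h n t * nu(dt)]. The fixed-location weights are
    independent of all this and each of them follows Bayes' rule.

    In the proof these statements are replaced by an identity between Laplace
    functionals. The sigma-algebra on measures is generated by masses of sets
    and numbers of atoms, which are sums over the atoms. A kernel is the
    conditional law of [Theta] given [X] as soon as the expectations of
    [e^(-f1(X)) e^(-f2(Theta))] and of [e^(-f1(X))] times the conditional mean of
    [e^(-f2)] agree for all finite sums [f1] and [f2] of such functionals: the
    exponentials generate everything under bounded limits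
    ([functional_monotone_class], [regular_conditional_distribution_laplace]).
    Both [f1(X)] and [f2(Theta)] are sums over the marked atoms, so that both
    expectations are Laplace functionals of the marked atoms. These are computed
    by averaging over the marks ([marked_laplace]), and what remains is Bayes'
    rule for each fixed location, and for each nonzero mark at each location
    ([marks_bayes]).

    The kernel itself consists of the laws of the asserted form. Such a law is
    built from the given random variables: the ordinary points with mark [0]
    have the required Poisson law, and there are infinitely many of them since
    [nu] is infinite; independent weights at the required locations are adjoined
    by an extension of the probability space ([thinned_crm_law]). The Laplace
    functional of this law is an explicit function of the atoms of the
    observation ([posterior_law_laplace]), and therefore measurable in it. *)

(** * Exponentials of extended reals *)

Section negexp.
Context {R : realType}.
Implicit Types x y : \bar R.

(** The exponential [e^-y] of an extended real. It turns sums of nonnegative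
    terms, finite or not, into products of numbers between [0] and [1]. *)
Definition eN y : R :=
  match y with r%:E => expR (- r) | +oo => 0%R | -oo => 0%R end.

Lemma eN_ge0 y : (0 <= eN y)%R.
Proof. by case: y => //= r; exact: expR_ge0. Qed.

Lemma eN_le1 y : 0 <= y -> (eN y <= 1)%R.
Proof. by case: y => //= r; rewrite lee_fin => r0; rewrite -expR0 ler_expR oppr_le0. Qed.

Lemma eN0 : eN 0 = 1%R.
Proof. by rewrite /= oppr0 expR0. Qed.

Lemma eND x y : 0 <= x -> 0 <= y -> eN (x + y) = (eN x * eN y)%R.
Proof.
case: x y => [x| |] [y| |]//= _ _; rewrite ?mul0r ?mulr0//.
by rewrite opprD expRD.
Qed.

Lemma eN_sum (I : Type) (s : seq I) (D : pred I) (f : I -> \bar R) :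
  (forall i, 0 <= f i) ->
  eN (\sum_(i <- s | D i) f i) = (\prod_(i <- s | D i) eN (f i))%R.
Proof.
move=> f0; elim: s => [|i s IH]; first by rewrite !big_nil eN0.
by rewrite !big_cons; case: ifP => // _; rewrite eND ?IH// sume_ge0.
Qed.

Lemma le_eN x y : 0 <= x -> x <= y -> (eN y <= eN x)%R.
Proof.
case: x y => [x| |] [y| |]//= x0.
by rewrite lee_fin => xy; rewrite ler_expR lerN2.
Qed.

(** Holds also when the limit is infinite, which is where monotone limits of
    sums over infinitely many atoms end. *)
Lemma cvg_eN (u : nat -> \bar R) y : (forall n, 0 <= u n) -> 0 <= y ->
  u @ \oo --> y -> eN (u n) @[n --> \oo] --> eN y.
Proof.
move=> u0; case: y => [r| |//] y0.
  move/fine_cvgP => [ufin ur].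
  have : (fun n => expR (- fine (u n))) @ \oo --> expR (- r).
    apply: (cvg_comp (fun n => - fine (u n))%R expR).
      exact: (cvgN ur).
    exact: continuous_expR.
  apply: cvg_trans; apply: near_eq_cvg; near=> n.
  have : u n \is a fin_num by near: n.
  by case: (u n).
move=> uy /=; apply/cvgrPdist_le => e e0; near=> n.
rewrite sub0r normrN ger0_norm ?eN_ge0//.
have : (Num.max 0 (- ln e))%:E <= u n.
  near: n; move/cvgeyPge : uy; exact.
move=> /(le_eN _); rewrite lee_fin le_max lexx => /(_ isT) /le_trans; apply.
rewrite /= -[leRHS](lnK e0) ler_expR lerNl; by rewrite le_max lexx orbT.
Unshelve. all: by end_near. Qed.

Lemma measurable_eN : measurable_fun setT eN.
Proof.
have -> : eN = fun y => if y \is a fin_num then expR (- fine y) else 0%R.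
  by apply/funext => -[].
apply: measurable_fun_ifT => //.
  apply: (measurable_fun_bool true).
  rewrite setTI (_ : _ @^-1` _ = [set y : \bar R | y \is a fin_num])//.
  rewrite (_ : [set y : \bar R | _] = [set y | -oo < y] `&` [set y | y < +oo]).
    apply: measurableI.
      rewrite -[X in measurable X]setTI.
      by apply: emeasurable_fun_o_infty => //; exact: measurable_id.
    rewrite -[X in measurable X]setTI.
    by apply: emeasurable_fun_infty_o => //; exact: measurable_id.
  by apply/seteqP; split => y /=; rewrite fin_numElt => /andP.
by apply: measurableT_comp => //; apply: measurableT_comp.
Qed.

(** Writes a factor in the unit interval as the exponential of a nonnegative
    term, so that products over the atoms become sums over the atoms. *)
Definition lN (u : R) : \bar R := if (0 < u)%R then (- ln u)%:E else +oo.

Lemma lNK (u : R) : (0 <= u)%R -> eN (lN u) = u.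
Proof.
rewrite le_eqVlt /lN => /predU1P[<-|u0]; first by rewrite ltxx.
by rewrite u0 /= opprK lnK.
Qed.

Lemma lN_ge0 (u : R) : (u <= 1)%R -> 0 <= lN u.
Proof. by move=> u1; rewrite /lN; case: ifPn => // u0; rewrite lee_fin oppr_ge0 ln_le0. Qed.

Lemma measurable_lN : measurable_fun setT lN.
Proof.
apply: measurable_fun_ifT => //.
- by apply: measurable_fun_ltr => //.
- by apply/measurable_EFinP; apply: measurableT_comp => //; exact: measurable_ln.
Qed.

End negexp.

(** * A monotone class theorem for exponentials *)

Section threshold.
Context {R : realType}.
Local Open Scope ring_scope.

Lemma bernoulli_ge (a : R) n : 0 <= a -> 1 + a *+ n <= (1 + a) ^+ n.
Proof.
move=> a0; elim: n => [|n IH]; first by rewrite mulr0n addr0 expr0.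
rewrite exprS mulrDl mul1r.
rewrite mulrS addrCA addrA [X in X + _]addrC -addrA addrC.
have h1 : 1 + a *+ n + a <= (1 + a) ^+ n + a * (1 + a) ^+ n.
  apply: lerD => //; rewrite -[leLHS]mulr1 ler_wpM2l//.
  by apply: exprn_ege1; rewrite lerDl.
by move: h1; rewrite -mulr_natl; lra.
Qed.

Lemma bernoulli_le (a : R) n : 0 <= a <= 1 -> 1 - a *+ n <= (1 - a) ^+ n.
Proof.
move=> /andP[a0 a1]; elim: n => [|n IH]; first by rewrite mulr0n subr0 expr0.
rewrite exprS mulrDl mul1r mulNr mulrS opprD addrCA addrC.
apply: lerD => //; rewrite lerN2 -[leRHS]mulr1 ler_wpM2l//.
by rewrite exprn_ile1// ?subr_ge0// lerBlDr lerDl.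
Qed.

Let m_ (t : R) n := (n * (Num.trunc (t ^- (n * n))).+1)%N.

(** Bernoulli's inequality bounds [(1 - e^k)^m] from below by [1 - m e^k] and
    from above by [1 / (1 + m e^k)]; with [k = n^2] and [m] about [n t^-k] the
    product [m e^k] is about [n (e/t)^(n^2)], which tends to zero or to infinity
    according as [e < t] or not. *)
Lemma threshold_cvg (t e : R) : 0 < t <= 1 -> 0 <= e <= 1 ->
  (fun n => (1 - e ^+ (n * n)) ^+ (m_ t n)) @ \oo --> ((e < t)%R%:R : R).
Proof.
move=> /andP[t0 t1] /andP[e0 e1].
have tk k : 1 <= t ^- k by rewrite invf_ge1 ?exprn_gt0// exprn_ile1// ltW.
have m_lb n : n%:R * t ^- (n * n) <= (m_ t n)%:R :> R.
  by rewrite /m_ natrM ler_wpM2l// ltW// truncnS_gt.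
have m_ub n : (m_ t n)%:R <= n%:R * (2 * t ^- (n * n)) :> R.
  rewrite /m_ natrM ler_wpM2l// -natr1 mulrDl !mul1r lerD//.
  by rewrite truncn_le (le_trans _ (tk _)).
have ek k : 0 <= e ^+ k <= 1 by rewrite exprn_ge0//= exprn_ile1.
case: ltP => et /=; last first.
  apply: (@squeeze_cvgr _ _ _ _ (fun=> 0) (fun n => (n.+1%:R)^-1)).
  - near=> n; set a := e ^+ (n * n).
    have /andP[a0 a1] : 0 <= a <= 1 by exact: ek.
    rewrite exprn_ge0 ?subr_ge0//=.
    have h1 : ((1 - a) ^+ m_ t n) * (1 + a *+ m_ t n) <= 1.
      apply: (@le_trans _ _ (((1 - a) * (1 + a)) ^+ m_ t n)).
        by rewrite exprMn ler_wpM2l ?exprn_ge0 ?subr_ge0// bernoulli_ge.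
      rewrite exprn_ile1//.
        by rewrite mulr_ge0 ?subr_ge0// addr_ge0.
      by rewrite -subr_sqr expr1n lerBlDr lerDl sqr_ge0.
    have h2 : n.+1%:R <= 1 + a *+ m_ t n.
      rewrite -nat1r lerD2l -[a *+ _]mulr_natl.
      apply: (@le_trans _ _ (n%:R * t ^- (n * n) * a)); last first.
        by rewrite ler_wpM2r.
      rewrite -mulrA -[leLHS]mulr1 ler_wpM2l// mulrC -expr_div_n exprn_ege1//.
      by rewrite ler_pdivlMr// mul1r.
    have p0 : 0 < 1 + a *+ m_ t n by apply: lt_le_trans h2.
    move: h1; rewrite -ler_pdivlMr// div1r => /le_trans; apply.
    by rewrite lef_pV2// posrE ltr0n.
  - exact: cvg_cst.
  - exact: cvg_harmonic.
(* From here on [e < t], and the lower bound of Bernoulli's inequality tends to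
   one. *)
have [->|en0] := eqVneq e 0.
  apply: cvg_near_cst; near=> n.
  have n0 : (0 < n)%N by near: n; exists 1%N.
  by rewrite expr0n muln_eq0 gtn_eqF//= subr0 expr1n.
have {}e0 : 0 < e by rewrite lt_def en0.
pose a := t / e - 1.
have a0 : 0 < a by rewrite subr_gt0 ltr_pdivlMr// mul1r.
apply: (@squeeze_cvgr _ _ _ _ (fun n => 1 - 2 / a * n%:R^-1) (fun=> 1)).
- near=> n; have n0 : (0 < n)%N by near: n; exists 1%N.
  have /andP[k0 k1] := ek (n * n)%N.
  apply/andP; split; last first.
    by rewrite exprn_ile1// ?subr_ge0// lerBlDr lerDl.
  apply: le_trans (bernoulli_le _ (ek _)).
  rewrite lerD2l lerN2.
  apply: (@le_trans _ _ (n%:R * (2 * t ^- (n * n)) * e ^+ (n * n))).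
    by rewrite -[e ^+ _ *+ _]mulr_natl ler_wpM2r.
  rewrite -!mulrA [t ^- _ * _]mulrC -expr_div_n.
  have et' : e / t = (1 + a)^-1 by rewrite /a addrCA subrr addr0 invf_div.
  rewrite et' exprVn.
  have h1 : a * n%:R * n%:R <= (1 + a) ^+ (n * n).
    apply: le_trans (bernoulli_ge _ (ltW a0)).
    by rewrite -mulrA -natrM mulr_natr lerDr.
  have nn : (0:R) < n%:R by rewrite ltr0n.
  rewrite mulrCA ler_wpM2l//.
  apply: (@le_trans _ _ (n%:R * (a * n%:R * n%:R)^-1)).
    rewrite ler_wpM2l// lef_pV2// posrE.
      by rewrite exprn_gt0// addr_gt0.
    by rewrite !mulr_gt0.
  by rewrite !invfM [leLHS]mulrC -!mulrA mulVf ?mulr1// gt_eqF.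
- rewrite -[X in _ --> X]subr0; apply: cvgB; first exact: cvg_cst.
  rewrite -[X in _ --> X](mulr0 (2 / a)); apply: cvgMr => //.
  by rewrite -(cvg_shiftS (fun n => n%:R^-1 : R)); exact: cvg_harmonic.
- exact: cvg_cst.
Unshelve. all: by end_near. Qed.

End threshold.

Section functional_monotone_class.
Context {R : realType} {T : pointedType} {J : Type} (l : J -> T -> \bar R).
Hypothesis l0 : forall j x, 0 <= l j x.
Variable H : set (T -> R).
Hypothesis HB : forall f g, H f -> H g ->
  (forall x, 0 <= g x /\ g x <= f x /\ f x <= 1)%R ->
  H (fun x => f x - g x)%R.
Hypothesis Hlim : forall (u : nat -> T -> R) f, (forall n, H (u n)) ->
  (forall n x, 0 <= u n x <= 1)%R ->
  (forall x, u n x @[n --> \oo] --> f x) -> H f.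
Hypothesis Hexp : forall s : seq J, H (fun x => eN (\sum_(j <- s) l j x)).

(** Membership in [H] is not stable under products, but this property is stable
    under products with the functions [1 - e^(-k l j)]. *)
Let absorbs (g : T -> R) := (forall x, 0 <= g x <= 1)%R /\
  forall s : seq J, H (fun x => g x * eN (\sum_(j <- s) l j x))%R.

Let e01 j x k : (0 <= eN (l j x) ^+ k <= 1)%R.
Proof. by rewrite exprn_ge0 ?eN_ge0//= exprn_ile1 ?eN_ge0 ?eN_le1. Qed.

Let eN01 (s : seq J) x : (0 <= eN (\sum_(j <- s) l j x) <= 1)%R.
Proof. by rewrite eN_ge0 eN_le1// sume_ge0. Qed.

Let absorbs_onem g j k : absorbs g ->
  absorbs (fun x => (1 - eN (l j x) ^+ k) * g x)%R.
Proof.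
move=> [g01 gH]; split=> [x|s].
  have /andP[a0 a1] := e01 j x k; have /andP[b0 b1] := g01 x.
  rewrite mulr_ge0 ?subr_ge0//= mulr_ile1 ?subr_ge0//.
  by rewrite lerBlDr lerDl.
rewrite (_ : (fun x => _) = (fun x => g x * eN (\sum_(j <- s) l j x) -
   g x * eN (\sum_(j <- nseq k j ++ s) l j x))%R); last first.
  apply/funext => x; rewrite big_cat/= eND ?sume_ge0//.
  rewrite [X in (_ * (X * _))%R]eN_sum// big_nseq -Monoid.iteropE/=.
  rewrite (_ : iterop _ _ _ _ = eN (l j x) ^+ k)%R//.
  by rewrite mulrBl mulrBl mul1r mulrA [(eN (l j x) ^+ k * _)%R]mulrC.
apply: HB => // x; have /andP[a0 a1] := g01 x; split; last split.
- by rewrite mulr_ge0 ?eN_ge0.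
- rewrite ler_wpM2l//; apply: le_eN; first exact: sume_ge0.
  by rewrite big_cat/= leeDr// sume_ge0.
- by have /andP[? ?] := eN01 s x; rewrite mulr_ile1.
Qed.

Let absorbs_lt g j t : absorbs g -> (0 < t <= 1)%R ->
  absorbs (fun x => (eN (l j x) < t)%R%:R * g x)%R.
Proof.
move=> gG t01; have [g01 _] := gG; split=> [x|s].
  by case: ltP => _; rewrite ?mul1r ?mul0r ?g01// lexx ler01.
pose m n := (n * (Num.trunc (t ^- (n * n))).+1)%N.
pose u n x := ((1 - eN (l j x) ^+ (n * n)) ^+ m n * g x)%R.
have uG n : absorbs (u n).
  rewrite /u; elim: (m n) => [|k IH].
    by under eq_fun do rewrite expr0 mul1r.
  under eq_fun do rewrite exprS -mulrA.
  exact: absorbs_onem.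
apply: (Hlim (u := fun n x => u n x * eN (\sum_(j <- s) l j x))%R).
- by move=> n; have [_] := uG n; exact.
- move=> n x; have [/(_ x)/andP[a0 a1] _] := uG n.
  by have /andP[? ?] := eN01 s x; rewrite mulr_ge0//= mulr_ile1.
- move=> x; apply: cvgMl; apply: cvgMl; apply: threshold_cvg => //.
  by have := e01 j x 1; rewrite expr1.
Qed.

Let cell (s : seq (J * R)) :=
  [set x | all (fun p => (eN (l p.1 x) < p.2)%R) s].
Let cells := [set A | exists s : seq (J * R),
  all (fun p => (0 < p.2 <= 1)%R) s /\ A = cell s].

Let H1 : H (fun=> 1%R).
Proof.
have := Hexp [::]; congr H; apply/funext => x.
by rewrite big_nil eN0.
Qed.

Let cells_H A : cells A -> H (\1_A).
Proof.
move=> [s [s01 ->]].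
suff [_ /(_ [::])] : absorbs (\1_(cell s)).
  congr H; apply/funext => x.
  by rewrite big_nil eN0 mulr1.
elim: s s01 => [_|[j t] s IH /= /andP[t01 /IH sG]].
  rewrite (_ : cell _ = setT); last by apply/seteqP; split.
  split=> [x|s]; first by rewrite indicT ler01 lexx.
  by under eq_fun do rewrite indicT mul1r.
have := absorbs_lt j sG t01; congr absorbs; apply/funext => x.
rewrite !indicE -natrM mulnb; congr (_%:R); congr nat_of_bool.
apply/idP/idP => [/andP[xt /set_mem xs]|/set_mem /andP[/= -> xs]].
  by apply/mem_set; apply/andP.
by rewrite mem_set.
Qed.

(** Products of exponentials of sums are again such exponentials, so that [H]
    contains the products of the functions [(1 - e^(-k l j))^m], which are
    differences. By [threshold_cvg] their limits are the indicators of the sets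
    where finitely many [l j] exceed given bounds, and these sets form a
    pi-system that generates the sigma-algebra of the [l j]. Only differences of
    comparable functions with values in the unit interval occur, because [H]
    will be a set of equalities between integrals of such functions. *)
Lemma functional_monotone_class C :
  <<s [set E | exists j B, measurable B /\ E = l j @^-1` B] >> C -> H (\1_C).
Proof.
have ls : lambda_system setT [set A : set T | H \1_A].
  split => //=; first by move: H1; congr H; apply/funext => x; rewrite indicT.
  - move=> A B BA HA HBB; have := HB HA HBB.
    rewrite (_ : (fun x => _) = \1_(A `\` B)); last first.
      apply/funext => x; rewrite !indicE in_setD.
      case: (boolP (x \in B)) => [/set_mem/BA/mem_set -> /=|_ /=].
        by rewrite subrr.
      by rewrite subr0 andbT.
    apply => x; rewrite !indicE.
    case: (boolP (x \in B)) => [/set_mem/BA/mem_set -> //=|_ /=].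
    by case: (x \in A); rewrite ?lexx ?ler01.
  - move=> F ndF HF; apply: (Hlim HF) => [n x|x].
      by rewrite indicE; case: (_ \in _); rewrite ?lexx ?ler01.
    apply: cvg_near_cst; case: (pselect ((\bigcup_i F i) x)) => [xF|nxF].
      have [k _ Fkx] := xF; exists k => // n /= kn.
      rewrite !indicE (mem_set xF) mem_set//.
      by have /subsetPset := ndF _ _ kn; exact.
    apply: nearW => n; rewrite !indicE memNset ?[in RHS]memNset// => Fn.
    by apply: nxF; exists n.
have cI : setI_closed cells.
  move=> _ _ [s [s01 ->]] [s' [s01' ->]]; exists (s ++ s').
  rewrite all_cat s01 s01'; split => //.
  by apply/seteqP; split => x; rewrite /cell /= all_cat => /andP.
have cells_meas : <<s cells >> `<=` [set A : set T | H \1_A].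
  exact: (lambda_system_subset cI ls cells_H).
move=> GC; apply: cells_meas; move: C GC; apply: smallest_sub.
  exact: smallest_sigma_algebra.
move=> _ [j [B [mB ->]]].
rewrite -[X in <<s _ >> X]setTI.
suff : measurable_fun setT (l j : g_sigma_algebraType cells -> \bar R).
  by apply.
apply: (measurability _ (ErealGenOInfty.measurableE R)).
move=> _ [_ [r ->] <-]; rewrite setTI.
have [r0|r0] := leP 0%R r; last first.
  rewrite (_ : _ @^-1` _ = setT) //.
  apply/seteqP; split => // x _ /=.
  by rewrite in_itv/= andbT (lt_le_trans _ (l0 j x))// lte_fin.
apply: sub_sigma_algebra; exists [:: (j, expR (- r))] => /=; split.
  by rewrite andbT expR_gt0 -[leRHS]expR0 ler_expR oppr_le0.
apply/seteqP; split => x; rewrite /cell /= in_itv/= !andbT; have := l0 j x;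
  case: (l j x) => //=.
- by move=> a _; rewrite lte_fin ltr_expR ltrN2.
- by move=> _ _; exact: expR_gt0.
- by move=> a _; rewrite lte_fin ltr_expR ltrN2.
- by move=> _ _; exact: ltry.
Qed.

End functional_monotone_class.

Import HBNNSimple.

(** * Bounded functions and transfer of integrals *)

Section bounded_functions.
Context {R : realType}.

Lemma measurable_preimage d (T : measurableType d) d' (U : measurableType d')
    (f : T -> U) (B : set U) : measurable_fun setT f -> measurable B ->
  measurable (f @^-1` B).
Proof. by move=> mf mB; rewrite -[X in measurable X]setTI; exact: mf. Qed.

Lemma measurable_mem d (T : measurableType d) (A : set T) : measurable A ->
  measurable_fun setT (fun x => x \in A).
Proof.
move=> mA; apply: (measurable_fun_bool true); rewrite setTI (_ : _ @^-1` _ = A)//.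
by apply/seteqP; split => x /=; [move/set_mem|exact: mem_set].
Qed.

Lemma measurable_negative :
  measurable ([set t : R | (t < 0)%R] : set (measurableTypeR R)).
Proof.
rewrite (_ : [set t : R | _] = `]-oo, 0%R[%classic); first exact: measurable_itv.
by apply/seteqP; split => y /=; rewrite in_itv.
Qed.

Lemma indic01 (T : Type) (A : set T) x : (0 <= (\1_A x : R) <= 1)%R.
Proof. by rewrite indicE; case: (_ \in _); rewrite ?lexx ler01. Qed.

Lemma mul01 (a b : R) : (0 <= a <= 1 -> 0 <= b <= 1 -> 0 <= a * b <= 1)%R.
Proof. by move=> /andP[? ?] /andP[? ?]; rewrite mulr_ge0//= mulr_ile1. Qed.

Lemma integral_cst1 d (T : measurableType d) (P : probability T R) :
  \int[P]_(x in setT) cst 1 x = 1.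
Proof.
rewrite integral_cst//.
by rewrite -[RHS](mule1 1); congr (_ * _); exact: probability_setT.
Qed.

Lemma cvg_integral01 d (T : measurableType d) (P : probability T R)
    (u : nat -> T -> R) (f : T -> R) :
  (forall n, measurable_fun setT (u n)) ->
  (forall n x, 0 <= u n x <= 1)%R ->
  (forall x, u n x @[n --> \oo] --> f x) ->
  \int[P]_x (u n x)%:E @[n --> \oo] --> \int[P]_x (f x)%:E.
Proof.
move=> mu u01 uf.
apply: (@dominated_cvg _ _ _ P setT measurableT (fun n x => (u n x)%:E) _ (cst 1)) => //.
- by move=> n; exact/measurable_EFinP.
- by move=> x _; apply: cvg_EFin; [exact: nearW|exact: uf].
- apply/integrableP; split => //.
  under eq_integral do rewrite /= normr1.
  by rewrite integral_cst1 ltry.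
- move=> n x _; have /andP[a b] := u01 n x.
  by rewrite gee0_abs lee_fin.
Qed.

Lemma prod01 (I : Type) (s : seq I) (D : pred I) (f : I -> R) :
  (forall i, 0 <= f i <= 1)%R -> (0 <= \prod_(i <- s | D i) f i <= 1)%R.
Proof.
move=> f01; elim: s => [|i s /andP[IH0 IH1]]; first by rewrite big_nil ler01 lexx.
rewrite big_cons; case: ifP => _; last by rewrite IH0.
by have /andP[a b] := f01 i; rewrite mulr_ge0//= mulr_ile1.
Qed.

Lemma measurable_fun_prod d (T : measurableType d) (I : Type) (s : seq I)
    (D : pred I) (h : I -> T -> R) : (forall i, measurable_fun setT (h i)) ->
  measurable_fun setT (fun x => \prod_(i <- s | D i) h i x)%R.
Proof.
move=> mh; elim: s => [|i s IH].
  under eq_fun do rewrite big_nil.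
  exact: measurable_cst.
under eq_fun do rewrite big_cons.
by case: (D i) => //; exact: measurable_funM.
Qed.

Lemma nnsfun_range_ge0 d (T : measurableType d) (g : {nnsfun T >-> R}) i :
  (0 <= (finmap.enum_fset (fset_set (range g)))`_i)%R.
Proof.
have [si|si] := ltnP i (size (finmap.enum_fset (fset_set (range g)))).
  have := mem_nth 0%R si.
  rewrite in_fset_set; last exact: fimfunP.
  by move/set_mem => [x _ <-].
by rewrite nth_default.
Qed.

(** Induction over nonnegative measurable functions, through the approximation
    by simple ones. *)
Lemma nnfun_ind d (T : measurableType d) (Q : set (T -> \bar R)) :
  (forall A, measurable A -> Q (fun x => (\1_A x)%:E)) ->
  (forall (c : R) f, (0 <= c)%R -> (forall x, 0 <= f x) -> Q f ->
    Q (fun x => c%:E * f x)) ->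
  (forall f g, (forall x, 0 <= f x) -> (forall x, 0 <= g x) -> Q f -> Q g ->
    Q (fun x => f x + g x)) ->
  (forall (u : nat -> T -> \bar R) f, (forall n, Q (u n)) ->
    (forall n x, 0 <= u n x) -> (forall x, nondecreasing_seq (u ^~ x)) ->
    (forall x, u n x @[n --> \oo] --> f x) -> Q f) ->
  forall f, measurable_fun setT f -> (forall x, 0 <= f x) -> Q f.
Proof.
move=> Q1 QZ QD Ql f mf f0.
pose g := nnsfun_approx measurableT mf.
apply: (Ql (fun n x => (g n x)%:E)).
- move=> n.
  rewrite (_ : (fun x => _) = (fun x => \sum_(i < size (finmap.enum_fset
      (fset_set (range (g n)))))
    ((finmap.enum_fset (fset_set (range (g n))))`_i *
     \1_(g n @^-1` [set (finmap.enum_fset (fset_set (range (g n))))`_i]) x)%:E)); last first.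
    by apply/funext => x; rewrite (fimfunEord (g n)) sumEFin.
  have Q0 : Q (fun=> 0).
    have := Q1 set0 measurable0.
    by congr Q; apply/funext => x; rewrite indic0.
  have s0 i := nnsfun_range_ge0 (g n) i.
  elim: (index_enum _) => [|i s IH].
    by under eq_fun do rewrite big_nil.
  under eq_fun do rewrite big_cons.
  apply: QD => //.
  + by move=> x; rewrite lee_fin mulr_ge0// indicE; case: (_ \in _).
  + move=> x; apply: sume_ge0 => j _.
    by rewrite lee_fin mulr_ge0// indicE; case: (_ \in _).
  + under eq_fun do rewrite EFinM.
    apply: QZ => //; exact: Q1.
- by move=> n x; rewrite lee_fin.
- by move=> x m n mn; rewrite lee_fin; have /lefP := nd_nnsfun_approx measurableT mf mn; exact.
- move=> x; have := cvg_nnsfun_approx measurableT mf (fun x _ => f0 x) (I : setT x).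
  exact.
Qed.

Lemma nnsfun_trivIset d (T : measurableType d) (g : {nnsfun T >-> R}) :
  let s := finmap.enum_fset (fset_set (range g)) in
  trivIset setT (fun i : 'I_(size s) => g @^-1` [set s`_i]).
Proof.
move=> s i j _ _ [x [/= xi xj]]; apply/val_inj/eqP => /=.
have us : uniq s by exact: finmap.fset_uniq.
by rewrite -(nth_uniq 0%R _ _ us)// -xi -xj.
Qed.

Lemma nneseries_monotone (u : nat -> nat -> \bar R) (v : nat -> \bar R) :
  (forall n k, 0 <= u n k) -> (forall k, nondecreasing_seq (u ^~ k)) ->
  (forall k, u n k @[n --> \oo] --> v k) ->
  \sum_(0 <= k <oo) u n k @[n --> \oo] --> \sum_(0 <= k <oo) v k.
Proof.
move=> u0 nd uv.
have v0 k : 0 <= v k.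
  rewrite -(cvg_lim _ (uv k))//; apply: lime_ge; first by apply/cvg_ex; exists (v k).
  exact: nearW.
rewrite -ge0_integral_count//.
under eq_fun do rewrite -ge0_integral_count//.
have -> : v = fun k => limn (u ^~ k).
  by apply/funext => k; apply/esym/cvg_lim => //; exact: uv.
by apply: cvg_monotone_convergence => // k _ m n; exact: nd.
Qed.

(** A random index with values in the integers splits the space into countably
    many pieces on which it is constant. *)
Lemma measurable_at_index d (Omega : measurableType d) d' (T : measurableType d')
    (q : nat -> Omega -> T) (s : Omega -> nat) :
  (forall k, measurable_fun setT (q k)) -> (forall k, measurable [set w | s w = k]) ->
  measurable_fun setT (fun w => q (s w) w).
Proof.
move=> mq ms _ B mB; rewrite setTI.
rewrite (_ : _ @^-1` B = \bigcup_k ([set w | s w = k] `&` q k @^-1` B)).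
  by apply: bigcup_measurable => k _; apply: measurableI => //; exact: measurable_preimage.
by apply/seteqP; split => [w Bw|w [k _ [/= <-]]//]; exists (s w).
Qed.

End bounded_functions.

Section density.
Context {R : realType} d (T : measurableType d).

(** The proofs are arguments so that the measure structure can be inferred. *)
Definition density (m : {measure set T -> \bar R}) (l : T -> R) (ml : measurable_fun setT l) (l0 : forall t, (0 <= l t)%R)
  (B : set T) : \bar R := \int[m]_(t in B) (l t)%:E.

Lemma density0 m l ml l0 : @density m l ml l0 set0 = 0.
Proof. by rewrite /density integral_set0. Qed.

Lemma density_ge0 m l ml l0 B : 0 <= @density m l ml l0 B.
Proof. by apply: integral_ge0 => t _; rewrite lee_fin. Qed.

Lemma density_sigma_additive m l ml l0 : semi_sigma_additive (@density m l ml l0).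
Proof.
move=> /= F mF tF mUF; rewrite /density; apply: cvg_toP.
  apply: ereal_nondecreasing_is_cvgn => k n kn.
  by apply: lee_sum_nneg_natr => // j _ _; exact: density_ge0.
rewrite ge0_integral_bigcup//= => [|x _]; last by rewrite lee_fin.
by apply/measurable_funTS/measurable_EFinP.
Qed.

HB.instance Definition _ m l ml l0 := isMeasure.Build _ _ _ (@density m l ml l0)
  (@density0 m l ml l0) (@density_ge0 m l ml l0) (@density_sigma_additive m l ml l0).

(** True for indicators by definition, hence for all nonnegative functions. *)
Lemma integral_density m l ml l0 (f : T -> \bar R) :
  measurable_fun setT f -> (forall t, 0 <= f t) ->
  \int[@density m l ml l0]_t f t = \int[m]_t ((l t)%:E * f t).
Proof.
move=> mf f0; suff [//] : measurable_fun setT f /\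
  \int[@density m l ml l0]_t f t = \int[m]_t ((l t)%:E * f t).
have ml' : measurable_fun setT (EFin \o l) by exact/measurable_EFinP.
have ll t : 0 <= (l t)%:E by rewrite lee_fin.
apply: (@nnfun_ind R _ T (fun f => measurable_fun setT f /\
  \int[@density m l ml l0]_t f t = \int[m]_t ((l t)%:E * f t))) => //.
- move=> A mA; split; first exact/measurable_EFinP.
  rewrite integral_indic// setIT.
  transitivity (\int[m]_(t in A) (l t)%:E); first by [].
  rewrite integral_mkcond.
  apply: eq_integral => t _; rewrite patchE indicE.
  by case: (t \in A); rewrite ?mule1 ?mule0.
- move=> c g c0 g0 [mg Hg]; split; first exact: measurable_funeM.
  rewrite ge0_integralZl_EFin// Hg -ge0_integralZl_EFin//.
  + by apply: eq_integral => t _; rewrite muleCA.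
  + by move=> t _; rewrite mule_ge0.
  + exact: emeasurable_funM.
- move=> g1 g2 g10 g20 [mg1 H1] [mg2 H2]; split; first exact: emeasurable_funD.
  rewrite ge0_integralD// H1 H2 -ge0_integralD//.
  + by apply: eq_integral => t _; rewrite ge0_muleDr.
  + by move=> t _; rewrite mule_ge0.
  + exact: emeasurable_funM.
  + by move=> t _; rewrite mule_ge0.
  + exact: emeasurable_funM.
- move=> u g uQ u0 und ug; split.
    by apply: (emeasurable_fun_cvg u) => // k; case: (uQ k).
  have mu n : measurable_fun setT (u n) by case: (uQ n).
  have c1 : \int[@density m l ml l0]_t u n t @[n --> \oo] --> \int[@density m l ml l0]_t g t.
    have -> : g = fun t => limn (u ^~ t).
      by apply/funext => t; apply/esym/cvg_lim => //; exact: ug.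
    by apply: cvg_monotone_convergence => // t _ a b; exact: und.
  have c2 : \int[m]_t ((l t)%:E * u n t) @[n --> \oo] --> \int[m]_t ((l t)%:E * g t).
    have -> : (fun t => (l t)%:E * g t) = fun t => limn (fun n => (l t)%:E * u n t).
      by apply/funext => t; apply/esym/cvg_lim => //; apply: cvgeZl => //; exact: ug.
    apply: cvg_monotone_convergence => //.
    + by move=> n; exact: emeasurable_funM.
    + by move=> n t _; rewrite mule_ge0.
    + by move=> t _ a b ab; rewrite lee_wpmul2l//; exact: und.
  have uE : (fun n => \int[@density m l ml l0]_t u n t) = (fun n => \int[m]_t ((l t)%:E * u n t)).
    by apply/funext => n; case: (uQ n).
  by rewrite uE in c1; exact: (cvg_unique _ c1 c2).
Qed.

(** A density bounded by [1] preserves sigma-finiteness. *)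
Definition thinned (m : {sigma_finite_measure set T -> \bar R}) (l : T -> R) ml l0
  (l1 : forall t, (l t <= 1)%R) : set T -> \bar R := @density m l ml l0.

HB.instance Definition _ m l ml l0 l1 := Measure.on (@thinned m l ml l0 l1).

Lemma thinned_sigma_finite m l ml l0 l1 : sigma_finite setT (@thinned m l ml l0 l1).
Proof.
have [F FT Ffin] := sigma_finiteT m; exists F => // i; have [mFi Fi] := Ffin i.
split => //; apply: le_lt_trans Fi.
rewrite /thinned /density -[leRHS]mul1e -integral_cst//.
apply: ge0_le_integral => //.
- by move=> t _; rewrite lee_fin.
- by apply/measurable_EFinP/measurable_funTS.
- by move=> t _; rewrite lee_fin.
Qed.

HB.instance Definition _ m l ml l0 l1 := @Measure_isSigmaFinite.Build _ _ _
  (@thinned m l ml l0 l1) (@thinned_sigma_finite m l ml l0 l1).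

Definition normalized (m : {measure set T -> \bar R}) (l : T -> R) ml l0 (mass : \int[m]_t (l t)%:E = 1) : set T -> \bar R :=
  @density m l ml l0.

HB.instance Definition _ m l ml l0 mass := Measure.on (@normalized m l ml l0 mass).

HB.instance Definition _ m l ml l0 mass := @Measure_isProbability.Build _ _ _
  (@normalized m l ml l0 mass) mass.

End density.

Section transfer.
Context {R : realType}.

Lemma integral_transfer d1 (T1 : measurableType d1) d2 (T2 : measurableType d2)
    d (T : measurableType d) (m1 : {measure set T1 -> \bar R})
    (m2 : {measure set T2 -> \bar R}) (X1 : T1 -> T) (X2 : T2 -> T) (f : T -> \bar R) :
  measurable_fun setT X1 -> measurable_fun setT X2 ->
  (forall B, measurable B -> m1 (X1 @^-1` B) = m2 (X2 @^-1` B)) ->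
  measurable_fun setT f -> (forall t, 0 <= f t) ->
  \int[m1]_w f (X1 w) = \int[m2]_w f (X2 w).
Proof.
move=> mX1 mX2 E mf f0.
have := ge0_integral_pushforward mX1 m1 measurableT mf (fun y _ => f0 y).
rewrite preimage_setT => <-.
have := ge0_integral_pushforward mX2 m2 measurableT mf (fun y _ => f0 y).
rewrite preimage_setT => <-.
by apply: eq_measure_integral => A mA _; exact: E.
Qed.

(** The hypothesis says that the measures with densities [W1] and [W2] have the
    same image under [X], hence they integrate functions of [X] alike. *)
Lemma weighted_transfer d1 (T1 : measurableType d1) d (T : measurableType d)
    (m : {measure set T1 -> \bar R}) (X : T1 -> T) (W1 W2 : T1 -> R) (f : T -> \bar R) :
  measurable_fun setT X -> measurable_fun setT W1 -> measurable_fun setT W2 ->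
  (forall w, 0 <= W1 w)%R -> (forall w, 0 <= W2 w)%R ->
  (forall B, measurable B ->
    \int[m]_(w in X @^-1` B) (W1 w)%:E = \int[m]_(w in X @^-1` B) (W2 w)%:E) ->
  measurable_fun setT f -> (forall t, 0 <= f t) ->
  \int[m]_w (f (X w) * (W1 w)%:E) = \int[m]_w (f (X w) * (W2 w)%:E).
Proof.
move=> mX mW1 mW2 W10 W20 E mf f0.
under eq_integral do rewrite muleC; under [RHS]eq_integral do rewrite muleC.
have mfX : measurable_fun setT (fun w => f (X w)) by exact: (measurableT_comp mf mX).
rewrite -(integral_density m mW1 W10 mfX)//.
rewrite -(integral_density m mW2 W20 mfX)//.
exact: (integral_transfer (m1 := density m mW1 W10) (m2 := density m mW2 W20) mX mX E mf f0).
Qed.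

Lemma integral_law d (Omega : measurableType d) (P : probability Omega R)
    d' (T : measurableType d') (X : Omega -> T) (Q : {measure set T -> \bar R})
    (f : T -> \bar R) : measurable_fun setT X ->
  (forall B, measurable B -> P (X @^-1` B) = Q B) ->
  measurable_fun setT f -> (forall t, 0 <= f t) ->
  \int[P]_w f (X w) = \int[Q]_t f t.
Proof. by move=> mX PQ mf f0; exact: (integral_transfer mX (@measurable_id _ _ setT)). Qed.

Lemma expectation_law d (Omega : measurableType d) (P : probability Omega R)
    d' (T : measurableType d') (X : Omega -> T) (Q : {measure set T -> \bar R})
    (f : T -> R) : measurable_fun setT X ->
  (forall B, measurable B -> P (X @^-1` B) = Q B) ->
  measurable_fun setT f -> (forall t, 0 <= f t)%R ->
  \int[P]_w (f (X w))%:E = \int[Q]_t (f t)%:E.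
Proof.
move=> mX PQ mf f0; apply: (integral_law (f := EFin \o f)) => //.
exact/measurable_EFinP.
Qed.

End transfer.

(** * Expectations determined by exponentials *)

Section independence.
Context {R : realType} d (Omega : measurableType d) (P : probability Omega R).

Lemma expectation_le1 (Y : Omega -> R) : measurable_fun setT Y ->
  (forall w, 0 <= Y w <= 1)%R -> 0 <= \int[P]_w (Y w)%:E <= 1.
Proof.
move=> mY Y01; apply/andP; split.
  by apply: integral_ge0 => w _; rewrite lee_fin; case/andP: (Y01 w).
have := @ge0_le_integral _ _ _ P setT measurableT (fun w => (Y w)%:E) (cst 1).
rewrite integral_cst1; apply => //.
- by move=> w _; rewrite lee_fin; case/andP: (Y01 w).
- exact/measurable_EFinP.
- by move=> w _; rewrite lee_fin; case/andP: (Y01 w).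
Qed.

Lemma expectation_fin (Y : Omega -> R) : measurable_fun setT Y ->
  (forall w, 0 <= Y w <= 1)%R -> \int[P]_w (Y w)%:E \is a fin_num.
Proof.
move=> mY Y01; have /andP[a b] := expectation_le1 mY Y01.
by rewrite ge0_fin_numE// (le_lt_trans b)// ltry.
Qed.

Lemma integrable01 (Y : Omega -> R) : measurable_fun setT Y ->
  (forall w, 0 <= Y w <= 1)%R -> P.-integrable setT (fun w => (Y w)%:E).
Proof.
move=> mY Y01; apply/integrableP; split; first exact/measurable_EFinP.
under eq_integral.
  move=> w _; rewrite gee0_abs; last by rewrite lee_fin; case/andP: (Y01 w).
  over.
by have /andP[_ /le_lt_trans] := expectation_le1 mY Y01; apply; exact: ltry.
Qed.

Lemma expectationB (f g : Omega -> R) :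
  measurable_fun setT f -> measurable_fun setT g ->
  (forall w, 0 <= f w <= 1)%R -> (forall w, 0 <= g w <= 1)%R ->
  \int[P]_w (f w - g w)%:E = \int[P]_w (f w)%:E - \int[P]_w (g w)%:E.
Proof.
move=> mf mg f01 g01; under eq_integral do rewrite EFinB.
by rewrite integralB//; exact: integrable01.
Qed.

Lemma expectationZr (f : Omega -> R) (c : R) : (0 <= c)%R ->
  measurable_fun setT f -> (forall w, 0 <= f w <= 1)%R ->
  \int[P]_w (f w * c)%:E = (fine (\int[P]_w (f w)%:E) * c)%:E.
Proof.
move=> c0 mf f01; under eq_integral do rewrite mulrC EFinM.
rewrite ge0_integralZl_EFin//; last 2 first.
- by move=> w _; rewrite lee_fin; case/andP: (f01 w).
- exact/measurable_EFinP.
by rewrite mulrC [RHS]EFinM fineK//; exact: expectation_fin.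
Qed.

End independence.

Definition unit_fun {R : realType} d (T : measurableType d) (f : T -> R) :=
  measurable_fun setT f /\ forall x, (0 <= f x <= 1)%R.

(** The two properties of an expectation, as a function of its integrand, on
    which the monotone class theorem relies. They also hold for the expectation
    of a kernel mean. *)
Definition daniell {R : realType} d (T : measurableType d) (A : (T -> R) -> \bar R) :=
  (forall f g, unit_fun f -> unit_fun g -> unit_fun (fun x => f x - g x)%R ->
    A (fun x => f x - g x)%R = A f - A g) /\
  (forall (u : nat -> T -> R) f, (forall n, unit_fun (u n)) -> unit_fun f ->
    (forall x, u n x @[n --> \oo] --> f x) -> A (u n) @[n --> \oo] --> A f).

Section unit_functions.
Context {R : realType}.

Lemma unit_indic d (T : measurableType d) (C : set T) : measurable C ->
  unit_fun (\1_C : T -> R).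
Proof. by move=> mC; split; [exact: measurable_indic|move=> x; exact: indic01]. Qed.

Lemma unit_comp d (T : measurableType d) d' (U : measurableType d') (f : U -> R) (X : T -> U) :
  measurable_fun setT X -> unit_fun f -> unit_fun (fun w => f (X w)).
Proof. by move=> mX [mf f01]; split => //; exact: (measurableT_comp mf mX). Qed.

Lemma unit_mul d (T : measurableType d) (f g : T -> R) : unit_fun f -> unit_fun g ->
  unit_fun (fun w => f w * g w)%R.
Proof.
by move=> [mf f01] [mg g01]; split=> [|w]; [exact: measurable_funM|exact: mul01].
Qed.

Lemma unit_prod d (T : measurableType d) (I : Type) (s : seq I) (D : pred I) (f : I -> T -> R) :
  (forall i, unit_fun (f i)) -> unit_fun (fun w => \prod_(i <- s | D i) f i w)%R.
Proof.
move=> uf; split=> [|w]; first by apply: measurable_fun_prod => i; case: (uf i).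
by apply: prod01 => i; case: (uf i).
Qed.

Lemma unit_eN d (T : measurableType d) (f : T -> \bar R) : measurable_fun setT f ->
  (forall w, 0 <= f w) -> unit_fun (fun w => eN (f w)).
Proof.
move=> mf f0; split=> [|w]; last by rewrite eN_ge0 eN_le1.
exact: (measurableT_comp measurable_eN mf).
Qed.

Section generated.
Context d (T : measurableType d) (J : Type) (l : J -> T -> \bar R).
Hypothesis l0 : forall j x, 0 <= l j x.
Hypothesis ml : forall j, measurable_fun setT (l j).

Lemma unit_fun_ind (H : set (T -> R)) :
  (forall f g, unit_fun f -> unit_fun g -> unit_fun (fun x => f x - g x)%R ->
    H f -> H g -> H (fun x => f x - g x)%R) ->
  (forall (u : nat -> T -> R) f, (forall n, unit_fun (u n)) -> unit_fun f ->
    (forall x, u n x @[n --> \oo] --> f x) -> (forall n, H (u n)) -> H f) ->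
  (forall s : seq J, H (fun x => eN (\sum_(j <- s) l j x))) ->
  forall C, <<s [set E | exists j B, measurable B /\ E = l j @^-1` B] >> C -> H \1_C.
Proof.
move=> Hdiff Hlim Hexp C HC.
suff [] : unit_fun (\1_C : T -> R) /\ H \1_C by [].
apply: (@functional_monotone_class R T J l l0 [set f | unit_fun f /\ H f] _ _ _ C HC).
- move=> f g [uf Hf] [ug Hg] fg.
  have ufg : unit_fun (fun x => f x - g x)%R.
    split; first by apply: measurable_funB; [case: uf|case: ug].
    move=> x; have [g0 [gf f1]] := fg x.
    by rewrite subr_ge0 gf/= lerBlDr (le_trans f1)// lerDl.
  by split => //; exact: Hdiff.
- move=> u f Hu u01 uf.
  have uu n : unit_fun (u n) by case: (Hu n).
  have uf' : unit_fun f.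
    split; first by apply: (measurable_fun_cvg (h := u)) => [n|x _]; [case: (uu n)|exact: uf].
    move=> x; have cvu : cvgn (u ^~ x) by apply/cvg_ex; exists (f x); exact: uf.
    rewrite -(cvg_lim _ (uf x))//; apply/andP; split.
      by apply: limr_ge => //; apply: nearW => n; case/andP: (u01 n x).
    by apply: limr_le => //; apply: nearW => n; case/andP: (u01 n x).
  by split => //; apply: (Hlim u) => // n; case: (Hu n).
- move=> s; split => //; apply: unit_eN; first exact: emeasurable_sum.
  by move=> x; exact: sume_ge0.
Qed.

(** The functions with the same expectation under [A] and [B] form a class to
    which the monotone class theorem applies. *)
Lemma daniell_unique (A B : (T -> R) -> \bar R) : daniell A -> daniell B ->
  (forall s : seq J, A (fun x => eN (\sum_(j <- s) l j x)) =
                     B (fun x => eN (\sum_(j <- s) l j x))) ->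
  forall C, <<s [set E | exists j B, measurable B /\ E = l j @^-1` B] >> C ->
    A \1_C = B \1_C.
Proof.
move=> [A1 A2] [B1 B2] AB; apply: (unit_fun_ind (H := [set f | A f = B f])) => //.
- by move=> f g uf ug ufg /= Hf Hg; rewrite A1// B1// Hf Hg.
- move=> u f uu uf cvg /= Hu; have Au := A2 _ _ uu uf cvg; have Bu := B2 _ _ uu uf cvg.
  by rewrite (funext Hu) in Au; exact: (cvg_unique _ Au Bu).
Qed.

End generated.

Context d (Omega : measurableType d) (P : probability Omega R).

Lemma daniell_expectation d' (T : measurableType d') (e : Omega -> R) (Y : Omega -> T) :
  unit_fun e -> measurable_fun setT Y ->
  daniell (fun f : T -> R => \int[P]_w (f (Y w) * e w)%:E).
Proof.
move=> ue mY; have u f : unit_fun f -> unit_fun (fun w => f (Y w) * e w)%R.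
  by move=> uf; apply: unit_mul => //; exact: unit_comp.
split=> [f g /u[? ?] /u[? ?] _|v f uv uf cvg].
  by rewrite -expectationB//; apply: eq_integral => w _; rewrite mulrBl.
apply: cvg_integral01.
- by move=> n; case: (u _ (uv n)).
- by move=> n; case: (u _ (uv n)).
- by move=> w; apply: cvgMl; exact: cvg.
Qed.

(** Exchanging the factor [i] is possible when the other factors may be treated
    as a fixed weight [W], and their product of expectations as a constant [c].
    Induction over the indices exchanges all of them. *)
Lemma product_rule_extend (I : finType) (C0 C1 : I -> set (Omega -> R)) :
  (forall i f, C0 i f \/ C1 i f -> unit_fun f) ->
  (forall i (W : Omega -> R) (c : R), unit_fun W -> (0 <= c <= 1)%R ->
    (forall f, C0 i f -> \int[P]_w (f w * W w)%:E = \int[P]_w (f w * c)%:E) ->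
    forall f, C1 i f -> \int[P]_w (f w * W w)%:E = \int[P]_w (f w * c)%:E) ->
  (forall f, (forall i, C0 i (f i)) -> \int[P]_w (\prod_i f i w)%R%:E =
    (\prod_i fine (\int[P]_w (f i w)%:E))%R%:E) ->
  forall f, (forall i, C1 i (f i)) -> \int[P]_w (\prod_i f i w)%R%:E =
    (\prod_i fine (\int[P]_w (f i w)%:E))%R%:E.
Proof.
move=> unit step base.
suff H (s : seq I) : uniq s -> forall f,
    (forall i, (if i \in s then C1 i else C0 i) (f i)) ->
    \int[P]_w (\prod_i f i w)%R%:E = (\prod_i fine (\int[P]_w (f i w)%:E))%R%:E.
  by move=> f Cf; apply: (H (enum I) (enum_uniq I)) => i; rewrite mem_enum; exact: Cf.
elim: s => [_ f Cf|i s IH /= /andP[i_s us] f Cf]; first exact: base.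
have uf j : unit_fun (f j) by have := Cf j; case: ifP => _ Cj; apply: (unit j); [right|left].
pose W w := (\prod_(j | j != i) f j w)%R.
have uW : unit_fun W by exact: unit_prod.
pose c := (\prod_(j | j != i) fine (\int[P]_w (f j w)%:E))%R.
have c01 : (0 <= c <= 1)%R.
  apply: prod01 => j; have [mf f01] := uf j; have /andP[a b] := expectation_le1 P mf f01.
  by rewrite fine_ge0//= -lee_fin fineK//; exact: expectation_fin.
have /andP[c0 _] := c01.
transitivity (\int[P]_w (f i w * W w)%:E).
  by apply: eq_integral => w _; rewrite (bigD1 i).
rewrite (step i W c) //; last by have := Cf i; rewrite in_cons eqxx.
  by rewrite expectationZr; [rewrite [in RHS](bigD1 i)|case: (uf i)..].
move=> g Cg; have [mg g01] : unit_fun g by apply: (unit i); left.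
rewrite expectationZr//.
pose f' j := if j == i then g else f j.
have f'i : f' i = g by rewrite /f' eqxx.
have f'E j : j != i -> f' j = f j by rewrite /f' => /negbTE ->.
have Cf' j : (if j \in s then C1 j else C0 j) (f' j).
  have [->|ji] := eqVneq j i; first by rewrite (negbTE i_s) f'i.
  by have := Cf j; rewrite in_cons (negbTE ji) f'E.
transitivity (\int[P]_w (\prod_j f' j w)%:E).
  apply: eq_integral => w _; rewrite (bigD1 i)//= f'i; congr (_ * _)%:E.
  by apply: eq_bigr => j /f'E ->.
rewrite (IH us f' Cf') (bigD1 i)//= f'i; congr (_ * _)%:E.
by apply: eq_bigr => j /f'E ->.
Qed.

Lemma prod_indic (I : finType) (E : I -> set Omega) w :
  (\prod_i \1_(E i) w)%R = (\1_(\bigcap_(i in [set: I]) E i) w : R).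
Proof.
have [wE|/existsNP[i nEi]] := pselect (forall i, E i w).
  by rewrite [RHS]indicE mem_set ?big1// => i _; rewrite indicE mem_set.
rewrite (bigD1 i)//= indicE memNset// mul0r indicE memNset//.
by move=> /(_ i Logic.I).
Qed.

(** The form of independence to which the exchange of factors applies. *)
Lemma independent_product (I : finType) (F : I -> set_system Omega) :
  (forall i A, F i A -> measurable A) ->
  mutually_independent P F <->
  forall E, (forall i, F i (E i)) -> \int[P]_w (\prod_i (\1_(E i) w : R))%R%:E =
    (\prod_i fine (\int[P]_w (\1_(E i) w)%:E))%R%:E.
Proof.
move=> mF; split=> H E FE; have mE i : measurable (E i) by exact: mF (FE i).
  under eq_integral do rewrite prod_indic.
  rewrite integral_indic ?setIT//; last exact: fin_bigcap_measurable.
  by etransitivity; [exact: (H E FE)|congr EFin; apply: eq_bigr => i _; rewrite integral_indic ?setIT].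
have := H E FE; under eq_integral do rewrite prod_indic.
rewrite integral_indic ?setIT//; last exact: fin_bigcap_measurable.
by move=> ->; congr EFin; apply: eq_bigr => i _; rewrite integral_indic ?setIT.
Qed.

(** The weight [W] and the constant [c] have the same integrals over the events
    of [F i], hence against the functions that are measurable for [F i]. *)
Lemma expectation_prod (I : finType) (F : I -> set_system Omega)
    (Y : I -> Omega -> R) :
  mutually_independent P F ->
  (forall i A, F i A -> measurable A) ->
  (forall i B, measurable B -> F i (Y i @^-1` B)) ->
  (forall i w, 0 <= Y i w <= 1)%R ->
  \int[P]_w (\prod_(i : I) Y i w)%R%:E =
  (\prod_(i : I) fine (\int[P]_w (Y i w)%:E))%R%:E.
Proof.
move=> indF mF YF Y01.
have mY i : measurable_fun setT (Y i).
  by move=> _ B mB; rewrite setTI; apply: (mF i); exact: YF.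
apply: (product_rule_extend (C0 := fun i => [set f | exists2 E, F i E & f = \1_E])
  (C1 := fun i => [set Y i])) => //.
- move=> i f [[E FE ->]|->]; last by split.
  by apply: unit_indic; exact: mF FE.
- move=> i W c [mW W01] /andP[c0 _] HC f ->.
  (* The absolute value is nonnegative on the whole line, as an integrand must be. *)
  have Yn w : (Y i w)%:E = `|Y i w|%:E by rewrite ger0_norm//; case/andP: (Y01 i w).
  under eq_integral do rewrite EFinM Yn; under [RHS]eq_integral do rewrite EFinM Yn.
  apply: (weighted_transfer (X := Y i) (W2 := cst c) (f := fun y : measurableTypeR R => `|y|%:E)) => //.
  + by move=> w; case/andP: (W01 w).
  + move=> B mB; have FB := YF i B mB; have := HC (\1_(Y i @^-1` B)).
    have ind (V : Omega -> R) : \int[P]_w (\1_(Y i @^-1` B) w * V w)%:E =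
        \int[P]_(w in Y i @^-1` B) (V w)%:E.
      rewrite [RHS]integral_mkcond; apply: eq_integral => w _; rewrite patchE indicE.
      by case: (_ \in _); rewrite ?mul1r ?mul0r.
    by rewrite !ind; apply; exists (Y i @^-1` B).
  + by apply/measurable_EFinP; exact: normr_measurable.
- move=> f Hf; have /choice[E HE] : forall i, exists E, F i E /\ f i = \1_E.
    by move=> i; have [E FE fE] := Hf i; exists E.
  have FE i : F i (E i) by case: (HE i).
  have := (independent_product mF).1 indF E FE.
  by rewrite (_ : f = fun i => \1_(E i))//; apply/funext => i; case: (HE i).
Qed.

End unit_functions.

(** * Laplace transforms and independence *)

Section disjoint.
Context {R : realType} (T : Type).

(** At most one term of the sum is nonzero. *)
Lemma disjoint_sum_fun (I : finType) (S : I -> set T) (a : I -> R)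
    (phi : R -> R) x : trivIset setT S -> phi 0%R = 0%R ->
  phi (\sum_i a i * \1_(S i) x)%R = (\sum_i phi (a i) * \1_(S i) x)%R.
Proof.
move=> tS phi0; have [[i Six]|nS] := pselect (exists i, S i x).
  have Sj j : j != i -> \1_(S j) x = 0%R :> R.
    move=> ji; rewrite indicE memNset// => Sjx; move/eqP : ji; apply.
    by apply: tS => //; exists x.
  rewrite (bigD1 i)//= [in RHS](bigD1 i)//= indicE mem_set// !mulr1.
  rewrite !big1 ?addr0// => j ji; rewrite Sj ?mulr0//.
have Sj j : \1_(S j) x = 0%R :> R.
  by rewrite indicE memNset// => Sjx; apply: nS; exists j.
by rewrite !big1// => j _; rewrite Sj mulr0.
Qed.

End disjoint.

Section laplace_unique.
Context {R : realType}.

Lemma sum_nseq_eN (s : seq unit) (y : \bar R) : 0 <= y ->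
  \sum_(j <- s) y = (size s)%:R%:E * y.
Proof.
move=> y0; elim: s => [|u s IH]; first by rewrite big_nil mul0e.
by rewrite big_cons IH /= -nat1r EFinD ge0_muleDl ?mul1e.
Qed.

(** The functions [e^(-k y)] for natural [k] are the exponentials of the sums of
    copies of a single function, which generates the Borel sigma-algebra of the
    nonnegative extended reals. *)
Lemma laplace_unique d1 (T1 : measurableType d1) (P1 : probability T1 R)
    (N1 : T1 -> \bar R) d2 (T2 : measurableType d2) (P2 : probability T2 R)
    (N2 : T2 -> \bar R) :
  measurable_fun setT N1 -> measurable_fun setT N2 ->
  (forall x, 0 <= N1 x) -> (forall x, 0 <= N2 x) ->
  (forall k : nat, \int[P1]_x (eN (k%:R%:E * N1 x))%:E =
                   \int[P2]_x (eN (k%:R%:E * N2 x))%:E) ->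
  forall B, measurable B -> P1 (N1 @^-1` B) = P2 (N2 @^-1` B).
Proof.
move=> mN1 mN2 N10 N20 NN B mB.
pose l (_ : unit) (y : \bar R) := `|y|.
have u1 d (T : measurableType d) : unit_fun (cst 1%R : T -> R).
  by split => // x; rewrite ler01 lexx.
have ext i (Ti : measurableType i) (Pi : probability Ti R) (N : Ti -> \bar R) (s : seq unit) :
    (forall x, 0 <= N x) -> \int[Pi]_x (eN (\sum_(j <- s) l j (N x)) * cst 1 x)%:E =
    \int[Pi]_x (eN ((size s)%:R%:E * N x))%:E.
  move=> N0; apply: eq_integral => x _.
  by rewrite mulr1 sum_nseq_eN /l ?gee0_abs.
have := @daniell_unique R _ (\bar R) unit l (fun _ y => abse_ge0 y) _ _ _
  (daniell_expectation P1 (u1 _ T1) mN1) (daniell_expectation P2 (u1 _ T2) mN2) _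
  (l tt @^-1` B) _.
have preim i (Ti : measurableType i) (Pi : probability Ti R) (N : Ti -> \bar R) :
    measurable_fun setT N -> (forall x, 0 <= N x) ->
    \int[Pi]_x (\1_(l tt @^-1` B) (N x) * cst 1 x)%:E = Pi (N @^-1` B).
  move=> mN N0.
  transitivity (\int[Pi]_x (\1_(N @^-1` B) x)%:E); last first.
    by rewrite integral_indic ?setIT//; exact: measurable_preimage.
  apply: eq_integral => x _; rewrite mulr1 !indicE; congr ((_ : bool)%:R)%:E.
  by apply/idP/idP => /set_mem xB; apply/mem_set; move: xB; rewrite /= /l gee0_abs.
rewrite !preim//; apply => //.
- by move=> j; exact: abse_measurable.
- by move=> s; rewrite /= !ext// NN.
- by apply: sub_sigma_algebra; exists tt, B.
Qed.

(** The exponentials of the multiples of [N i] determine expectations of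
    functions of [N i], so that each of them may be exchanged for the indicator of
    an event of [N i]. *)
Lemma indep_of_laplace d (Omega : measurableType d) (P : probability Omega R)
    (I : finType) (N : I -> Omega -> \bar R) :
  (forall i, measurable_fun setT (N i)) -> (forall i w, 0 <= N i w) ->
  (forall k : I -> nat, \int[P]_w (\prod_i eN ((k i)%:R%:E * N i w))%R%:E =
     (\prod_i fine (\int[P]_w (eN ((k i)%:R%:E * N i w))%:E))%R%:E) ->
  mutually_independent P (fun i => sigma_fun (N i)).
Proof.
move=> mN N0 hk.
have mF i A : sigma_fun (N i) A -> measurable A by move=> [B mB <-]; exact: mN.
apply: (proj2 (independent_product P mF)) => E EN.
apply: (@product_rule_extend R _ _ P I
  (fun i => [set f | exists k : nat, f = fun w => eN (k%:R%:E * N i w)])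
  (fun i => [set f | exists2 A, sigma_fun (N i) A & f = \1_A]) _ _ _ (fun i => \1_(E i))).
- move=> i f [[k ->]|[A /mF mA ->]]; last exact: unit_indic.
  by apply: unit_eN; [exact: measurable_funeM|move=> w; rewrite mule_ge0// lee_fin].
- move=> i W c uW c01 HC f [A [B mB <-] ->].
  have uc : unit_fun (cst c : Omega -> R) by split.
  apply: (@daniell_unique R _ Omega unit (fun _ => N i) (fun _ => N0 i) (fun _ => mN i) _ _
    (daniell_expectation P uW (@measurable_id _ Omega setT))
    (daniell_expectation P uc (@measurable_id _ Omega setT))).
    by move=> s /=; apply: HC; exists (size s); apply/funext => w; rewrite sum_nseq_eN.
  by rewrite setTI; apply: sub_sigma_algebra; exists tt, B.
- move=> f Hf; have /choice[k fk] := Hf.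
  by have := hk k; rewrite (_ : f = fun i w => eN ((k i)%:R%:E * N i w))//; exact/funext.
- by move=> i; exists (E i).
Qed.

End laplace_unique.

(** * Poisson processes *)

Section counts.
Context {R : realType}.

Lemma sum_prob_nat (Q : probability nat R) : \sum_(0 <= n <oo) Q [set n] = 1.
Proof.
rewrite -[RHS](probability_setT Q) (_ : [set: nat] = \bigcup_n [set n]); last first.
  by apply/seteqP; split => // n _; exists n.
rewrite measure_bigcup//; last by move=> i j _ _ [x [/= -> ->]].
by apply: eq_eseriesl => n; rewrite in_setT.
Qed.

(** The weights [e^(-y n)] turn the Poisson law with mean [l] into a multiple of
    the Poisson law with mean [e^-y l], whose total mass is [1]. *)
Lemma poisson_gf (l : R) (y : R) : (0 <= l)%R ->
  \sum_(0 <= n <oo) (expR (- (y * n%:R)))%:E * poisson_prob l 0 [set n] =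
  (eN ((1 - expR (- y))%:E * l%:E))%:E.
Proof.
rewrite le_eqVlt => /predU1P[<-|l0].
  rewrite mule0 eN0 -[RHS](sum_prob_nat \d_0%N).
  apply: eq_eseriesr => n _; rewrite /poisson_prob ltxx.
  rewrite diracE; case: (boolP (0%N \in [set n])) => [/set_mem /= <-|n0].
    rewrite mulr0 oppr0 expR0 mul1e; apply/esym; etransitivity; first exact: diracE.
    by rewrite mem_set.
  by rewrite mule0; apply/esym; etransitivity; [exact: diracE|rewrite (negbTE n0)].
pose l' := (expR (- y) * l)%R.
have l'0 : (0 < l')%R by rewrite mulr_gt0 ?expR_gt0.
transitivity (\sum_(0 <= n <oo) (expR (l' - l))%:E * (poisson_prob l' 0 [set n] : \bar R)).
  apply: eq_eseriesr => n _.
  have pE (a : R) : (0 < a)%R -> poisson_prob a 0 [set n] = (poisson_pmf a n)%:E.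
    by move=> a0; rewrite /poisson_prob a0 esum_set1// lee_fin poisson_pmf_ge0.
  rewrite !pE// -!EFinM /poisson_pmf l0 l'0; congr EFin.
  rewrite /l' exprMn -expRM_natr expRD !expRN mulNr.
  rewrite expRN.
  by field; rewrite !gt_eqF ?expR_gt0//= ltr0n fact_gt0.
rewrite nneseriesZl// sum_prob_nat mule1 /=; congr (expR _)%:E.
by rewrite /l'; ring.
Qed.

(** Counts take values in the natural numbers and infinity, so that their
    Laplace transform is a power series in [expR (- y)]. *)
Lemma count_gf d (T : measurableType d) (P : probability T R) (N : T -> \bar R)
    (y : R) : measurable_fun setT N ->
  (forall w, N w = +oo \/ exists n : nat, N w = n%:R%:E) -> (0 < y)%R ->
  \int[P]_w (eN (y%:E * N w))%:E =
  \sum_(0 <= n <oo) (expR (- (y * n%:R)))%:E * P [set w | N w = n%:R%:E].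
Proof.
move=> mN Nval y0.
have mA n : measurable [set w | N w = n%:R%:E].
  rewrite (_ : [set w | _] = N @^-1` [set n%:R%:E])//.
  exact: measurable_preimage.
transitivity (\int[P]_w \sum_(0 <= n <oo)
    ((expR (- (y * n%:R)))%:E * (\1_[set w | N w = n%:R%:E] w)%:E)).
  apply: eq_integral => w _.
  have [Nw|[n Nw]] := Nval w.
    rewrite Nw mulry gtr0_sg// mul1e /= eseries0// => n _ _.
    by rewrite indicE memNset ?mule0//= Nw.
  rewrite Nw -EFinM /= (nneseriesD1 (n := n))//.
  rewrite indicE mem_set//= mule1 eseries0 ?adde0// => k _ /= kn.
  rewrite indicE memNset ?mule0//= Nw => -[] /eqP; rewrite eqr_nat => /eqP nk.
  by move: kn; rewrite nk eqxx.
rewrite integral_nneseries//; last first.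
  by move=> n; apply: measurable_funeM; exact/measurable_EFinP.
apply: eq_eseriesr => n _; rewrite ge0_integralZl_EFin//.
- by rewrite integral_indic ?setIT.
- by apply/measurable_EFinP.
Qed.

End counts.

Section point_process.
Context {R : realType} d (Omega : measurableType d) (P : probability Omega R).
Context d' (T : measurableType d') (p : nat -> Omega -> T).
Hypothesis mp : forall k, measurable_fun setT (p k).

Definition psum (f : T -> \bar R) (w : Omega) : \bar R :=
  \sum_(0 <= k <oo) f (p k w).

Lemma psum_ge0 f w : (forall t, 0 <= f t) -> 0 <= psum f w.
Proof. by move=> f0; apply: nneseries_ge0. Qed.

Lemma measurable_psum f : measurable_fun setT f -> (forall t, 0 <= f t) ->
  measurable_fun setT (psum f).
Proof.
move=> mf f0; apply: (@ge0_emeasurable_sum _ _ _ _ (fun k w => f (p k w)) xpredT) => //.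
by move=> k _; exact: measurableT_comp.
Qed.

Lemma point_countE (S : set T) :
  point_count R p S = psum (fun t => (\1_S t)%:E).
Proof.
apply/funext => w; rewrite /point_count counting_dirac.
apply: eq_eseriesr => k _; by rewrite diracE indicE; congr ((_ : bool)%:R)%:E.
Qed.

Lemma point_count_val (S : set T) w :
  point_count R p S w = +oo :> \bar R \/ exists n : nat, point_count R p S w = n%:R%:E :> \bar R.
Proof.
rewrite /point_count /counting; case: ifP => _; last by left.
by right; eexists.
Qed.

Lemma measurable_point_count (S : set T) : measurable S ->
  measurable_fun setT (point_count R p S : Omega -> \bar R).
Proof.
move=> mS; rewrite point_countE; apply: measurable_psum.
  exact/measurable_EFinP.
by move=> t; rewrite lee_fin.
Qed.

Lemma psumZ (c : R) f w : (forall t, 0 <= f t) ->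
  psum (fun t => c%:E * f t) w = c%:E * psum f w.
Proof. by move=> f0; rewrite /psum nneseriesZl. Qed.

Lemma psum_sum (I : Type) (s : seq I) (f : I -> T -> \bar R) w :
  (forall i t, 0 <= f i t) ->
  psum (fun t => \sum_(i <- s) f i t) w = \sum_(i <- s) psum (f i) w.
Proof. by move=> f0; rewrite /psum nneseries_sum. Qed.

Lemma psum_cvg (u : nat -> T -> \bar R) f w : (forall n t, 0 <= u n t) ->
  (forall t, nondecreasing_seq (u ^~ t)) ->
  (forall t, u n t @[n --> \oo] --> f t) ->
  psum (u n) w @[n --> \oo] --> psum f w.
Proof. by move=> u0 und uf; apply: nneseries_monotone. Qed.

(** Sums over the points are determined by the counts. *)
Lemma psum_sigma_family f : measurable_fun setT f -> (forall t, 0 <= f t) ->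
  forall B, measurable B ->
  sigma_family measurable (fun S => point_count R p S : Omega -> \bar R) (psum f @^-1` B).
Proof.
move=> mf f0.
pose Oc := g_sigma_algebraType [set E | exists S, measurable S /\
  sigma_fun (point_count R p S : Omega -> \bar R) E].
suff mF : measurable_fun setT (psum f : Oc -> \bar R).
  by move=> B mB; have := mF measurableT B mB; rewrite setTI.
pose Q := [set f : T -> \bar R | measurable_fun setT (psum f : Oc -> \bar R)].
apply: (@nnfun_ind _ _ T Q) => //.
- move=> A mA _ B mB; rewrite setTI -point_countE; apply: sub_sigma_algebra.
  by exists A; split => //; exists B => //; rewrite setTI.
- move=> c g c0 g0 Qg; rewrite /Q /=.
  have -> : psum (fun t => c%:E * g t) = fun w => c%:E * psum g w.
    by apply/funext => w; rewrite psumZ.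
  exact: measurable_funeM.
- move=> g1 g2 g10 g20 Qg1 Qg2; rewrite /Q /=.
  have -> : psum (fun t => g1 t + g2 t) = fun w => psum g1 w + psum g2 w.
    by apply/funext => w; rewrite /psum nneseriesD.
  exact: emeasurable_funD.
- move=> u g uQ u0 und ug; rewrite /Q /=.
  apply: (emeasurable_fun_cvg (fun n => psum (u n) : Oc -> \bar R)) => //.
  by move=> w _; exact: psum_cvg.
Qed.

Lemma count_laplace (l : R) (S : set T) (y : R) : measurable S -> (0 <= l)%R ->
  (0 < y)%R ->
  (forall n : nat, P [set w | point_count R p S w = n%:R%:E :> \bar R] = poisson_prob l 0 [set n]) ->
  \int[P]_w (eN (y%:E * point_count R p S w))%:E = (eN ((1 - expR (- y))%:E * l%:E))%:E.
Proof.
move=> mS l0 y0 pl.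
rewrite count_gf//; last exact: point_count_val.
  rewrite -poisson_gf//; apply: eq_eseriesr => n _; congr (_ * _); exact: pl.
exact: measurable_point_count.
Qed.

End point_process.

Section poisson_laplace.
Context {R : realType} d (Omega : measurableType d) (P : probability Omega R).
Context d' (T : measurableType d') (mu : {measure set T -> \bar R}).
Context (p : nat -> Omega -> T) (mp : forall k, measurable_fun setT (p k)).

(** When the mean is infinite, all probabilities of finite counts vanish, and so
    do both sides unless [y = 0]. *)
Lemma poisson_count_laplace (S : set T) (y : R) : poisson_points P mu p ->
  measurable S -> (0 <= y)%R ->
  \int[P]_w (eN (y%:E * point_count R p S w))%:E =
  (eN ((1 - expR (- y))%:E * mu S))%:E.
Proof.
move=> [pp _] mS; rewrite le_eqVlt => /predU1P[<-|y0].
  rewrite oppr0 expR0 subrr mul0e eN0.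
  under eq_integral do rewrite mul0e eN0.
  exact: integral_cst1.
have := pp S ^~ mS.
case: (boolP (mu S \is a fin_num)) => [muS|muS] ppS.
  by rewrite (count_laplace mp mS _ y0 ppS) ?fineK ?fine_ge0.
have -> : mu S = +oo.
  by move: muS; rewrite ge0_fin_numE// -leNgt leye_eq => /eqP.
rewrite count_gf//; last 2 first.
- exact: measurable_point_count.
- exact: point_count_val.
rewrite eseries0; last by move=> n _ _; rewrite [X in _ * X]ppS mule0.
by rewrite mulry gtr0_sg ?mul1e// subr_gt0 -[ltRHS]expR0 ltr_expR oppr_lt0.
Qed.

(** On [S i] the integrand is constant. *)
Lemma integral_onem_eN_sum (I : finType) (S : I -> set T) (a : I -> R) :
  (forall i, measurable (S i)) -> trivIset setT S -> (forall i, 0 <= a i)%R ->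
  \int[mu]_t (1 - eN (\sum_i (a i * \1_(S i) t)%:E))%R%:E =
  \sum_i (1 - expR (- a i))%:E * mu (S i).
Proof.
move=> mS tS a0.
have e0 i : (0 <= 1 - expR (- a i))%R.
  by rewrite subr_ge0 -expR0 ler_expR oppr_le0.
transitivity (\int[mu]_t (\sum_i (1 - expR (- a i))%:E * (\1_(S i) t)%:E)).
  apply: eq_integral => t _; rewrite sumEFin /=.
  rewrite (@disjoint_sum_fun R T I S a (fun y => 1 - expR (- y))%R)//.
    by rewrite -sumEFin.
  by rewrite oppr0 expR0 subrr.
rewrite ge0_integral_sum//.
- apply: eq_bigr => i _; rewrite ge0_integralZl_EFin//.
    by rewrite integral_indic ?setIT.
  exact/measurable_EFinP.
- by move=> i; apply: measurable_funeM; exact/measurable_EFinP.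
- by move=> i t _; rewrite mule_ge0// lee_fin.
Qed.

Lemma laplace_disjoint_sum (I : finType) (S : I -> set T) (a : I -> R) :
  (forall i, measurable (S i)) -> trivIset setT S -> (forall i, 0 <= a i)%R ->
  mutually_independent P (fun i => sigma_fun (point_count R p (S i) : Omega -> \bar R)) ->
  (forall i, \int[P]_w (eN ((a i)%:E * point_count R p (S i) w))%:E =
    (eN ((1 - expR (- a i))%:E * mu (S i)))%:E) ->
  \int[P]_w (eN (psum p (fun t => \sum_i (a i * \1_(S i) t)%:E) w))%:E =
  (eN (\int[mu]_t (1 - eN (\sum_i (a i * \1_(S i) t)%:E))%R%:E))%:E.
Proof.
move=> mS tS a0 indS laS.
have mC i := measurable_point_count mp (mS i).
have C0 i w : 0 <= point_count R p (S i) w :> \bar R.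
  by rewrite point_countE psum_ge0// => t; rewrite lee_fin.
have aC0 i w : 0 <= (a i)%:E * (point_count R p (S i) w : \bar R).
  by rewrite mule_ge0// lee_fin.
transitivity (\int[P]_w (\prod_i eN ((a i)%:E * (point_count R p (S i) w)))%R%:E).
  apply: eq_integral => w _; rewrite -eN_sum//; congr (eN _)%:E.
  rewrite psum_sum; last by move=> i t; rewrite lee_fin mulr_ge0.
  apply: eq_bigr => i _; by rewrite point_countE -psumZ.
rewrite (expectation_prod (F := fun i => sigma_fun (point_count R p (S i) : Omega -> \bar R)))//.
- rewrite integral_onem_eN_sum// eN_sum.
    by congr EFin; apply: eq_bigr => i _; rewrite laS.
  move=> i; rewrite mule_ge0// lee_fin subr_ge0 -expR0 ler_expR oppr_le0//.
- by move=> i _ [B mB <-]; exact: mC.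
- move=> i B mB; exists ((fun y => eN ((a i)%:E * y)) @^-1` B); last by rewrite setTI.
  rewrite -[X in measurable X]setTI.
  by apply: (measurableT_comp measurable_eN (measurable_funeM (a i)%:E (@measurable_id _ _ setT))).
- by move=> i w; rewrite eN_ge0 eN_le1.
Qed.

(** The Laplace functional of a Poisson process: for step functions it
    factorizes over the disjoint steps, and the general case is a monotone
    limit. *)
Lemma poisson_laplace (f : T -> \bar R) : poisson_points P mu p ->
  measurable_fun setT f -> (forall t, 0 <= f t) ->
  \int[P]_w (eN (psum p f w))%:E = (eN (\int[mu]_t (1 - eN (f t))%R%:E))%:E.
Proof.
move=> pp mf f0.
pose g := nnsfun_approx measurableT mf.
pose u n t : \bar R := (g n t)%:E.
have u0 n t : 0 <= u n t by rewrite lee_fin.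
have und t : nondecreasing_seq (u ^~ t).
  by move=> m n mn; rewrite lee_fin; have /lefP := nd_nnsfun_approx measurableT mf mn; exact.
have uf t : u n t @[n --> \oo] --> f t.
  by have := cvg_nnsfun_approx measurableT mf (fun x _ => f0 x) (Logic.I : setT t); exact.
have mu_ n : measurable_fun setT (u n) by exact/measurable_EFinP.
have uE n : \int[P]_w (eN (psum p (u n) w))%:E = (eN (\int[mu]_t (1 - eN (u n t))%R%:E))%:E.
  pose s := finmap.enum_fset (fset_set (range (g n))).
  have -> : u n = fun t => \sum_(i < size s) (s`_i * \1_(g n @^-1` [set s`_i]) t)%:E.
    by apply/funext => t; rewrite sumEFin /u (fimfunEord (g n)).
  apply: laplace_disjoint_sum => //.
  - exact: nnsfun_trivIset.
  - by move=> i; exact: nnsfun_range_ge0.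
  - by case: pp => _; apply => //; exact: nnsfun_trivIset.
  - by move=> i; apply: poisson_count_laplace => //; exact: nnsfun_range_ge0.
have e01 (y : \bar R) : 0 <= y -> (0 <= 1 - eN y)%R by move=> y0; rewrite subr_ge0 eN_le1.
have h1 : \int[P]_w (eN (psum p (u n) w))%:E @[n --> \oo] --> \int[P]_w (eN (psum p f w))%:E.
  apply: cvg_integral01.
  - move=> n; apply: measurableT_comp; first exact: measurable_eN.
    exact: measurable_psum.
  - by move=> n w; rewrite eN_ge0 eN_le1// psum_ge0.
  - move=> w; apply: cvg_eN; [by move=> n; exact: psum_ge0|exact: psum_ge0|exact: psum_cvg].
have h2 : (eN (\int[mu]_t (1 - eN (u n t))%R%:E)) @[n --> \oo] -->
    eN (\int[mu]_t (1 - eN (f t))%R%:E).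
  apply: cvg_eN.
  - by move=> n; apply: integral_ge0 => t _; rewrite lee_fin e01.
  - by apply: integral_ge0 => t _; rewrite lee_fin e01.
  have -> : (fun t => (1 - eN (f t))%R%:E) = fun t => limn (fun n => (1 - eN (u n t))%R%:E).
    apply/funext => t; apply/esym/cvg_lim => //; apply: cvg_EFin; first exact: nearW.
    by apply: cvgB; [exact: cvg_cst|exact: cvg_eN].
  apply: cvg_monotone_convergence => //.
  - move=> n; apply/measurable_EFinP; apply: measurable_funB => //.
    by apply: measurableT_comp => //; exact: measurable_eN.
  - by move=> n t _; rewrite lee_fin e01.
  - by move=> t _ m n mn; rewrite lee_fin lerD2l lerN2 le_eN//; exact: und.
have uE' : (fun n => \int[P]_w (eN (psum p (u n) w))%:E) =
    (fun n => (eN (\int[mu]_t (1 - eN (u n t))%R%:E))%:E) by exact/funext.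
rewrite uE' in h1; apply: (cvg_unique _ h1) => //.
by apply: cvg_EFin; [exact: nearW|exact: h2].
Qed.

(** Conversely, the Laplace functional at step functions yields the Laplace
    transforms of the counts, and their product form for disjoint sets; these
    determine the laws of the counts and their independence. *)
Lemma poisson_of_laplace :
  (forall f : T -> \bar R, measurable_fun setT f -> (forall t, 0 <= f t) ->
    \int[P]_w (eN (psum p f w))%:E = (eN (\int[mu]_t (1 - eN (f t))%R%:E))%:E) ->
  poisson_points P mu p.
Proof.
move=> lap.
have la1 S (y : R) : measurable S -> (0 <= y)%R ->
    \int[P]_w (eN (y%:E * point_count R p S w))%:E = (eN ((1 - expR (- y))%:E * mu S))%:E.
  move=> mS y0; have := lap (fun t => (y * \1_S t)%:E) _ _.
  have -> : psum p (fun t => (y * \1_S t)%:E) = fun w => y%:E * point_count R p S w.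
    apply/funext => w; by rewrite point_countE -psumZ.
  move=> ->; last 2 first.
  - by apply/measurable_EFinP; apply: measurable_funM.
  - by move=> t; rewrite lee_fin mulr_ge0.
  have := @integral_onem_eN_sum unit (fun=> S) (fun=> y) (fun=> mS) _ (fun=> y0).
  rewrite big_const card_unit/= adde0 => <-.
    by congr (eN _)%:E; apply: eq_integral => t _; rewrite big_const card_unit/= addr0.
  by move=> [] [].
have C0 S w : 0 <= point_count R p S w :> \bar R.
  by rewrite point_countE psum_ge0// => t; rewrite lee_fin.
split.
  move=> S n mS; have mC := measurable_point_count mp mS.
  case: ifPn => [muS|muS].
    have l0 : (0 <= fine (mu S))%R by rewrite fine_ge0.
    (* The identity of [nat] under its Poisson law has the Laplace transform of the
       count. *)
    pose N2 (n : nat) : \bar R := n%:R%:E.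
    have -> : poisson_prob (fine (mu S)) 0 [set n] =
        poisson_prob (fine (mu S)) 0 (N2 @^-1` [set n%:R%:E]).
      congr poisson_prob; apply/seteqP; split => k /=; first by move=> ->.
      by case=> /eqP; rewrite eqr_nat => /eqP.
    apply: (laplace_unique (N1 := point_count R p S) (N2 := N2)) => //.
      by move=> k; rewrite lee_fin.
    move=> k; case: k => [|k].
      under eq_integral do rewrite mul0e eN0.
      under [in RHS]eq_integral do rewrite mul0e eN0.
      by rewrite !integral_cst1.
    rewrite la1// count_gf//; last by move=> w; right; exists w.
    rewrite -{1}(fineK muS) -poisson_gf//.
    apply: eq_eseriesr => m _; congr (_ * poisson_prob _ _ _).
    apply/seteqP; split => j /=; first by move=> ->.
    by case=> /eqP; rewrite eqr_nat => /eqP.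
  have muSy : mu S = +oo.
    by move: muS; rewrite ge0_fin_numE// -leNgt leye_eq => /eqP.
  have := la1 S 1%R mS ler01.
  rewrite muSy mulry gtr0_sg; last by rewrite subr_gt0 -[ltRHS]expR0 ltr_expR oppr_lt0.
  rewrite mul1e /= count_gf//; last exact: point_count_val.
  have t0 k : 0 <= (expR (- (1 * k%:R)))%:E * P [set w | point_count R p S w = k%:R%:E :> \bar R].
    by rewrite mule_ge0// lee_fin expR_ge0.
  move=> s0.
  have : (expR (- (1 * n%:R)))%:E * P [set w | point_count R p S w = n%:R%:E :> \bar R] <= 0.
    rewrite -[leRHS]s0 (nneseriesD1 (n := n))//.
    by rewrite leeDl// nneseries_ge0.
  move=> le0; apply/eqP.
  have : (expR (- (1 * n%:R)))%:E * P [set w | point_count R p S w = n%:R%:E :> \bar R] == 0.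
    by rewrite eq_le le0 t0.
  by rewrite mule_eq0 eqe gt_eqF ?expR_gt0.
move=> K S mS tS; apply: indep_of_laplace => //.
  by move=> i; exact: measurable_point_count.
move=> k.
have := lap (fun t => \sum_i ((k i)%:R * \1_(S i) t)%:E) _ _.
rewrite integral_onem_eN_sum// eN_sum; last first.
  by move=> i; rewrite mule_ge0// lee_fin subr_ge0 -expR0 ler_expR oppr_le0.
have -> : (\prod_i eN ((1 - expR (- (k i)%:R))%:E * mu (S i)) =
    \prod_i fine (\int[P]_w (eN ((k i)%:R%:E * point_count R p (S i) w))%:E))%R.
  by apply: eq_bigr => i _; rewrite la1.
move=> <-.
  - apply: eq_integral => w _; rewrite -eN_sum; last first.
      by move=> i; rewrite mule_ge0// lee_fin.
    congr (eN _)%:E; rewrite psum_sum; last first.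
      by move=> i t; rewrite lee_fin mulr_ge0.
    apply: eq_bigr => i _; by rewrite point_countE -psumZ.
  - by apply: emeasurable_sum => i; apply/measurable_EFinP; exact: measurable_funM.
  - by move=> t; apply: sume_ge0 => i _; rewrite lee_fin mulr_ge0.
Qed.

End poisson_laplace.

(** * Marked atoms *)

Section crm_laplace.
Context {R : realType}.

Lemma prod_option (I : finType) (f : option I -> R) :
  (\prod_i f i = f None * \prod_k f (Some k))%R.
Proof.
rewrite (bigD1 None)//=; congr (_ * _)%R.
rewrite (reindex_omap (@Some I) id)/=; last by case.
by apply: eq_bigl => k; rewrite eqxx.
Qed.

Context dPsi (Psi : measurableType dPsi) d (Omega : measurableType d)
  (P : probability Omega R) (I : finType) (psi_fix : I -> Psi)
  (F : I -> probability (measurableTypeR R) R)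
  (mu : {measure set (measurableTypeR R * Psi) -> \bar R})
  (theta : I + nat -> Omega -> measurableTypeR R)
  (psi : I + nat -> Omega -> Psi)
  (Hcrm : crm_atoms P psi_fix F mu theta psi).

Let pt k w := (theta (inr k) w, psi (inr k) w).

Lemma measurable_ordinary_point k : measurable_fun setT (pt k).
Proof.
apply/measurable_fun_pairP; split.
  exact: crm_theta_measurable Hcrm _.
exact: crm_psi_measurable Hcrm _.
Qed.

(** The fixed-location weights are independent of the point process, and the sum
    over the points is a function of its counts. *)
Lemma crm_laplace (phi : I -> measurableTypeR R -> R) (f : measurableTypeR R * Psi -> \bar R) :
  (forall k, measurable_fun setT (phi k)) ->
  (forall k t, 0 <= phi k t <= 1)%R ->
  measurable_fun setT f -> (forall t, 0 <= f t) ->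
  \int[P]_w ((\prod_k phi k (theta (inl k) w)) * eN (psum pt f w))%R%:E =
  ((\prod_k fine (\int[F k]_t (phi k t)%:E)) *
     eN (\int[mu]_t (1 - eN (f t))%R%:E))%R%:E.
Proof.
move=> mphi phi01 mf f0.
pose Y (j : option I) w := if j is Some k then phi k (theta (inl k) w) else eN (psum pt f w).
have mpt := measurable_ordinary_point.
have := expectation_prod (Y := Y) (crm_indep Hcrm).
under eq_integral do rewrite prod_option mulrC.
rewrite prod_option mulrC => ->.
- congr (_ * _)%:E.
    apply: eq_bigr => k _; congr fine; 
    apply: (@expectation_law R _ _ P _ (measurableTypeR R) (theta (inl k)) (F k) (phi k)) => //.
    + exact: crm_theta_measurable Hcrm _.
    + by move=> B mB; exact: (crm_theta_fix Hcrm).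
    + by move=> t; case/andP: (phi01 k t).
  by rewrite /Y (poisson_laplace (mu := mu))//; exact: crm_poisson Hcrm.
- move=> [k|] A /=.
    by move=> [B mB <-]; apply: (crm_theta_measurable Hcrm).
  move: A; apply: smallest_sub; first exact: sigma_algebra_measurable.
  move=> _ [S [mS [B mB <-]]].
  exact: (measurable_point_count mpt).
- move=> [k|] B mB /=.
    exists (phi k @^-1` B); last by rewrite setTI.
    exact: measurable_preimage.
  rewrite /Y (_ : _ @^-1` B = psum pt f @^-1` (eN @^-1` B))//.
  apply: psum_sigma_family => //.
  by apply: measurable_preimage => //; exact: measurable_eN.
- by move=> [k|] w /=; [exact: phi01|rewrite eN_ge0 eN_le1// psum_ge0].
Qed.

End crm_laplace.

Definition mixture {R : realType} (h : nat -> R -> R) (t : R) (v : nat -> R) : R :=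
  fine (\sum_(0 <= n <oo) (h n t * v n)%:E).

Section mixtures.
Context {R : realType} (h : nat -> R -> R).
Hypothesis h0 : forall n t, (0 <= h n t)%R.
Hypothesis h1 : forall t, \sum_(0 <= n <oo) (h n t)%:E = 1.

Lemma pmf_le1 n t : (h n t <= 1)%R.
Proof.
rewrite -lee_fin -(h1 t) (nneseriesD1 (n := n))//; last by move=> k _; rewrite lee_fin.
by rewrite leeDl// nneseries_ge0// => k _ _; rewrite lee_fin.
Qed.

Lemma mixture_sum_le1 (v : nat -> R) t : (forall n, 0 <= v n <= 1)%R ->
  0 <= \sum_(0 <= n <oo) (h n t * v n)%:E <= 1.
Proof.
move=> v01; have hv0 n : 0 <= (h n t * v n)%:E.
  by rewrite lee_fin mulr_ge0//; case/andP: (v01 n).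
rewrite nneseries_ge0//= -(h1 t); apply: lee_nneseries => // n _.
by rewrite lee_fin ler_piMr//; case/andP: (v01 n).
Qed.

Lemma mixtureE t (v : nat -> R) : (forall n, 0 <= v n <= 1)%R ->
  (mixture h t v)%:E = \sum_(0 <= n <oo) (h n t * v n)%:E.
Proof.
move=> v01; have /andP[a b] := mixture_sum_le1 t v01.
by rewrite fineK// ge0_fin_numE// (le_lt_trans b)// ltry.
Qed.

Lemma mixture01 t (v : nat -> R) : (forall n, 0 <= v n <= 1)%R ->
  (0 <= mixture h t v <= 1)%R.
Proof. by move=> v01; rewrite -!lee_fin mixtureE//; exact: mixture_sum_le1. Qed.

Lemma mixture_cst1 t : mixture h t (fun=> 1%R) = 1%R.
Proof. by rewrite /mixture; under eq_eseriesr do rewrite mulr1; rewrite h1. Qed.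

Lemma onem_mixture t v : (forall n, 0 <= v n <= 1)%R ->
  (1 - mixture h t v)%:E = \sum_(0 <= n <oo) (h n t * (1 - v n))%:E.
Proof.
move=> v01; rewrite EFinB; apply/eqP; rewrite sube_eq//; last exact: fin_num_adde_defl.
rewrite mixtureE// -nneseriesD.
- rewrite -(h1 t); apply/eqP/eq_eseriesr => n _.
  by rewrite -EFinD -mulrDr subrK mulr1.
- by move=> n _ _; rewrite lee_fin mulr_ge0// subr_ge0; case/andP: (v01 n).
- by move=> n _ _; rewrite lee_fin mulr_ge0//; case/andP: (v01 n).
Qed.

Lemma unit_mixture d (T : measurableType d) (g : T -> R) (v : T -> nat -> R) :
  (forall n, measurable_fun setT (h n)) ->
  measurable_fun setT g -> (forall n, unit_fun (v ^~ n)) ->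
  unit_fun (fun p => mixture h (g p) (v p)).
Proof.
move=> mh mg uv; split=> [|p]; last by apply: mixture01 => n; case: (uv n).
apply: measurableT_comp; first exact: fine_measurable.
apply: (@ge0_emeasurable_sum _ _ _ _ (fun n p => (h n (g p) * v p n)%:E) xpredT).
  by move=> n p _ _; rewrite lee_fin mulr_ge0//; case: (uv n) => _ /(_ p) /andP[].
move=> n _; apply/measurable_EFinP; apply: measurable_funM; last by case: (uv n).
exact: (measurableT_comp (mh n) mg).
Qed.

End mixtures.

Section marks.
Context {R : realType} dPsi (Psi : measurableType dPsi) d (Omega : measurableType d)
  (P : probability Omega R) (J : choiceType).
Context (theta : J -> Omega -> measurableTypeR R) (psi : J -> Omega -> Psi).
Context (h : nat -> R -> R) (x : J -> Omega -> nat).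
Hypothesis mtheta : forall i, measurable_fun setT (theta i).
Hypothesis mpsi : forall i, measurable_fun setT (psi i).
Hypothesis mh : forall n, measurable_fun setT (h n).
Hypothesis h0 : forall n t, (0 <= h n t)%R.
Hypothesis h1 : forall t, \sum_(0 <= n <oo) (h n t)%:E = 1.
Hypothesis Hx : conditionally_independent_marks P theta psi h x.

Let pr i w := (theta i w, psi i w).

Let mpr i : measurable_fun setT (pr i).
Proof. by apply/measurable_fun_pairP; split; [exact: mtheta|exact: mpsi]. Qed.

(** [Omega] with the sigma-algebra of the points. *)
Let Oc := g_sigma_algebraType [set E | exists i, [set: J] i /\ sigma_fun (pr i) E].

Let Oc_sub (A : set Omega) : measurable (A : set Oc) -> measurable A.
Proof.
move: A; apply: smallest_sub; first exact: sigma_algebra_measurable.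
by move=> _ [i [_ [B mB <-]]]; exact: mpr.
Qed.

Let Oc_pr i : measurable_fun (setT : set Oc) (pr i).
Proof.
move=> _ B mB; apply: sub_sigma_algebra; exists i; split => //.
by exists B.
Qed.

Let ev_x (s : seq J) (n : J -> nat) := [set w | forall i, i \in s -> x i w = n i].

Let mev_x s n : measurable (ev_x s n).
Proof.
elim: s => [|i s IH]; first by rewrite (_ : ev_x _ _ = setT)//; apply/seteqP; split.
rewrite (_ : ev_x _ _ = x i @^-1` [set n i] `&` ev_x s n).
  apply: measurableI => //; rewrite -[X in measurable X]setTI.
  by case: Hx => mx _; exact: mx.
apply/seteqP; split => w /=.
  by move=> H; split=> [|j js]; apply: H; rewrite in_cons ?eqxx// js orbT.
by move=> [H1 H2] j; rewrite in_cons => /predU1P[->//|]; exact: H2.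
Qed.

Let unit_h (s : seq J) (n : J -> nat) :
  unit_fun (fun w => (\prod_(i <- s) h (n i) (theta i w))%R).
Proof.
apply: unit_prod => i; split=> [|w]; last by rewrite h0 (pmf_le1 h0 h1).
exact: (measurableT_comp (mh _) (mtheta i)).
Qed.

Let unit_ev s n : unit_fun (\1_(ev_x s n) : Omega -> R).
Proof. exact/unit_indic/mev_x. Qed.

(** The conditional probability of given values of finitely many marks is
    assumed on the events of the points, and extends to integrals of functions
    of the points. *)
Lemma marks_indicator (s : seq J) (n : J -> nat) (Z : Oc -> R) : uniq s -> unit_fun Z ->
  \int[P]_w (Z w * \1_(ev_x s n) w)%:E =
  \int[P]_w (Z w * \prod_(i <- s) h (n i) (theta i w))%:E.
Proof.
move=> us [mZ Z01].
under eq_integral do rewrite EFinM; under [RHS]eq_integral do rewrite EFinM.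
have [mI I01] := unit_ev s n; have [mprod prod01] := unit_h s n.
apply: (weighted_transfer (X := (id : Omega -> Oc)) (f := EFin \o Z)) => //=.
- by move=> _ B mB; rewrite setTI; exact: Oc_sub.
- by move=> w; case/andP: (prod01 w).
- move=> A mA; case: Hx => _ /(_ s n A us mA) => <-.
  rewrite integral_mkcond -[A `&` _]setIT -integral_indic//; last exact/measurableI/mev_x/Oc_sub.
  apply: eq_integral => w _; rewrite patchE (_ : (w \in id @^-1` A) = (w \in A))//.
  by rewrite indicI /= [X in (X * _)%R]indicE; case: (w \in A); rewrite ?mul1r ?mul0r.
- exact/measurable_EFinP.
- by move=> w; rewrite lee_fin; case/andP: (Z01 w).
Qed.

(** Averaging out the marks one index at a time: the mark of the next index is
    fixed to a value, over which the sum is then taken. *)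
Lemma marks_average (phi : J -> measurableTypeR R * Psi -> nat -> R) :
  (forall i n, unit_fun ((phi i) ^~ n)) ->
  forall (s2 s1 : seq J) (n : J -> nat) (Z : Oc -> R), uniq (s2 ++ s1) -> unit_fun Z ->
  \int[P]_w (Z w * \1_(ev_x s1 n) w * \prod_(i <- s2) phi i (pr i w) (x i w))%R%:E =
  \int[P]_w (Z w * (\prod_(i <- s1) h (n i) (theta i w)) *
     \prod_(i <- s2) mixture h (theta i w) (phi i (pr i w)))%R%:E.
Proof.
move=> uphi; elim=> [|i s2 IH] s1 n Z.
  move=> us uZ; under eq_integral do rewrite big_nil mulr1.
  under [RHS]eq_integral do rewrite big_nil mulr1.
  exact: marks_indicator.
rewrite /= => /andP[]; rewrite mem_cat negb_or => /andP[is2 is1] us uZ.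
pose n' m j := if j == i then m else n j.
pose Zm m (w : Omega) := (Z w * phi i (pr i w) m)%R.
have uZm m : unit_fun (Zm m : Oc -> R).
  by apply: unit_mul => //; exact: unit_comp (Oc_pr i) (uphi i m).
have uZm' m : unit_fun (Zm m : Omega -> R).
  case: (uZm m) => mZm Zm01; split => // _ B mB; rewrite setTI.
  by apply: Oc_sub; exact: measurable_preimage.
have ux j : unit_fun (fun w => phi j (pr j w) (x j w)).
  split=> [|w]; last by case: (uphi j (x j w)).
  apply: (measurable_at_index (q := fun m w => phi j (pr j w) m) (s := x j)) => m.
    by case: (unit_comp (mpr j) (uphi j m)).
  rewrite (_ : [set w | _] = x j @^-1` [set m])//; apply: measurable_preimage => //.
  exact: (proj1 Hx).
have um j : unit_fun (fun w => mixture h (theta j w) (phi j (pr j w))).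
  apply: (unit_mixture h0 h1 mh (mtheta j)) => m; exact: (unit_comp (mpr j) (uphi j m)).
pose Lm m (w : Omega) := (Zm m w * \1_(ev_x (i :: s1) (n' m)) w * \prod_(j <- s2) phi j (pr j w) (x j w))%R.
pose Rm m (w : Omega) := (Zm m w * (h m (theta i w) * \prod_(j <- s1) h (n j) (theta j w)) *
  \prod_(j <- s2) mixture h (theta j w) (phi j (pr j w)))%R.
have uL m : unit_fun (Lm m) by apply: unit_mul; [exact: unit_mul|exact: unit_prod].
have E m : \int[P]_w (Lm m w)%:E = \int[P]_w (Rm m w)%:E.
  have us' : uniq (s2 ++ i :: s1).
    by rewrite -[i :: s1]cat1s uniq_catCA /= mem_cat negb_or is2 is1.
  rewrite (IH (i :: s1) (n' m) (Zm m) us' (uZm m)).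
  apply: eq_integral => w _; rewrite /Rm big_cons /n' eqxx; congr (_ * (_ * _) * _)%:E.
  apply: eq_big_seq => j js; case: eqP => // ji.
  by move: is1; rewrite -ji js.
have uR m : unit_fun (Rm m).
  apply: unit_mul; last exact: unit_prod.
  apply: unit_mul => //; apply: unit_mul => //.
  by have := unit_h [:: i] (fun=> m); congr unit_fun; apply/funext => w; rewrite big_seq1.
have sum_integral (u : nat -> Omega -> R) : (forall m, unit_fun (u m)) ->
    \int[P]_w (\sum_(0 <= m <oo) (u m w)%:E) = \sum_(0 <= m <oo) \int[P]_w (u m w)%:E.
  move=> uu; apply: integral_nneseries => //.
    by move=> m; apply/measurable_EFinP; case: (uu m).
  by move=> m w _; rewrite lee_fin; case: (uu m) => _ /(_ w) /andP[].
transitivity (\int[P]_w (\sum_(0 <= m <oo) (Lm m w)%:E)).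
  apply: eq_integral => w _; rewrite (nneseriesD1 (n := x i w))//; last first.
    by move=> m _; rewrite lee_fin; case: (uL m) => _ /(_ w) /andP[].
  rewrite eseries0 ?adde0; last first.
    move=> m _ /= mxi; rewrite /Lm [\1_ _ w]indicE memNset ?mulr0 ?mul0r//=.
    move=> /(_ i); rewrite in_cons eqxx => /(_ isT); rewrite /n' eqxx => xm.
    by move: mxi; rewrite xm eqxx.
  rewrite big_cons /Lm /Zm.
  have -> : \1_(ev_x (i :: s1) (n' (x i w))) w = \1_(ev_x s1 n) w :> R.
    rewrite !indicE; congr ((_ : bool)%:R); apply/idP/idP => /set_mem /= H; apply/mem_set => j js.
      have := H j; rewrite in_cons js orbT => /(_ isT) ->; rewrite /n'.
      by case: eqP => // ji; move: is1; rewrite -ji js.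
    move: js; rewrite in_cons /n' => /predU1P[->|js]; first by rewrite eqxx.
    by case: eqP => [ji|_]; [move: is1; rewrite -ji js|exact: H].
  by congr EFin; ring.
rewrite sum_integral//; under eq_eseriesr do rewrite E.
rewrite -sum_integral//; apply: eq_integral => w _; rewrite big_cons.
set A := (\prod_(j <- s1) _)%R; set B := (\prod_(j <- s2) _)%R.
transitivity (\sum_(0 <= m <oo) (Z w * A * B)%:E * (h m (theta i w) * phi i (pr i w) m)%:E).
  by apply: eq_eseriesr => m _; rewrite -EFinM /Rm /Zm -/A -/B; congr EFin; ring.
have phi01 m : (0 <= phi i (pr i w) m <= 1)%R by case: (uphi i m).
rewrite nneseriesZl; last by move=> m _; rewrite lee_fin mulr_ge0//; case/andP: (phi01 m).
by rewrite -mixtureE// -EFinM; congr EFin; ring.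
Qed.

End marks.

Section marked_laplace.
Context {R : realType} dPsi (Psi : measurableType dPsi) d (Omega : measurableType d)
  (P : probability Omega R) (I : finType) (psi_fix : I -> Psi)
  (F : I -> probability (measurableTypeR R) R)
  (mu : {measure set (measurableTypeR R * Psi) -> \bar R})
  (theta : I + nat -> Omega -> measurableTypeR R)
  (psi : I + nat -> Omega -> Psi)
  (Hcrm : crm_atoms P psi_fix F mu theta psi).
Context (h : nat -> R -> R) (x : I + nat -> Omega -> nat).
Hypothesis mh : forall n, measurable_fun setT (h n).
Hypothesis h0 : forall n t, (0 <= h n t)%R.
Hypothesis h1 : forall t, \sum_(0 <= n <oo) (h n t)%:E = 1.
Hypothesis Hx : conditionally_independent_marks P theta psi h x.

Let pt k w := (theta (inr k) w, psi (inr k) w).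

Let measurable_at_mark d' (T : measurableType d') d'' (U : measurableType d'')
    (q : Omega -> T) i (f : T -> nat -> U) :
  measurable_fun setT q -> (forall n, measurable_fun setT (f ^~ n)) ->
  measurable_fun setT (fun w => f (q w) (x i w)).
Proof.
move=> mq mf; apply: (measurable_at_index (q := fun n w => f (q w) n) (s := x i)) => n.
  exact: (measurableT_comp (mf n) mq).
rewrite (_ : [set w | _] = x i @^-1` [set n])//; apply: measurable_preimage => //.
exact: (proj1 Hx).
Qed.

Lemma unit_fixed_marks (phi : I -> measurableTypeR R -> nat -> R) :
  (forall k n, unit_fun ((phi k) ^~ n)) ->
  unit_fun (fun w => \prod_k phi k (theta (inl k) w) (x (inl k) w))%R.
Proof.
move=> uphi; apply: unit_prod => k; split=> [|w]; last by case: (uphi k (x (inl k) w)).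
apply: (measurable_at_mark (inl k)) => [|n]; last by case: (uphi k n).
exact: crm_theta_measurable Hcrm _.
Qed.

Lemma measurable_ordinary_mark (g : measurableTypeR R * Psi -> nat -> \bar R) j :
  (forall n, measurable_fun setT (g ^~ n)) ->
  measurable_fun setT (fun w => g (pt j w) (x (inr j) w)).
Proof.
by move=> mg; apply: (measurable_at_mark (inr j) _ mg); exact: measurable_ordinary_point Hcrm j.
Qed.

(** Given the atoms the marks are independent, so that each factor may be
    replaced by its mean over the mark of its atom, which is a function of the
    atom alone. For ordinary atoms the mean is again written as an exponential,
    and the Laplace functional of the unmarked atoms applies. *)
Lemma marked_laplace (phi : I -> measurableTypeR R -> nat -> R)
    (g : measurableTypeR R * Psi -> nat -> \bar R) :
  (forall k n, measurable_fun setT ((phi k) ^~ n)) ->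
  (forall k t n, 0 <= phi k t n <= 1)%R ->
  (forall n, measurable_fun setT (g ^~ n)) -> (forall t n, 0 <= g t n) ->
  \int[P]_w ((\prod_k phi k (theta (inl k) w) (x (inl k) w)) *
     eN (\sum_(0 <= j <oo) g (pt j w) (x (inr j) w)))%R%:E =
  ((\prod_k fine (\int[F k]_t (mixture h t (phi k t))%:E)) *
     eN (\int[mu]_p (1 - mixture h p.1 (fun n => eN (g p n)))%R%:E))%R%:E.
Proof.
move=> mphi phi01 mg g0.
have mth i : measurable_fun setT (theta i) by exact: crm_theta_measurable Hcrm _.
have mps i : measurable_fun setT (psi i) by exact: crm_psi_measurable Hcrm _.
have mpt j : measurable_fun setT (pt j) by exact: measurable_ordinary_point Hcrm j.
pose Phi (i : I + nat) (p : measurableTypeR R * Psi) n : R :=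
  match i with inl k => phi k p.1 n | inr _ => eN (g p n) end.
have ug n : unit_fun (fun p => eN (g p n)) by exact: unit_eN.
have uphi k n : unit_fun ((phi k) ^~ n) by split.
have uPhi i n : unit_fun ((Phi i) ^~ n).
  case: i => [k|j]; last exact: ug.
  exact: unit_comp measurable_fst (uphi k n).
pose sN N : seq (I + nat) := map inl (index_enum I) ++ map inr (iota 0 N).
have usN N : uniq (sN N ++ [::]).
  rewrite cats0 cat_uniq !map_inj_uniq ?iota_uniq ?index_enum_uniq//=.
  - by rewrite andbT; apply/hasPn => _ /mapP[j _ ->]; apply/mapP => -[].
  - by move=> a b [].
  - by move=> a b [].
pose H p : R := mixture h p.1 (fun n => eN (g p n)).
have uH : unit_fun H by apply: unit_mixture.
have [mH H01] := uH.
pose Hk k t : R := mixture h t (phi k t).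
have uHk k : unit_fun (Hk k : measurableTypeR R -> R) by apply: unit_mixture.
have lH0 p : 0 <= lN (H p) by rewrite lN_ge0//; case/andP: (H01 p).
have lNH p : eN (lN (H p)) = H p by rewrite lNK//; case/andP: (H01 p).
have mlH : measurable_fun setT (fun p => lN (H p)) by exact: (measurableT_comp measurable_lN mH).
have avg N : \int[P]_w ((\prod_k phi k (theta (inl k) w) (x (inl k) w)) *
     eN (\sum_(0 <= j < N) g (pt j w) (x (inr j) w)))%R%:E =
   \int[P]_w ((\prod_k Hk k (theta (inl k) w)) *
     eN (\sum_(0 <= j < N) lN (H (pt j w))))%R%:E.
  have u1 : unit_fun (fun=> 1%R : R) by split => // w; rewrite ler01 lexx.
  have := marks_average mth mps mh h0 h1 Hx uPhi (fun=> 0%N) (usN N) (u1 _ _).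
  rewrite (_ : [set w | forall i : I + nat, i \in [::] -> x i w = 0%N] = setT); last first.
    by apply/seteqP; split.
  under eq_integral do rewrite indicT !mul1r big_cat !big_map/=.
  under [X in _ = X -> _]eq_integral do rewrite big_nil !mul1r big_cat !big_map/=.
  move=> E; under eq_integral do rewrite eN_sum// /index_iota subn0.
  rewrite E; apply: eq_integral => w _; rewrite eN_sum// /index_iota subn0.
  by congr (_ * _)%:E; apply: eq_bigr => j _; rewrite lNH.
have lim (U : Omega -> R) (u : nat -> Omega -> \bar R) : unit_fun U ->
    (forall j, measurable_fun setT (u j)) -> (forall j w, 0 <= u j w) ->
    \int[P]_w (U w * eN (\sum_(0 <= j < N) u j w))%:E @[N --> \oo] -->
    \int[P]_w (U w * eN (\sum_(0 <= j <oo) u j w))%:E.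
  move=> uU m_u u0; have uUN N : unit_fun (fun w => U w * eN (\sum_(0 <= j < N) u j w))%R.
    apply: unit_mul => //; apply: unit_eN; first exact: emeasurable_sum.
    by move=> w; exact: sume_ge0.
  apply: cvg_integral01 => [N|N w|w]; [by case: (uUN N)|by case: (uUN N)|].
  apply: cvgMr; apply: cvg_eN; first by move=> N; exact: sume_ge0.
    exact: nneseries_ge0.
  by apply: is_cvg_nneseries => n _ _.
have l1 := lim _ (fun j w => g (pt j w) (x (inr j) w)) (unit_fixed_marks uphi)
  (fun j => measurable_ordinary_mark j mg) (fun j w => g0 _ _).
have l2 := lim (fun w => \prod_k Hk k (theta (inl k) w))%R (fun j w => lN (H (pt j w)))
  (unit_prod _ _ (fun k => unit_comp (mth _) (uHk k)))
  (fun j => measurableT_comp mlH (mpt j)) (fun j w => lH0 _).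
transitivity (\int[P]_w ((\prod_k Hk k (theta (inl k) w)) *
     eN (psum pt (fun p => lN (H p)) w))%R%:E).
  apply: (cvg_unique _ l1) => //; apply: cvg_trans l2; apply: near_eq_cvg.
  by apply: nearW => N; rewrite avg.
rewrite (crm_laplace Hcrm)//; first by congr (_ * eN _)%:E; apply: eq_integral => p _; rewrite lNH.
  by move=> k; case: (uHk k).
by move=> k; case: (uHk k).
Qed.

End marked_laplace.

(** * The space of measures *)

Section esum_lemmas.
Context {R : realType}.

(** Counts of atoms are sums over atoms, like masses. *)
Lemma counting_esum (T : choiceType) (S : set T) :
  counting S = \esum_(i in S) (1 : \bar R).
Proof.
rewrite /counting; case: asboolP => fS.
  rewrite esum_fset// fsbig_finite//= big_const_seq count_predT.
  by elim: (size _) => [//|n IH]; rewrite iterS -IH -nat1r EFinD.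
apply/esym/eq_infty => r.
have [B BS nB] := infinite_set_fset (Num.truncn r).+1 fS.
apply: (@le_trans _ _ ((Num.truncn r).+1%:R%:E)).
  by rewrite lee_fin ltW// truncnS_gt.
apply: esum_ge; exists [set` B]; first by split.
rewrite fsbig_finite//= set_fsetK big_const_seq count_predT.
apply: (@le_trans _ _ ((size B)%:R%:E)); first by rewrite lee_fin ler_nat.
by elim: (size _) => [//|n IH]; rewrite iterS -nat1r EFinD leeD2l.
Qed.

Lemma esum_finType (I : finType) (a : I -> \bar R) : (forall i, 0 <= a i) ->
  \esum_(i in [set: I]) a i = \sum_i a i.
Proof.
move=> a0; rewrite esum_fset//; last exact: finite_finset.
rewrite fsbig_finite; last exact: finite_finset.
apply/perm_big/uniq_perm; rewrite ?finmap.fset_uniq ?index_enum_uniq//.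
by move=> i; rewrite mem_index_enum in_fset_set ?in_setT//; exact: finite_finset.
Qed.

Lemma esum_sum_type (I : finType) (g : I + nat -> \bar R) : (forall i, 0 <= g i) ->
  \esum_(i in [set: I + nat]) g i = \sum_k g (inl k) + \sum_(0 <= j <oo) g (inr j).
Proof.
move=> g0; rewrite (esumID (range (@inl I nat)))// !setTI.
rewrite (_ : ~` range (@inl I nat) = range (@inr I nat)); last first.
  apply/seteqP; split => [[k []|j _]|_ [j _ <-] [//]]; first by exists k.
  by exists j.
rewrite esum_image; last by move=> a b _ _ [].
rewrite esum_image; last by move=> a b _ _ [].
by rewrite esum_finType// nneseries_esumT.
Qed.

Lemma esum_single (T : choiceType) (i : T) (g : T -> \bar R) : (forall j, 0 <= g j) ->
  (forall j, j != i -> g j = 0) -> \esum_(j in [set: T]) g j = g i.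
Proof.
move=> g0 gi; rewrite -[RHS](esum_set1 (t := i) (a := g))// [RHS]esum_mkcond.
apply: eq_esum => j _; case: ifPn => // /negP ji; rewrite gi//; apply/negP => /eqP ji'.
by apply: ji; rewrite ji'; exact/mem_set.
Qed.

End esum_lemmas.

Section functionals.
Context {R : realType} dPsi (Psi : measurableType dPsi).
Hypothesis singletons : forall p : Psi, measurable [set p].

(** The masses of sets and the numbers of atoms, in one family. *)
Definition functional_index : Type :=
  {A : set Psi | measurable A} +
  {AB : set Psi * set (\bar R) | measurable AB.1 /\ measurable AB.2}.

Definition functional (j : functional_index) (m : measure_space Psi R) : \bar R :=
  match j with
  | inl A => ev m (sval A)
  | inr AB => atom_count m (sval AB).1 (sval AB).2
  end.

(** What an atom of mass [p.1] at [p.2] contributes. The absolute value makes the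
    contribution nonnegative for every [p]. *)
Definition contribution (j : functional_index) (p : measurableTypeR R * Psi) : \bar R :=
  match j with
  | inl A => (`|p.1| * \1_(sval A) p.2)%:E
  | inr AB => (\1_((sval AB).1) p.2 * ((0 < p.1)%R%:R * \1_((sval AB).2) (p.1%:E)))%:E
  end.

Lemma functional_ge0 j m : 0 <= functional j m.
Proof.
case: j => [A|AB] /=; first exact: measure_ge0.
by rewrite /atom_count counting_esum esum_ge0.
Qed.

Lemma contribution_ge0 j p : 0 <= contribution j p.
Proof. by case: j => [A|AB] /=; rewrite lee_fin ?mulr_ge0. Qed.

Lemma contribution_null j p : p.1 = 0%R -> contribution j p = 0.
Proof. by move=> p0; case: j => [A|AB] /=; rewrite p0 ?normr0 ?ltxx ?mul0r ?mulr0. Qed.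

Lemma measurable_functional j : measurable_fun setT (functional j).
Proof.
move=> _ B mB; apply: sub_sigma_algebra; case: j => [[A mA]|[[A C] /= [mA mC]]] /=.
  by left; exists A; split => //; exists B.
by right; exists A, C; split => //; exists B.
Qed.

Lemma measurable_contribution j : measurable_fun setT (contribution j).
Proof.
have ind d (T : measurableType d) d' (T' : measurableType d') (g : T -> T') (S : set T') :
    measurable_fun setT g -> measurable S -> measurable_fun setT (fun t => \1_S (g t) : R).
  by move=> mg mS; apply: measurableT_comp => //; exact: measurable_indic.
case: j => [[A mA]|[[A B] /= [mA mB]]] /=; apply/measurable_EFinP.
  apply: measurable_funM.
    exact: (measurableT_comp (@normr_measurable R setT) measurable_fst).
  exact: (ind _ _ _ _ snd _ measurable_snd mA).
apply: measurable_funM.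
  exact: (ind _ _ _ _ snd _ measurable_snd mA).
have -> : (fun p : measurableTypeR R * Psi => ((0 < p.1)%R%:R * \1_B p.1%:E)%R) =
    (fun p => \1_([set t | (0 < t)%R] `&` EFin @^-1` B) p.1 : R).
  apply/funext => p; rewrite indicI /=; congr (_ * _)%R.
  by rewrite indicE; congr ((_ : bool)%:R); apply/idP/idP => [p0|/set_mem//]; exact/mem_set.
have mS : measurable ([set t : R | (0 < t)%R] `&` EFin @^-1` B).
  apply: measurableI.
    by rewrite (_ : [set t : R | _] = `]0%R, +oo[%classic)//; apply/seteqP; split => t /=; rewrite in_itv/= andbT.
  exact: measurable_preimage.
exact: (ind _ _ _ _ fst _ measurable_fst mS).
Qed.

(** The generators are the level sets of the functionals. *)
Lemma measure_space_generated (C : set (measure_space Psi R)) : measurable C ->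
  <<s [set E | exists j B, measurable B /\ E = functional j @^-1` B] >> C.
Proof.
move: C; apply: smallest_sub; first exact: smallest_sigma_algebra.
move=> E [[A [mA [B mB <-]]]|[A [B [mA mB [D mD <-]]]]]; rewrite setTI.
  by apply: sub_sigma_algebra; exists (inl (exist _ A mA)), B.
by apply: sub_sigma_algebra; exists (inr (exist _ (A, B) (conj mA mB))), D.
Qed.

Lemma measurable_to_measure_space d (Omega : measurableType d)
    (Theta : Omega -> measure_space Psi R) :
  (forall j, measurable_fun setT (fun w => functional j (Theta w))) ->
  measurable_fun setT Theta.
Proof.
move=> mT _ C /measure_space_generated; rewrite setTI; move: C.
apply: smallest_sub.
  have := sigma_algebra_preimage setT Theta.
  split.
  - by rewrite preimage_set0.
  - by move=> A mA; rewrite setTD preimage_setC; exact: measurableC.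
  - by move=> F mF; rewrite preimage_bigcup; exact: bigcup_measurable.
move=> _ [j [B [mB ->]]].
by have := mT j measurableT B mB; rewrite setTI.
Qed.

Section atoms_of_sum.
Context (J : choiceType) (a : J -> R) (p : J -> Psi) (m : measure_space Psi R).
Hypothesis a0 : forall i, (0 <= a i)%R.
Hypothesis p_inj : injective p.
Hypothesis sum_m : atomic_sum a p m.

Lemma mass_at i : ev m [set p i] = (a i)%:E.
Proof.
rewrite sum_m// (esum_single (i := i)).
- by rewrite diracE mem_set// mule1.
- by move=> j; rewrite mule_ge0// lee_fin.
- move=> j ji; rewrite diracE memNset ?mule0//= => /p_inj ij.
  by rewrite ij eqxx in ji.
Qed.

Lemma mass_off q : ~ range p q -> ev m [set q] = 0.
Proof.
move=> nq; rewrite sum_m// esum1// => i _.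
by rewrite diracE memNset ?mule0//= => pi; apply: nq; exists i.
Qed.

(** Atoms at distinct locations do not merge, so that the atoms of the measure
    are those of the sum and carry the masses [a i]. *)
Lemma functional_esum j : functional j m = \esum_(i in [set: J]) contribution j (a i, p i).
Proof.
case: j => [[A mA]|[[A B] /= [mA mB]]] /=.
  rewrite sum_m//; apply: eq_esum => i _.
  by rewrite ger0_norm// diracE indicE EFinM.
rewrite /atom_count counting_esum.
have -> : [set q | [/\ A q, atom m q & B (ev m [set q])]] =
   p @` [set i | [/\ A (p i), (0 < a i)%R & B (a i)%:E]].
  apply/seteqP; split => [q [Aq mq Bq]|_ [i [Ai i0 Bi] <-]]; last first.
    by split => //; rewrite /atom ?mass_at ?lte_fin.
  have [[i _ pi]|nq] := pselect (range p q); last first.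
    by move: mq; rewrite /atom mass_off ?ltxx.
  by exists i => //; move: Aq mq Bq; rewrite -pi /atom mass_at lte_fin.
rewrite esum_image; last by move=> i i' _ _; exact: p_inj.
rewrite esum_mkcond; apply: eq_esum => i _.
rewrite !indicE -!natrM !mulnb; case: ifPn => [/set_mem [Ai i0 Bi]|/negP nD].
  by rewrite (mem_set Ai) i0 (mem_set Bi).
suff -> : [&& p i \in A, (0 < a i)%R & (a i)%:E \in B] = false by [].
apply/negP => /and3P[/set_mem Ai i0 /set_mem Bi]; apply: nD.
by apply/mem_set; split.
Qed.

End atoms_of_sum.

Definition total_contribution (s : seq functional_index) p : \bar R :=
  \sum_(j <- s) contribution j p.

Lemma total_contribution_ge0 s p : 0 <= total_contribution s p.
Proof. by apply: sume_ge0 => j _; exact: contribution_ge0. Qed.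

Lemma total_contribution_null s p : p.1 = 0%R -> total_contribution s p = 0.
Proof. by move=> p0; rewrite /total_contribution big1// => j _; rewrite contribution_null. Qed.

Lemma measurable_total_contribution s : measurable_fun setT (total_contribution s).
Proof. by apply: emeasurable_sum => j; exact: measurable_contribution. Qed.

Lemma sum_functional (I : finType) (a : I + nat -> R) (p : I + nat -> Psi) m s :
  (forall i, 0 <= a i)%R -> injective p -> atomic_sum a p m ->
  \sum_(j <- s) functional j m =
  \sum_k total_contribution s (a (inl k), p (inl k)) +
  \sum_(0 <= j <oo) total_contribution s (a (inr j), p (inr j)).
Proof.
move=> a0 pinj am; have c0 := contribution_ge0.
rewrite /total_contribution exchange_big/= nneseries_sum// -big_split/=.
apply: eq_bigr => j _; rewrite (functional_esum a0 pinj am) esum_sum_type//.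
Qed.

End functionals.

(** * Laws of completely random measures *)

Lemma ae_countable d (T : measurableType d) {R : realType}
    (mu : {measure set T -> \bar R}) (J : countType) (Q : J -> T -> Prop) :
  (forall j, {ae mu, forall w, Q j w}) -> {ae mu, forall w, forall j, Q j w}.
Proof.
move=> HQ.
have : {ae mu, forall w, forall n : nat, forall j, @choice.unpickle J n = Some j -> Q j w}.
  apply: ae_foralln => n; case: (@choice.unpickle J n) => [j|]; last exact: aeW.
  by apply: filterS (HQ j) => w Qjw _ [<-].
by apply: filterS => w Hw j; apply: (Hw (@choice.pickle J j)); exact: choice.pickleK.
Qed.

Section crm_law_exists.
Context {R : realType} dPsi (Psi : measurableType dPsi).
Hypothesis singletons : forall p : Psi, measurable [set p].

Section point_measure.
Context (I : finType) (a : I + nat -> R) (p : I + nat -> Psi).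

Let m_ (i : I + nat) : {measure set Psi -> \bar R} :=
  mscale (NngNum (normr_ge0 (a i))) (dirac (p i)).

(** The finitely many atoms of the left summand are enumerated by ordinals, for
    which finite sums of measures are available. *)
Definition point_measure : {measure set Psi -> \bar R} :=
  measure_add
    (msum (fun n => if insub n is Some o then m_ (inl (enum_val (o : 'I_#|I|)))
                    else (mzero : {measure set Psi -> \bar R})) #|I|)
    (mseries (fun j => m_ (inr j)) 0).

Lemma point_measureE : atomic_sum (fun i => `|a i|%R) p (point_measure : measure_space Psi R).
Proof.
move=> A mA; rewrite esum_sum_type; last by move=> i; rewrite mule_ge0// lee_fin.
etransitivity; first exact: measure_addE.
congr (_ + _).
transitivity (\sum_(k in I) (`|a (inl k)|)%:E * (\d_(p (inl k)) A : \bar R)); last exact: eq_bigl.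
by rewrite big_enum_val; apply: eq_bigr => o _; rewrite valK.
Qed.

End point_measure.

Context d (Omega : measurableType d) (P : probability Omega R) (I : finType)
  (psi_fix : I -> Psi) (F : I -> probability (measurableTypeR R) R)
  (mu : {measure set (measurableTypeR R * Psi) -> \bar R})
  (theta : I + nat -> Omega -> measurableTypeR R)
  (psi : I + nat -> Omega -> Psi)
  (Hcrm : crm_atoms P psi_fix F mu theta psi).

Let pt k w := (theta (inr k) w, psi (inr k) w).

(** The Laplace functional of the atoms of a completely random measure. *)
Definition crm_transform (f : measurableTypeR R * Psi -> \bar R) : R :=
  ((\prod_k fine (\int[F k]_t (eN (f (t, psi_fix k)))%:E)) *
     eN (\int[mu]_t (1 - eN (f t))%R%:E))%R.

Lemma crm_sum_laplace (f : measurableTypeR R * Psi -> \bar R) :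
  measurable_fun setT f -> (forall t, 0 <= f t) ->
  \int[P]_w (eN (\sum_k f (theta (inl k) w, psi (inl k) w) + psum pt f w))%:E =
  (crm_transform f)%:E.
Proof.
move=> mf f0; rewrite -(crm_laplace Hcrm (phi := fun k t => eN (f (t, psi_fix k))))//.
- apply: eq_integral => w _; rewrite eND ?psum_ge0 ?sume_ge0//.
  rewrite eN_sum//; congr (_ * _)%:E; apply: eq_bigr => k _.
  by rewrite (crm_psi_fix Hcrm).
- move=> k; apply: (measurableT_comp measurable_eN).
  exact: (measurableT_comp mf (measurable_pair2 _)).
- by move=> k t; rewrite eN_ge0 eN_le1.
Qed.

Lemma crm_almost_surely :
  exists N : set Omega, [/\ measurable N, P N = 0 &
    forall w, ~ N w -> (forall i, 0 <= theta i w)%R /\ injective (psi ^~ w)].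
Proof.
have : {ae P, forall w, (forall i, 0 <= theta i w)%R /\ injective (psi ^~ w)}.
  have := ae_countable (crm_theta_ge0 Hcrm); have := crm_distinct Hcrm.
  by apply: filterS2.
move=> [N [mN N0 HN]]; exists N; split => // w Nw.
by have [//|] := pselect ((forall i, 0 <= theta i w)%R /\ injective (psi ^~ w)) => /HN.
Qed.

(** Disjoint sets see different atoms, so that the transform factorizes. *)
Lemma crm_transform_disjoint (K : finType) (A : K -> set Psi) (c : K -> R) :
  (forall i, measurable (A i)) -> trivIset setT A -> (forall i, 0 <= c i)%R ->
  crm_transform (fun p => \sum_i ((c i * `|p.1|) * \1_(A i) p.2)%:E) =
  (\prod_i crm_transform (fun p => ((c i * `|p.1|) * \1_(A i) p.2)%:E))%R.
Proof.
move=> mA tA c0.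
have f0 i (p : measurableTypeR R * Psi) : 0 <= ((c i * `|p.1|) * \1_(A i) p.2)%:E.
  by rewrite lee_fin !mulr_ge0.
have mf i : measurable_fun setT (fun p : measurableTypeR R * Psi => ((c i * `|p.1|) * \1_(A i) p.2)%:E).
  apply/measurable_EFinP; apply: measurable_funM.
    apply: measurable_funM => //.
    exact: (measurableT_comp (@normr_measurable R setT) measurable_fst).
  apply: (measurableT_comp (f := (\1_(A i) : Psi -> R)) _ measurable_snd).
  exact: measurable_indic.
have e01 i (p : measurableTypeR R * Psi) : (0 <= 1 - expR (- (c i * `|p.1| * \1_(A i) p.2)))%R.
  by rewrite subr_ge0 -expR0 ler_expR oppr_le0 !mulr_ge0.
rewrite /crm_transform big_split/=; congr (_ * _)%R; last first.
  rewrite -eN_sum; last by move=> i; apply: integral_ge0 => p _; rewrite lee_fin e01.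
  congr eN; rewrite -ge0_integral_sum//.
  - apply: eq_integral => p _; rewrite !sumEFin /=.
    rewrite (@disjoint_sum_fun R Psi K A (fun i => c i * `|p.1|)%R (fun y => 1 - expR (- y))%R)//; last first.
      by rewrite oppr0 expR0 subrr.
    congr EFin; apply: eq_bigr => i _; rewrite indicE.
    by case: (_ \in _); rewrite ?mulr1 ?mulr0 ?oppr0 ?expR0 ?subrr.
  - move=> i; apply/measurable_EFinP; apply: measurable_funB => //.
    exact: (measurableT_comp measurable_eN (mf i)).
  - by move=> i p _; rewrite lee_fin e01.
rewrite exchange_big/=; apply: eq_bigr => k _.
have one i : ~ A i (psi_fix k) ->
    fine (\int[F k]_t (eN ((c i * `|t|) * \1_(A i) (psi_fix k))%:E)%:E) = 1%R.
  move=> nA; under eq_integral do rewrite indicE memNset// mulr0 eN0.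
  by rewrite integral_cst1.
have [[i0 Ai0]|nA] := pselect (exists i, A i (psi_fix k)).
  have nA i : i != i0 -> ~ A i (psi_fix k).
    by move=> ii0 Ai; move/eqP : ii0; apply; apply: tA => //; exists (psi_fix k).
  rewrite [RHS](bigD1 i0)//= [X in (_ * X)%R]big1 ?mulr1; last first.
    by move=> i ii0; apply: one; exact: nA.
  congr fine; apply: eq_integral => t _.
  rewrite (bigD1 i0)//= big1 ?adde0// => i ii0.
  by rewrite indicE memNset ?mulr0//; exact: nA.
rewrite [RHS]big1; last by move=> i _; apply: one => Ai; apply: nA; exists i.
transitivity (fine (\int[F k]_(t in setT) cst 1 t)); last by rewrite integral_cst1.
congr fine; apply: eq_integral => t _; rewrite big1 ?eN0// => i _.
by rewrite indicE memNset ?mulr0// => Ai; apply: nA; exists i.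
Qed.

(** The joint Laplace transform of the masses of disjoint sets factorizes. *)
Lemma completely_random_sum (Theta : Omega -> measure_space Psi R) :
  measurable_fun setT Theta ->
  {ae P, forall w, atomic_sum (theta ^~ w) (psi ^~ w) (Theta w)} ->
  completely_random P Theta.
Proof.
move=> mTheta Theta_sum; split => // K A mA tA.
have mev i : measurable_fun setT (fun w => ev (Theta w) (A i)).
  exact: (measurableT_comp (measurable_functional (inl (exist _ (A i) (mA i)))) mTheta).
have ev0 i w : 0 <= ev (Theta w) (A i) by exact: measure_ge0.
apply: indep_of_laplace => // k.
pose f i (p : measurableTypeR R * Psi) : \bar R := (((k i)%:R * `|p.1|) * \1_(A i) p.2)%:E.
have f0 i p : 0 <= f i p by rewrite lee_fin !mulr_ge0.
have mf i : measurable_fun setT (f i).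
  apply/measurable_EFinP; apply: measurable_funM.
    apply: measurable_funM => //.
    exact: (measurableT_comp (@normr_measurable R setT) measurable_fst).
  apply: (measurableT_comp (f := (\1_(A i) : Psi -> R)) _ measurable_snd).
  exact: measurable_indic.
have evE : {ae P, forall w, forall i, (k i)%:R%:E * ev (Theta w) (A i) =
    \sum_j f i (theta (inl j) w, psi (inl j) w) + psum pt (f i) w}.
  have := ae_countable (crm_theta_ge0 Hcrm); move: Theta_sum.
  apply: filterS2 => w Tw tw i; rewrite Tw// esum_sum_type; last first.
    by move=> j; rewrite mule_ge0// lee_fin.
  rewrite ge0_muleDr; last 2 first.
  - by apply: sume_ge0 => j _; rewrite mule_ge0// lee_fin.
  - by apply: nneseries_ge0 => j _ _; rewrite mule_ge0// lee_fin.
  congr (_ + _).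
    rewrite ge0_sume_distrr; last by move=> j _; rewrite mule_ge0// lee_fin.
    by apply: eq_bigr => j _; rewrite /f /= ger0_norm// diracE -!EFinM mulrA indicE.
  rewrite -nneseriesZl; last by move=> j _; rewrite mule_ge0// lee_fin.
  by apply: eq_eseriesr => j _; rewrite /f /= ger0_norm// diracE -!EFinM mulrA indicE.
have mpt := measurable_ordinary_point Hcrm.
have mS g : measurable_fun setT g -> (forall t, 0 <= g t) -> measurable_fun setT
    (fun w => (eN (\sum_j g (theta (inl j) w, psi (inl j) w) + psum pt g w))%:E).
  move=> mg g0; apply/measurable_EFinP; apply: (measurableT_comp measurable_eN).
  apply: emeasurable_funD; last exact: measurable_psum.
  apply: emeasurable_sum => j; apply: (measurableT_comp mg).
  apply/measurable_fun_pairP; split.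
    exact: crm_theta_measurable Hcrm _.
  exact: crm_psi_measurable Hcrm _.
have kev0 i w : 0 <= (k i)%:R%:E * ev (Theta w) (A i) by rewrite mule_ge0// lee_fin.
have one i : \int[P]_w (eN ((k i)%:R%:E * ev (Theta w) (A i)))%:E = (crm_transform (f i))%:E.
  rewrite -crm_sum_laplace//; apply: ge0_ae_eq_integral => //.
  - apply/measurable_EFinP; apply: (measurableT_comp measurable_eN).
    exact: measurable_funeM.
  - exact: mS.
  - by move=> w _; rewrite lee_fin eN_ge0.
  - by move=> w _; rewrite lee_fin eN_ge0.
  - by move: evE; apply: filterS => w Ew _; rewrite Ew.
have fs0 p : 0 <= \sum_i f i p by apply: sume_ge0 => i _.
have mfs : measurable_fun setT (fun p => \sum_i f i p) by exact: emeasurable_sum.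
transitivity (crm_transform (fun p => \sum_i f i p))%:E.
  rewrite -crm_sum_laplace//; apply: ge0_ae_eq_integral => //.
  - apply/measurable_EFinP; apply: measurable_fun_prod => i.
    by apply: (measurableT_comp measurable_eN); exact: measurable_funeM.
  - exact: mS.
  - by move=> w _; rewrite lee_fin prodr_ge0// => i _; rewrite eN_ge0.
  - by move=> w _; rewrite lee_fin eN_ge0.
  - move: evE; apply: filterS => w Ew _; rewrite -eN_sum//; congr (eN _)%:E.
    under eq_bigr do rewrite Ew.
    by rewrite big_split/= exchange_big/=; congr (_ + _); rewrite psum_sum.
rewrite crm_transform_disjoint//.
by congr EFin; apply: eq_bigr => i _; rewrite one.
Qed.

(** The sum over the atoms is a measurable random measure once it is redefined on
    a null set outside of which the weights are nonnegative and the locations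
    distinct. *)
Lemma crm_law_exists : exists Q : probability (measure_space Psi R) R,
  crm_law Q psi_fix F mu.
Proof.
have [N [mN N0 HN]] := crm_almost_surely.
pose Theta w : measure_space Psi R :=
  if w \in N then (mzero : {measure set Psi -> \bar R}) else point_measure (theta ^~ w) (psi ^~ w).
have mpt := measurable_ordinary_point Hcrm.
have mTheta : measurable_fun setT Theta.
  apply: measurable_to_measure_space => j.
  rewrite (_ : (fun w => _) = fun w => if w \in N then
     functional j (mzero : {measure set Psi -> \bar R}) else
     \sum_k contribution j (`|theta (inl k) w|%R, psi (inl k) w) +
     \sum_(0 <= i <oo) contribution j (`|theta (inr i) w|%R, psi (inr i) w)); last first.
    apply/funext => w; rewrite /Theta; case: ifPn => // /negP wN.
    rewrite (functional_esum singletons _ _ (@point_measureE _ (theta ^~ w) (psi ^~ w))).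
    + by rewrite esum_sum_type// => i; exact: contribution_ge0.
    + by move=> i; exact: normr_ge0.
    + by apply: (proj2 (HN w _)) => Nw; apply: wN; exact/mem_set.
  have mc i : measurable_fun setT (fun w => contribution j (`|theta i w|%R : measurableTypeR R, psi i w)).
    apply: (measurableT_comp (measurable_contribution j)).
    apply/measurable_fun_pairP; split; last exact: crm_psi_measurable Hcrm _.
    exact: (measurableT_comp (@normr_measurable R setT) (crm_theta_measurable Hcrm i)).
  apply: measurable_fun_ifT.
  - exact: measurable_mem.
  - exact: measurable_cst.
  - apply: emeasurable_funD; first exact: emeasurable_sum.
    apply: (@ge0_emeasurable_sum _ _ _ _ (fun i w => contribution j (`|theta (inr i) w|%R, psi (inr i) w)) xpredT) => //.
    by move=> i w _ _; exact: contribution_ge0.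
have Theta_sum : {ae P, forall w, atomic_sum (theta ^~ w) (psi ^~ w) (Theta w)}.
  exists N; split => // w /= H; apply: contrapT => nN; apply: H.
  have [t0 _] := HN w nN.
  rewrite /Theta memNset// => A mA; rewrite point_measureE//.
  by apply: eq_esum => i _; rewrite ger0_norm.
pose TM : {mfun Omega >-> measure_space Psi R} :=
  HB.pack Theta (isMeasurableFun.Build _ _ _ _ Theta mTheta).
exists (distribution P TM).
exists d, Omega, P, Theta, theta, psi; split => //.
exact: completely_random_sum.
Qed.

End crm_law_exists.

(** A finite sum of functionals is a sum over the atoms of their total
    contributions. *)
Lemma crm_law_laplace {R : realType} dPsi (Psi : measurableType dPsi)
    (I : finType) (psi_fix : I -> Psi) (F : I -> probability (measurableTypeR R) R)
    (mu : {measure set (measurableTypeR R * Psi) -> \bar R})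
    (Q : probability (measure_space Psi R) R) (s : seq (functional_index Psi)) :
  (forall p : Psi, measurable [set p]) -> crm_law Q psi_fix F mu ->
  \int[Q]_m (eN (\sum_(j <- s) functional j m))%:E =
  (crm_transform psi_fix F mu (total_contribution s))%:E.
Proof.
move=> singles [] d [] Omega [] P [] Theta [] theta [] psi [] law_Theta [mTheta _] Hcrm Theta_sum.
have f0 m : 0 <= \sum_(j <- s) functional j m.
  by apply: sume_ge0 => j _; exact: functional_ge0.
have mfs : measurable_fun setT (fun m : measure_space Psi R => \sum_(j <- s) functional j m).
  by apply: emeasurable_sum => j; exact: measurable_functional.
have meN : measurable_fun setT (fun m : measure_space Psi R => eN (\sum_(j <- s) functional j m) : R).
  exact: (measurableT_comp measurable_eN mfs).
rewrite -(expectation_law mTheta law_Theta meN); last by move=> m; exact: eN_ge0.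
have mpt := measurable_ordinary_point Hcrm.
rewrite -(crm_sum_laplace Hcrm); last 2 first.
- exact: measurable_total_contribution.
- exact: total_contribution_ge0.
apply: ge0_ae_eq_integral => //.
- by apply/measurable_EFinP; exact: (measurableT_comp meN mTheta).
- apply/measurable_EFinP; apply: (measurableT_comp measurable_eN).
  apply: emeasurable_funD; last first.
    by apply: measurable_psum => //; [exact: measurable_total_contribution|exact: total_contribution_ge0].
  apply: emeasurable_sum => j; apply: (measurableT_comp (measurable_total_contribution s)).
  apply/measurable_fun_pairP; split.
    exact: crm_theta_measurable Hcrm _.
  exact: crm_psi_measurable Hcrm _.
- by move=> w _; rewrite lee_fin eN_ge0.
- by move=> w _; rewrite lee_fin eN_ge0.
- have := ae_countable (crm_theta_ge0 Hcrm); have := crm_distinct Hcrm; move: Theta_sum.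
  apply: filterS3 => w Tw inj_w t0 _; congr (eN _)%:E.
  by rewrite (sum_functional singles s _ inj_w Tw).
Qed.

(** * Bayesian posteriors *)

Lemma posterior_exists {R : realType} (m : {measure set (measurableTypeR R) -> \bar R})
    (l : R -> R) : measurable_fun setT l -> (forall t, 0 <= l t)%R ->
  0 < \int[m]_t (l t)%:E < +oo ->
  exists Q : probability (measurableTypeR R) R, is_posterior m l Q.
Proof.
move=> ml l0 Zb; have /andP[Z0 Zoo] := Zb; pose Z := \int[m]_t (l t)%:E.
have Zfin : Z \is a fin_num by rewrite ge0_fin_numE// ltW.
have z0 : (0 < fine Z)%R by rewrite fine_gt0// Z0 Zoo.
pose l' t : R := ((fine Z)^-1 * l t)%R.
have ml' : measurable_fun (setT : set (measurableTypeR R)) l' by exact: measurable_funM.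
have l'0 t : (0 <= l' t)%R by rewrite mulr_ge0// invr_ge0 ltW.
have intl' B : measurable B -> \int[m]_(t in B) (l' t)%:E = (fine Z)^-1%:E * \int[m]_(t in B) (l t)%:E.
  move=> mB; under eq_integral do rewrite EFinM.
  rewrite ge0_integralZl_EFin//.
  - by move=> t _; rewrite lee_fin.
  - by apply/measurable_EFinP/measurable_funTS.
  - by rewrite invr_ge0 ltW.
have mass : \int[m]_t (l' t)%:E = 1.
  by rewrite intl'// -/Z -{2}(fineK Zfin) -EFinM mulVf// gt_eqF.
by exists (normalized ml' l'0 mass); split => // B mB; rewrite -intl'.
Qed.

Section posterior_mean.
Context {R : realType}.

(** The posterior mean of [g] for a prior [M] and a likelihood [l]. It depends
    on the posterior only through Bayes' formula, hence is defined without
    choosing one. *)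
Definition posterior_mean (M : {measure set (measurableTypeR R) -> \bar R})
    (l g : R -> R) : R :=
  (fine (\int[M]_t (l t * g t)%:E) / fine (\int[M]_t (l t)%:E))%R.

Context (M : {measure set (measurableTypeR R) -> \bar R}) (l g : R -> R).
Hypothesis ml : measurable_fun (setT : set (measurableTypeR R)) l.
Hypothesis l0 : forall t, (0 <= l t)%R.
Hypothesis mg : measurable_fun (setT : set (measurableTypeR R)) g.
Hypothesis g01 : forall t, (0 <= g t <= 1)%R.

Let Z := \int[M]_t (l t)%:E.
Let Zg := \int[M]_t (l t * g t)%:E.

Let Z0 : 0 <= Z. Proof. by apply: integral_ge0 => t _; rewrite lee_fin. Qed.
Let lg0 t : (0 <= l t * g t)%R.
Proof. by rewrite mulr_ge0//; case/andP: (g01 t). Qed.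
Let Zg0 : 0 <= Zg. Proof. by apply: integral_ge0 => t _; rewrite lee_fin. Qed.
Let mlE : measurable_fun (setT : set (measurableTypeR R)) (fun t => (l t)%:E).
Proof. exact/measurable_EFinP. Qed.
Let mlgE : measurable_fun (setT : set (measurableTypeR R)) (fun t => (l t * g t)%:E).
Proof. by apply/measurable_EFinP; exact: measurable_funM. Qed.

Let ZgZ : Zg <= Z.
Proof.
apply: ge0_le_integral => //.
- by move=> t _; rewrite lee_fin.
- by move=> t _; rewrite lee_fin ler_piMr//; case/andP: (g01 t).
Qed.

Lemma posterior_mean01 : Z < +oo -> (0 <= posterior_mean M l g <= 1)%R.
Proof.
move=> Zoo; have Zfin : Z \is a fin_num by rewrite ge0_fin_numE.
have Zgfin : Zg \is a fin_num by rewrite ge0_fin_numE// (le_lt_trans ZgZ).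
rewrite /posterior_mean -/Z -/Zg divr_ge0 ?fine_ge0//=.
have := fine_ge0 Z0; rewrite le_eqVlt => /predU1P[<-|Z1].
  by rewrite invr0 mulr0 ler01.
by rewrite ler_pdivrMr// mul1r fine_le.
Qed.

Lemma posterior_meanE : Z < +oo ->
  \int[M]_t (l t * g t)%:E = \int[M]_t (l t * posterior_mean M l g)%:E.
Proof.
move=> Zoo; have Zfin : Z \is a fin_num by rewrite ge0_fin_numE.
have Zgfin : Zg \is a fin_num by rewrite ge0_fin_numE// (le_lt_trans ZgZ).
have /andP[m0 m1] := posterior_mean01 Zoo.
under [RHS]eq_integral do rewrite mulrC EFinM.
rewrite ge0_integralZl_EFin//; last by move=> t _; rewrite lee_fin.
rewrite -/Z -/Zg -(fineK Zfin) -EFinM -(fineK Zgfin) /posterior_mean -/Z -/Zg.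
have [Z1|Z1] := eqVneq (fine Z) 0%R; last by rewrite divfK.
rewrite Z1 mulr0; congr EFin; apply/eqP; rewrite eq_le fine_ge0// andbT.
by rewrite -Z1 fine_le.
Qed.

Lemma posterior_meanC (c : R) : (0 <= c)%R -> Z < +oo ->
  \int[M]_t (l t * (c * g t))%:E = \int[M]_t (l t * (c * posterior_mean M l g))%:E.
Proof.
move=> c0 Zoo; have /andP[m0 m1] := posterior_mean01 Zoo.
under eq_integral do rewrite mulrCA EFinM.
under [RHS]eq_integral do rewrite mulrCA EFinM.
rewrite !ge0_integralZl_EFin// ?posterior_meanE//.
- by move=> t _; rewrite lee_fin mulr_ge0.
- by apply/measurable_EFinP; exact: measurable_funM.
- by move=> t _; rewrite lee_fin.
Qed.

(** Both sides are the normalizing constant minus the integrals of the preceding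
    lemma. *)
Lemma posterior_mean_onem (c : R) : (0 <= c <= 1)%R -> Z < +oo ->
  \int[M]_t (l t * (1 - c * g t))%:E = \int[M]_t (l t * (1 - c * posterior_mean M l g))%:E.
Proof.
move=> /andP[c0 c1] Zoo; have /andP[m0 m1] := posterior_mean01 Zoo.
have Zfin : Z \is a fin_num by rewrite ge0_fin_numE.
have split_onem (v : R -> R) : measurable_fun (setT : set (measurableTypeR R)) v ->
    (forall t, 0 <= v t <= 1)%R ->
    Z = \int[M]_t (l t * (1 - c * v t))%:E + \int[M]_t (l t * (c * v t))%:E.
  move=> mv v01; rewrite -ge0_integralD//.
  - by apply: eq_integral => t _; rewrite -EFinD -mulrDr subrK mulr1.
  - move=> t _; have /andP[v0 v1] := v01 t.
    by rewrite lee_fin mulr_ge0// subr_ge0 mulr_ile1.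
  - apply/measurable_EFinP; apply: measurable_funM => //; apply: measurable_funB => //.
    exact: measurable_funM.
  - by move=> t _; have /andP[v0 v1] := v01 t; rewrite lee_fin !mulr_ge0.
  - apply/measurable_EFinP; apply: measurable_funM => //.
    exact: measurable_funM.
have E1 := split_onem g mg g01.
have E2 := split_onem (fun=> posterior_mean M l g) (@measurable_cst _ _ _ _ _ _) (fun=> posterior_mean01 Zoo).
rewrite -posterior_meanC// in E2.
have fin : \int[M]_t (l t * (c * g t))%:E \is a fin_num.
  rewrite ge0_fin_numE; last first.
    by apply: integral_ge0 => t _; have /andP[v0 v1] := g01 t; rewrite lee_fin !mulr_ge0.
  apply: le_lt_trans Zoo; rewrite E1 leeDr// integral_ge0// => t _.
  by have /andP[v0 v1] := g01 t; rewrite lee_fin mulr_ge0// subr_ge0 mulr_ile1.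
by rewrite -[LHS](addeK _ fin) -E1 E2 addeK.
Qed.

Lemma is_posterior_mean (Q : probability (measurableTypeR R) R) : is_posterior M l Q ->
  \int[Q]_t (g t)%:E = (posterior_mean M l g)%:E.
Proof.
move=> [/andP[Z1 Zoo] HQ]; have Zfin : Z \is a fin_num by rewrite ge0_fin_numE.
have Zgfin : Zg \is a fin_num by rewrite ge0_fin_numE// (le_lt_trans ZgZ).
pose l' t : R := ((fine Z)^-1 * l t)%R.
have Zi0 : (0 <= (fine Z)^-1)%R by rewrite invr_ge0 fine_ge0.
have ml' : measurable_fun (setT : set (measurableTypeR R)) l' by exact: measurable_funM.
have l'0 t : (0 <= l' t)%R by rewrite mulr_ge0.
transitivity (\int[density M ml' l'0]_t (g t)%:E).
  apply: eq_measure_integral => B mB _; etransitivity; first exact: HQ.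
  rewrite -ge0_integralZl_EFin//.
  - by move=> t _; rewrite lee_fin.
  - exact: measurable_funTS.
rewrite integral_density//; last 2 first.
- exact/measurable_EFinP.
- by move=> t; rewrite lee_fin; case/andP: (g01 t).
under eq_integral do rewrite -EFinM -mulrA EFinM.
rewrite ge0_integralZl_EFin//; last by move=> t _; rewrite lee_fin.
by rewrite -/Zg -(fineK Zgfin) -EFinM mulrC /posterior_mean -/Z -/Zg.
Qed.

End posterior_mean.

Lemma is_posterior_nneg {R : realType} (M : {measure set (measurableTypeR R) -> \bar R})
    (l : R -> R) (Q : probability (measurableTypeR R) R) :
  measurable_fun (setT : set (measurableTypeR R)) l ->
  M [set t : R | (t < 0)%R] = 0 -> is_posterior M l Q ->
  Q [set t : R | (t < 0)%R] = 0.
Proof.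
move=> ml M0 [_ HQ].
rewrite HQ ?(null_set_integral measurable_negative) ?mule0//; last exact: measurable_negative.
by apply/measurable_EFinP; exact: measurable_funTS.
Qed.

(** * Conditional laws of random measures *)

Lemma kernel_of_probabilities {R : realType} d (X : measurableType d) d'
    (Y : measurableType d') (k : X -> probability Y R) :
  (forall U, measurable U -> measurable_fun setT (fun x => k x U)) ->
  exists kappa : R.-pker X ~> Y, forall x U, kappa x U = k x U.
Proof.
move=> mk; pose k0 : X -> {measure set Y -> \bar R} := k.
pose k1 : R.-ker X ~> Y := HB.pack k0 (isKernel.Build _ _ X Y R k0 mk).
pose K : R.-pker X ~> Y := HB.pack k0 k1
  (Kernel_isProbability.Build _ _ X Y R k1 (fun x => probability_setT (k x))).
by exists K.
Qed.

Section conditional_law.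
Context {R : realType} dPsi (Psi : measurableType dPsi).
Let M := measure_space Psi R.

Lemma measure_space_ind (H : set (M -> R)) :
  (forall f g, unit_fun f -> unit_fun g -> unit_fun (fun m => f m - g m)%R ->
    H f -> H g -> H (fun m => f m - g m)%R) ->
  (forall (u : nat -> M -> R) f, (forall n, unit_fun (u n)) -> unit_fun f ->
    (forall m, u n m @[n --> \oo] --> f m) -> (forall n, H (u n)) -> H f) ->
  (forall s, H (fun m => eN (\sum_(j <- s) functional j m))) ->
  forall C, measurable C -> H \1_C.
Proof.
move=> Hdiff Hlim Hexp C /measure_space_generated.
by apply: (unit_fun_ind (fun j => @functional_ge0 _ _ _ j) (fun j => @measurable_functional _ _ _ j)).
Qed.

Lemma measure_space_unique (A B : (M -> R) -> \bar R) : daniell A -> daniell B ->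
  (forall s, A (fun m => eN (\sum_(j <- s) functional j m)) =
             B (fun m => eN (\sum_(j <- s) functional j m))) ->
  forall C, measurable C -> A \1_C = B \1_C.
Proof.
move=> dA dB AB C /measure_space_generated.
exact: (daniell_unique (fun j => @functional_ge0 _ _ _ j) (fun j => @measurable_functional _ _ _ j)).
Qed.

Let unit_exp s : unit_fun (fun m : M => eN (\sum_(j <- s) functional j m)).
Proof.
apply: unit_eN; first by apply: emeasurable_sum => j; exact: measurable_functional.
by move=> m; apply: sume_ge0 => j _; exact: functional_ge0.
Qed.

Context d (Omega : measurableType d) (P : probability Omega R).
Context (k : M -> probability M R).
Hypothesis mk : forall C, measurable C -> measurable_fun setT (fun m => k m C).

Let K (f : M -> R) m : R := fine (\int[k m]_y (f y)%:E).

Let unit_K f : unit_fun f -> unit_fun (K f).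
Proof.
move=> [mf f01]; split=> [|m].
  apply: measurableT_comp; first exact: fine_measurable.
  apply: (@measurable_fun_integral_kernel _ _ _ _ _ (fun m => k m)) => //.
  - by move=> m; rewrite lee_fin; case/andP: (f01 m).
  - exact/measurable_EFinP.
have /andP[a b] := expectation_le1 (k m) mf f01.
by rewrite fine_ge0//= -lee_fin fineK// ge0_fin_numE// (le_lt_trans b)// ltry.
Qed.

Lemma daniell_kernel (e : Omega -> R) (X : Omega -> M) :
  unit_fun e -> measurable_fun setT X ->
  daniell (fun f => \int[P]_w (K f (X w) * e w)%:E).
Proof.
move=> ue mX; have [dB dL] := daniell_expectation P ue mX; split.
- move=> f g uf ug ufg; have [mf f01] := uf; have [mg g01] := ug.
  have KB : K (fun m => f m - g m)%R = (fun m => K f m - K g m)%R.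
    apply/funext => m; rewrite /K (expectationB (k m) mf mg f01 g01) fineB//.
      exact: expectation_fin.
    exact: expectation_fin.
  by rewrite KB; apply: dB; [exact: unit_K|exact: unit_K|rewrite -KB; exact: unit_K].
- move=> u f uu uf cvg; apply: (dL (fun n => K (u n))); [by move=> n; exact: unit_K|exact: unit_K|].
  move=> m; apply: fine_cvg; rewrite fineK; last by case: uf => mf f01; exact: expectation_fin.
  apply: cvg_integral01 => //; first by move=> n; case: (uu n).
  by move=> n y; case: (uu n).
Qed.

(** The exponentials of the functionals suffice, first in place of the event of
    [Theta] and then in place of the event of [X]. *)
Lemma regular_conditional_distribution_laplace (X Theta : Omega -> M) :
  measurable_fun setT X -> measurable_fun setT Theta ->
  (forall s1 s2 : seq (functional_index Psi),
    \int[P]_w (eN (\sum_(j <- s1) functional j (X w)) *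
               eN (\sum_(j <- s2) functional j (Theta w)))%:E =
    \int[P]_w (eN (\sum_(j <- s1) functional j (X w)) *
               fine (\int[k (X w)]_m (eN (\sum_(j <- s2) functional j m))%:E))%:E) ->
  forall C D, measurable C -> measurable D ->
    P (X @^-1` D `&` Theta @^-1` C) = \int[P]_(w in X @^-1` D) k (X w) C.
Proof.
move=> mX mTheta HXT C D mC mD.
have swap (a b : Omega -> R) : \int[P]_w (a w * b w)%:E = \int[P]_w (b w * a w)%:E.
  by apply: eq_integral => w _; rewrite mulrC.
have step1 s : \int[P]_w (\1_C (Theta w) * eN (\sum_(j <- s) functional j (X w)))%:E =
    \int[P]_w (K \1_C (X w) * eN (\sum_(j <- s) functional j (X w)))%:E.
  have ue := unit_comp mX (unit_exp s).
  apply: (measure_space_unique (daniell_expectation P ue mTheta) (daniell_kernel ue mX)) => // s2.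
  by rewrite swap HXT swap.
have uC : unit_fun (\1_C : M -> R) := unit_indic mC.
have := measure_space_unique (daniell_expectation P (unit_comp mTheta uC) mX)
  (daniell_expectation P (unit_comp mX (unit_K uC)) mX) _ mD.
move=> /(_ (fun s => etrans (swap _ _) (etrans (step1 s) (swap _ _)))) E.
transitivity (\int[P]_w (\1_D (X w) * \1_C (Theta w))%:E).
  rewrite -(setIT (_ `&` _)) -integral_indic//; last first.
    by apply: measurableI; exact: measurable_preimage.
  by apply: eq_integral => w _; rewrite indicI.
rewrite E [RHS]integral_mkcond; apply: eq_integral => w _; rewrite patchE.
have KC : (K \1_C (X w))%:E = k (X w) C.
  by rewrite /K integral_indic// setIT fineK// fin_num_measure.
rewrite EFinM KC indicE (_ : (X w \in D) = (w \in X @^-1` D)); last first.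
  by apply/idP/idP => /set_mem ?; exact/mem_set.
by case: (_ \in _); rewrite ?mul1e ?mul0e.
Qed.

End conditional_law.

(** * Measurable functions of the atoms of a measure *)

Lemma counting_eq0 {R : realType} (T : choiceType) (S : set T) : (counting S = 0 :> \bar R) <-> S = set0.
Proof.
rewrite /counting; split => [|->]; last first.
  by rewrite asboolT// fset_set0.
case: asboolP => // fS [] /eqP; rewrite pnatr_eq0 size_eq0 => /eqP s0.
apply/seteqP; split => // q Sq.
have : q \in fset_set S by rewrite in_fset_set//; exact/mem_set.
by rewrite (_ : (q \in fset_set S) = (q \in finmap.enum_fset (fset_set S)))// s0.
Qed.

Lemma esum_finite {R : realType} (T : choiceType) (S : set T) (a : T -> \bar R) :
  finite_set S -> (forall i, 0 <= a i) ->
  \esum_(i in S) a i = \sum_(i <- finmap.enum_fset (fset_set S)) a i.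
Proof. by move=> fS a0; rewrite esum_fset// fsbig_finite. Qed.

Section integer_atoms.
Context {R : realType} dPsi (Psi : measurableType dPsi).
Hypothesis singletons : forall p : Psi, measurable [set p].
Implicit Types (m : measure_space Psi R) (p q : Psi).

(** The mass of [p] as a natural number; [0] when it is not one. *)
Definition mark m p : nat := xget 0%N [set n | ev m [set p] = n%:R%:E].

Lemma markE m p n : ev m [set p] = n%:R%:E -> mark m p = n.
Proof.
move=> mp; rewrite /mark; case: xgetP => [k _ /=|/(_ n)//].
by rewrite mp => -[] /eqP; rewrite eqr_nat => /eqP.
Qed.

Lemma measurable_mass p (B : set (\bar R)) : measurable B ->
  measurable [set m : measure_space Psi R | B (ev m [set p])].
Proof.
move=> mB; rewrite (_ : [set m | _] = functional (inl (exist _ [set p] (singletons p))) @^-1` B)//.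
apply: measurable_preimage => //; exact: measurable_functional.
Qed.

Lemma measurable_mark p n : measurable [set m : measure_space Psi R | mark m p = n].
Proof.
pose C k := [set m : measure_space Psi R | ev m [set p] = k%:R%:E].
have mC k : measurable (C k) by apply: (measurable_mass p (emeasurable_set1 k%:R%:E)).
rewrite (_ : [set m | _] = C n `|` ((if n == 0%N then setT else set0) `&` ~` \bigcup_k C k)).
  apply: measurableU => //; apply: measurableI; first by case: ifP.
  by apply: measurableC; exact: bigcup_measurable.
apply/seteqP; split => m /=.
  rewrite /mark; case: xgetP => [k _ Ck <-|H <-]; first by left.
  by right; rewrite eqxx; split => // -[k _]; exact: H.
move=> [Cn|[]]; first exact: markE.
rewrite /mark; case: xgetP => [k _ Ck _ H|H]; last by case: eqP.
by exfalso; apply: H; exists k.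
Qed.

Context (D : set Psi) (mD : measurable D) (V : set (measure_space Psi R)) (mV : measurable V).
Let atoms m := [set q | atom m q /\ D q].
Hypothesis finite_atoms : forall m, V m -> finite_set (atoms m).
Hypothesis integer_atoms : forall m q, V m -> atoms m q -> exists n : nat, ev m [set q] = n%:R%:E.

Let mVb : measurable_fun setT (fun m : measure_space Psi R => m \in V).
Proof. exact: measurable_mem. Qed.

(** For an indicator this is a number of atoms, which is measurable by the choice
    of the sigma-algebra. *)
Lemma measurable_atom_sum_at (v : Psi -> \bar R) n : measurable_fun setT v ->
  (forall q, 0 <= v q) ->
  measurable_fun setT (fun m => if m \in V then
    \esum_(q in atoms m `&` [set q | ev m [set q] = n%:R%:E]) v q else 0).
Proof.
move=> mv v0; pose S m := atoms m `&` [set q | ev m [set q] = n%:R%:E].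
have fS m : V m -> finite_set (S m) by move=> Vm; apply: finite_setIl; exact: finite_atoms.
apply: (@nnfun_ind R _ Psi (fun v => measurable_fun setT
  (fun m => if m \in V then \esum_(q in S m) v q else 0))) => //.
- move=> A mA; rewrite (_ : (fun m => _) = fun m => if m \in V then
      atom_count m (A `&` D) [set n%:R%:E] else 0).
    apply: measurable_fun_ifT => //.
    exact: (measurable_functional (inr (exist (fun AB => measurable AB.1 /\ measurable AB.2)
      (A `&` D, [set n%:R%:E]) (conj (measurableI _ _ mA mD) (emeasurable_set1 n%:R%:E))))).
  apply/funext => m; case: ifP => // _; rewrite /atom_count counting_esum.
  rewrite [LHS]esum_mkcond [RHS]esum_mkcond; apply: eq_esum => q _.
  rewrite indicE; case: ifPn => [/set_mem [[mq Dq] qn]|/negP nS].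
    case: ifPn => [/set_mem [[Aq _] _ _]|/negP nC]; first by rewrite mem_set.
    rewrite memNset// => Aq; apply: nC; apply/mem_set; split => //.
  case: ifPn => [/set_mem [[Aq Dq] mq qn]|//].
  by exfalso; apply: nS; apply/mem_set.
- move=> c f c0 f0 mf; rewrite (_ : (fun m => _) = fun m => c%:E *
      (if m \in V then \esum_(q in S m) f q else 0)).
    exact: measurable_funeM.
  apply/funext => m; case: ifPn => [/set_mem Vm|_]; last by rewrite mule0.
  rewrite !esum_finite//; [|exact: fS|exact: fS|by move=> q; rewrite mule_ge0].
  by rewrite ge0_sume_distrr.
- move=> f g f0 g0 mf mg; rewrite (_ : (fun m => _) = fun m =>
      (if m \in V then \esum_(q in S m) f q else 0) + (if m \in V then \esum_(q in S m) g q else 0)).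
    exact: emeasurable_funD.
  by apply/funext => m; case: ifP => _; rewrite ?esumD ?adde0.
- move=> u g mu u0 und ug; have g0 q : 0 <= g q.
    rewrite -(cvg_lim _ (ug q))//; apply: lime_ge; last exact: nearW.
    by apply/cvg_ex; exists (g q); exact: ug.
  apply: (emeasurable_fun_cvg _ _ mu) => m _ /=.
  case: ifPn => [/set_mem Vm|_]; last exact: cvg_cst.
  rewrite esum_finite//; last exact: fS.
  rewrite (_ : (fun k => _) = fun k => \sum_(q <- finmap.enum_fset (fset_set (S m))) u k q).
    by apply: cvg_nnesum => q _; [exact: nearW|exact: ug].
  by apply/funext => k; rewrite esum_finite//; exact: fS.
Qed.

Lemma measurable_atom_sum (v : nat -> Psi -> \bar R) :
  (forall n, measurable_fun setT (v n)) -> (forall n q, 0 <= v n q) ->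
  measurable_fun setT (fun m => if m \in V then
    \esum_(q in atoms m) v (mark m q) q else 0).
Proof.
move=> mv v0; rewrite (_ : (fun m => _) = fun m => \sum_(0 <= n <oo) if m \in V then
    \esum_(q in atoms m `&` [set q | ev m [set q] = n%:R%:E]) v n q else 0).
  apply: (@ge0_emeasurable_sum _ _ _ _ (fun n m => if m \in V then
    \esum_(q in atoms m `&` [set q | ev m [set q] = n%:R%:E]) v n q else 0) xpredT).
    by move=> n m _ _; case: ifP => // _; exact: esum_ge0.
  by move=> n _; exact: measurable_atom_sum_at.
apply/funext => m; case: ifPn => [/set_mem Vm|_]; last by rewrite eseries0.
have fm := finite_atoms Vm.
rewrite esum_finite//.
under eq_eseriesr => n _.
  rewrite esum_mkcondr esum_finite//; last by move=> q; case: ifP.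
  over.
rewrite nneseries_sum; last by move=> q n _; case: ifP.
rewrite !big_seq; apply: eq_bigr => q.
rewrite in_fset_set// => /set_mem /(integer_atoms Vm) [n qn].
rewrite (markE qn) (nneseriesD1 (n := n))//; last by move=> k _; case: ifP.
rewrite mem_set// eseries0 ?adde0// => k _ /= kn.
rewrite memNset//= qn => -[] /eqP; rewrite eqr_nat => /eqP nk.
by rewrite nk eqxx in kn.
Qed.

End integer_atoms.

(** * Independent extensions and random enumerations *)

Lemma ae_pullback {R : realType} d1 (T1 : measurableType d1) d (T : measurableType d)
    (P1 : {measure set T1 -> \bar R}) (P : {measure set T -> \bar R})
    (pi : T1 -> T) (Q : T -> Prop) : measurable_fun setT pi ->
  (forall E, measurable E -> P1 (pi @^-1` E) = P E) ->
  {ae P, forall w, Q w} -> {ae P1, forall w, Q (pi w)}.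
Proof.
move=> mpi Ppi [N [mN N0 HN]]; exists (pi @^-1` N); split.
- exact: measurable_preimage.
- by rewrite Ppi.
- by move=> w /= Hw; apply: HN.
Qed.

Section independent_extension.
Context {R : realType} (I : finType) (F : I -> probability (measurableTypeR R) R).

(** The variables are adjoined one at a time, by taking products with the real
    line. *)
Lemma independent_extension d (Omega : measurableType d) (P : probability Omega R) :
  exists d1 (Omega1 : measurableType d1) (P1 : probability Omega1 R)
    (pi : Omega1 -> Omega) (t : I -> Omega1 -> measurableTypeR R),
  [/\ measurable_fun setT pi, (forall i, measurable_fun setT (t i)) &
   forall E (B : I -> set (measurableTypeR R)), measurable E -> (forall i, measurable (B i)) ->
     P1 (pi @^-1` E `&` [set w | forall i, B i (t i w)]) = P E * \prod_i F i (B i)].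
Proof.
(* The events constrain the indices of a list, which is extended by one index at
   a time. *)
suff : exists d1 (Omega1 : measurableType d1) (P1 : probability Omega1 R)
    (pi : Omega1 -> Omega) (t : I -> Omega1 -> measurableTypeR R),
  [/\ measurable_fun setT pi, (forall i, measurable_fun setT (t i)) &
   forall E (B : I -> set (measurableTypeR R)), measurable E -> (forall i, measurable (B i)) ->
     P1 (pi @^-1` E `&` [set w | forall i, i \in index_enum I -> B i (t i w)]) = P E * \prod_(i <- index_enum I) F i (B i)].
  case=> d1 [] Omega1 [] P1 [] pi [] t [] mpi mt H.
  exists d1, Omega1, P1, pi, t; split => // E B mE mB; rewrite -H//; congr (P1 (_ `&` _)).
  by apply/seteqP; split => w Hw i; [move=> _|apply: Hw; rewrite mem_index_enum].
elim: (index_enum I) (index_enum_uniq I) => [_|i s IH /= /andP[is_ us]].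
  exists d, Omega, P, id, (fun _ _ => 0%R); split => // E B mE mB.
  rewrite big_nil mule1; congr (P _).
  by apply/seteqP; split => w //= [].
case: (IH us) => d1 [] Omega1 [] P1 [] pi [] t [] mpi mt H.
have P2T : (P1 \x F i) setT = 1.
  rewrite -setXTT product_measure1E// -[RHS]mule1.
  by congr (_ * _); exact: probability_setT.
pose P2 : probability (Omega1 * measurableTypeR R)%type R :=
  HB.pack (P1 \x F i) (Measure_isProbability.Build _ _ _ (P1 \x F i) P2T).
exists _, (Omega1 * measurableTypeR R)%type, P2, (pi \o fst),
  (fun j w => if j == i then w.2 else t j w.1); split.
- exact: measurableT_comp.
- move=> j; case: eqP => _; first exact: measurable_snd.
  exact: (measurableT_comp (mt j) measurable_fst).
move=> E B mE mB; rewrite big_cons.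
rewrite (_ : _ `&` _ = (pi @^-1` E `&` [set w | forall j, j \in s -> B j (t j w)]) `*` B i); last first.
  apply/seteqP; split => [[w y] /= [Ew Hw]|[w y] /= [[Ew Hw] By]].
    split; last by have := Hw i; rewrite in_cons eqxx; apply.
    split => // j js; have := Hw j; rewrite in_cons js orbT => /(_ isT).
    by case: eqP => // ji; move: is_; rewrite -ji js.
  split => // j; rewrite in_cons => /predU1P[->|js]; first by rewrite eqxx.
  by case: eqP => [ji|_]; [move: is_; rewrite -ji js|exact: Hw].
have mS : measurable (pi @^-1` E `&` [set w | forall j, j \in s -> B j (t j w)]).
  apply: measurableI; first exact: measurable_preimage.
  elim: (s) => [|j s' IHs]; first by rewrite (_ : [set w | _] = setT)//; apply/seteqP; split.
  rewrite (_ : [set w | _] = t j @^-1` (B j) `&` [set w | forall j, j \in s' -> B j (t j w)]).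
    by apply: measurableI => //; exact: measurable_preimage.
  apply/seteqP; split => w /=.
    by move=> Hw; split=> [|k ks]; apply: Hw; rewrite in_cons ?eqxx// ks orbT.
  by move=> [H1 H2] k; rewrite in_cons => /predU1P[->//|]; exact: H2.
transitivity (P1 (pi @^-1` E `&` [set w | forall j, j \in s -> B j (t j w)]) * F i (B i)).
  exact: product_measure1E.
by rewrite H// -muleA; congr (_ * _); rewrite muleC.
Qed.

End independent_extension.

Section nth_true.
Implicit Types (b : nat -> bool).

Definition rank b k := (\sum_(i < k) b i)%N.

Definition nth_true b j := xget 0%N [set k | b k /\ rank b k = j].

Lemma rankS b k : rank b k.+1 = (rank b k + b k)%N.
Proof. by rewrite /rank big_ord_recr. Qed.

Lemma le_rank b k l : (k <= l)%N -> (rank b k <= rank b l)%N.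
Proof.
move=> /subnKC <-; elim: (l - k)%N => [|n IH]; first by rewrite addn0.
by rewrite addnS rankS (leq_trans IH)// leq_addr.
Qed.

Lemma rank_inj b k l : b k -> b l -> rank b k = rank b l -> k = l.
Proof.
move=> bk bl; wlog kl : k l bk bl / (k <= l)%N => [H|].
  by move=> rkl; case/orP: (leq_total k l) => h; [exact: H|apply/esym/H].
move: kl; rewrite leq_eqVlt => /predU1P[//|/(le_rank b)].
by rewrite rankS bk addn1 => + rkl; rewrite rkl ltnn.
Qed.

(** The rank grows by steps of at most one and is unbounded. *)
Lemma rank_surj b j : infinite_set [set k | b k] -> exists k, b k /\ rank b k = j.
Proof.
move=> inf_b.
have unb n : exists k, (n <= rank b k)%N.
  elim: n => [|n [k nk]]; first by exists 0%N.
  have [l [kl bl]] : exists l, (k <= l)%N /\ b l.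
    apply: contrapT => H; apply: inf_b.
    apply: (@sub_finite_set _ _ `I_k); last exact: finite_II.
    move=> l /= bl; rewrite ltnNge; apply/negP => kl; apply: H.
    by exists l.
  by exists l.+1; rewrite rankS bl addn1 ltnS (leq_trans nk)// le_rank.
have Hj : exists k, (j < rank b k.+1)%N.
  by have [k kj] := unb j.+1; exists k; rewrite (leq_trans kj)// le_rank.
case: (ex_minnP Hj) => k jk kmin; exists k.
have kj : (rank b k <= j)%N.
  case: k kmin {jk} => [|k] kmin; first by rewrite /rank big_ord0.
  by rewrite leqNgt; apply/negP => /kmin; rewrite ltnn.
move: jk; rewrite rankS; case: (b k); last by rewrite addn0 ltnNge kj.
by rewrite addn1 ltnS => jk; split => //; apply/eqP; rewrite eqn_leq kj jk.
Qed.

Lemma nth_trueP b j : infinite_set [set k | b k] -> b (nth_true b j) /\ rank b (nth_true b j) = j.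
Proof.
move=> inf_b; rewrite /nth_true; case: xgetP => [k _ //|H].
by have [k Hk] := rank_surj j inf_b; case: (H k).
Qed.

Lemma nth_true_inj b : infinite_set [set k | b k] -> injective (nth_true b).
Proof. by move=> inf_b i j ij; rewrite -(proj2 (nth_trueP i inf_b)) ij; case: (nth_trueP j inf_b). Qed.

Lemma range_nth_true b : infinite_set [set k | b k] -> range (nth_true b) = [set k | b k].
Proof.
move=> inf_b; apply/seteqP; split => [_ [j _ <-]|k /= bk].
  by case: (nth_trueP j inf_b).
exists (rank b k) => //; have [bn rn] := nth_trueP (rank b k) inf_b.
exact: rank_inj rn.
Qed.

Lemma sum_nth_true {R : realType} b (f : nat -> \bar R) :
  infinite_set [set k | b k] -> (forall k, 0 <= f k) ->
  \sum_(0 <= j <oo) f (nth_true b j) = \sum_(0 <= k <oo) (if b k then f k else 0).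
Proof.
move=> inf_b f0; rewrite nneseries_esumT// nneseries_esumT; last by move=> k; case: ifP.
rewrite -(@esum_image R nat nat setT (nth_true b) f)//; last by move=> i j _ _; exact: nth_true_inj.
rewrite range_nth_true// esum_mkcond; apply: eq_esum => k _.
congr (if _ then _ else _); apply/idP/idP => [/set_mem//|bk].
exact/mem_set.
Qed.

(** The default value [0] is taken when no index has rank [j]; this too is an
    event. *)
Lemma measurable_nth_true d (Omega : measurableType d) (b : nat -> Omega -> bool) j k :
  (forall k, measurable [set w | b k w]) ->
  measurable [set w | nth_true (b ^~ w) j = k].
Proof.
move=> mb.
have mr l i : measurable [set w | rank (b ^~ w) l = i].
  elim: l i => [|l IH] i.
    have [->|i0] := eqVneq i 0%N.
      rewrite (_ : [set w | _] = setT)//; apply/seteqP; split => // w _ /=.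
      by rewrite /rank big_ord0.
    rewrite (_ : [set w | _] = set0)//; apply/seteqP; split => // w /=.
    by rewrite /rank big_ord0 => i0'; rewrite -i0' eqxx in i0.
  rewrite (_ : [set w | _] = ([set w | b l w] `&` [set w | rank (b ^~ w) l = i.-1 /\ (0 < i)%N])
     `|` (~` [set w | b l w] `&` [set w | rank (b ^~ w) l = i])).
    apply: measurableU; apply: measurableI => //; last exact: measurableC.
    case: i => [|i]; last by rewrite (_ : [set w | _] = [set w | rank (b ^~ w) l = i])//; apply/seteqP; split => w /= => [[]|].
    by rewrite (_ : [set w | _] = set0)//; apply/seteqP; split => w //= [].
  apply/seteqP; split => w /=; rewrite rankS.
    have [blw|/negbTE blw] := boolP (b l w); rewrite ?addn1 ?addn0 => <-; first by left.
    by right.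
  move=> [[-> [-> i0]]|[/negP/negbTE -> ->]]; last by rewrite addn0.
  by rewrite addn1 prednK.
pose C k := [set w | b k w /\ rank (b ^~ w) k = j].
have mC l : measurable (C l).
  by rewrite (_ : C l = [set w | b l w] `&` [set w | rank (b ^~ w) l = j])//; exact: measurableI.
rewrite (_ : [set w | _] = C k `|` ((if k == 0%N then setT else set0) `&` ~` \bigcup_l C l)).
  apply: measurableU => //; apply: measurableI; first by case: ifP.
  by apply: measurableC; exact: bigcup_measurable.
apply/seteqP; split => w /=.
  rewrite /nth_true; case: xgetP => [l -> Cl <-|H <-]; first by left.
  by right; rewrite eqxx; split => // -[l _]; exact: H.
rewrite /nth_true; case: xgetP => [l _ [bl rl]|H].
  move=> [[bk rk]|[_ H]]; first by apply: (@rank_inj (b ^~ w)) => //; rewrite rl.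
  by exfalso; apply: H; exists l.
move=> [Ck|[]]; first by case: (H k).
by case: eqP.
Qed.

End nth_true.

(** * Splitting the ordinary atoms by their marks *)

Section thinning.
Context {R : realType} dPsi (Psi : measurableType dPsi).
Hypothesis singletons : forall p : Psi, measurable [set p].
Context d (Omega : measurableType d) (P : probability Omega R) (I : finType)
  (psi_fix : I -> Psi) (F : I -> probability (measurableTypeR R) R)
  (nu : {sigma_finite_measure set (measurableTypeR R) -> \bar R})
  (G : probability Psi R) (G_diffuse : forall p, G [set p] = 0)
  (theta : I + nat -> Omega -> measurableTypeR R)
  (psi : I + nat -> Omega -> Psi)
  (Hcrm : crm_atoms P psi_fix F (nu \x G) theta psi).
Context (h : nat -> R -> R) (x : I + nat -> Omega -> nat).
Hypothesis mh : forall n, measurable_fun setT (h n).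
Hypothesis h0 : forall n t, (0 <= h n t)%R.
Hypothesis h1 : forall t, \sum_(0 <= n <oo) (h n t)%:E = 1.
Hypothesis Hx : conditionally_independent_marks P theta psi h x.

Let pt k w := (theta (inr k) w, psi (inr k) w).
Let mpt k : measurable_fun setT (pt k).
Proof. exact: measurable_ordinary_point Hcrm k. Qed.

Let mx i : measurable_fun setT (x i).
Proof. by case: Hx. Qed.

(** The rate of the weights of the ordinary points that receive the mark [n]. *)
Definition nu_part n : {sigma_finite_measure set (measurableTypeR R) -> \bar R} :=
  thinned nu (mh n) (h0 n) (pmf_le1 h0 h1 n).

Lemma integral_nu_part n (g : measurableTypeR R * Psi -> \bar R) :
  measurable_fun setT g -> (forall p, 0 <= g p) ->
  \int[nu_part n \x G]_p g p = \int[nu \x G]_p ((h n p.1)%:E * g p).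
Proof.
move=> mg g0.
have mhg : measurable_fun setT (fun p : measurableTypeR R * Psi => (h n p.1)%:E * g p).
  apply: emeasurable_funM => //; apply/measurable_EFinP.
  exact: (measurableT_comp (mh n) measurable_fst).
rewrite fubini_tonelli1// [RHS]fubini_tonelli1//; last by move=> p; rewrite mule_ge0// lee_fin.
have mF := @measurable_fun_fubini_tonelli_F _ _ _ _ _ G g mg g0.
have F0 t : 0 <= fubini_F G g t by apply: integral_ge0 => y _.
transitivity (\int[nu]_t ((h n t)%:E * fubini_F G g t)).
  exact: integral_density.
apply: eq_integral => t _; rewrite /fubini_F /= ge0_integralZl_EFin//.
exact: (measurableT_comp mg (measurable_pair1 _)).
Qed.

(** This is the Laplace functional of a Poisson process with rate
    [nu_part n \x G]: the points that receive the mark [n] form such a process. *)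
Lemma mark_part_laplace n (f : measurableTypeR R * Psi -> \bar R) :
  measurable_fun setT f -> (forall p, 0 <= f p) ->
  \int[P]_w (eN (\sum_(0 <= k <oo) (if x (inr k) w == n then f (pt k w) else 0)))%:E =
  (eN (\int[nu_part n \x G]_p (1 - eN (f p))%R%:E))%:E.
Proof.
move=> mf f0.
pose g p m : \bar R := if m == n then f p else 0.
have g0 p m : 0 <= g p m by rewrite /g; case: eqP.
have := marked_laplace Hcrm mh h0 h1 Hx (phi := fun _ _ _ => 1%R) (g := g) _ _ _ g0.
under eq_integral do rewrite big1// mul1r.
move=> -> //; last 2 first.
- by move=> k t m; rewrite ler01 lexx.
- by move=> m; rewrite /g; case: eqP => // _; exact: measurable_cst.
rewrite big1 ?mul1r; last first.
  move=> k _; under eq_integral do rewrite mixture_cst1//.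
  by rewrite integral_cst1.
congr (eN _)%:E; rewrite integral_nu_part//; last 2 first.
- apply/measurable_EFinP; apply: measurable_funB => //.
  exact: (measurableT_comp measurable_eN mf).
- by move=> p; rewrite lee_fin subr_ge0 eN_le1.
apply: eq_integral => p _; rewrite onem_mixture//; last first.
  by move=> m; rewrite eN_ge0 eN_le1.
rewrite (nneseriesD1 (n := n))//; last first.
  by move=> m _; rewrite lee_fin mulr_ge0// subr_ge0 eN_le1.
rewrite /g eqxx eseries0 ?adde0// => m _ /= /negbTE mn.
by rewrite mn eN0 subrr mulr0.
Qed.

Lemma measurable_zero_mark k : measurable_fun setT (fun w => x (inr k) w == 0%N).
Proof.
apply: (measurable_fun_bool true); rewrite setTI.
rewrite (_ : _ @^-1` _ = x (inr k) @^-1` [set 0%N]); last first.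
  by apply/seteqP; split => w /= /eqP.
exact: measurable_preimage.
Qed.

Hypothesis nu_infinite : nu setT = +oo.
Hypothesis h_summable : \sum_(1 <= n <oo) \int[nu]_t (h n t)%:E < +oo.

(** The nonzero marks account for a finite part of the infinite rate. *)
Lemma nu_part0_infinite : nu_part 0%N setT = +oo.
Proof.
have mhE n : measurable_fun setT (fun t : measurableTypeR R => (h n t)%:E).
  by apply/measurable_EFinP; exact: mh.
have := nu_infinite; rewrite -[nu setT]mul1e -integral_cst//.
rewrite (_ : \int[nu]_t cst 1 t = \int[nu]_t \sum_(0 <= n <oo) (h n t)%:E); last first.
  by apply: eq_integral => t _; rewrite h1.
rewrite integral_nneseries//; last by move=> n t _; rewrite lee_fin.
rewrite nneseries_recl//; last by move=> n _; apply: integral_ge0 => t _; rewrite lee_fin.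
move=> E; apply/eqP; rewrite -leye_eq leNgt; apply/negP => lt.
suff : (\int[nu]_t (h 0%N t)%:E + \sum_(1 <= n <oo) \int[nu]_t (h n t)%:E < +oo).
  by rewrite E ltxx.
by rewrite lte_add_pinfty.
Qed.

Lemma integral_eN_eq0 (N : Omega -> \bar R) : measurable_fun setT N ->
  (forall w, 0 <= N w) -> \int[P]_w (eN (N w))%:E = 0 ->
  {ae P, forall w, N w = +oo}.
Proof.
move=> mN N0 E.
have meN : measurable_fun setT (fun w => (eN (N w))%:E).
  by apply/measurable_EFinP; exact: (measurableT_comp measurable_eN mN).
have : \int[P]_w `|(eN (N w))%:E| = 0.
  by under eq_integral do rewrite gee0_abs ?lee_fin ?eN_ge0//.
move/(ae_eq_integral_abs P measurableT meN).
apply: filterS => w /(_ Logic.I) /=; have := N0 w; case: (N w) => //= r _ [] /eqP.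
by rewrite expR_eq0.
Qed.

(** Their number is Poisson with infinite mean. *)
Lemma infinitely_many_zero_marks :
  {ae P, forall w, infinite_set [set k | x (inr k) w == 0%N]}.
Proof.
pose N w : \bar R := \sum_(0 <= k <oo) (if x (inr k) w == 0%N then 1 else 0).
have N0 w : 0 <= N w by apply: nneseries_ge0 => k _ _; case: ifP.
have mN : measurable_fun setT N.
  apply: (@ge0_emeasurable_sum _ _ _ _ (fun k w => if x (inr k) w == 0%N then 1 else 0) xpredT).
    by move=> k w _ _; case: ifP.
  move=> k _; apply: measurable_fun_ifT => //.
  exact: measurable_zero_mark.
have := @mark_part_laplace 0%N (cst 1) (measurable_cst _) (fun=> lee01).
have -> : \int[nu_part 0%N \x G]_p (1 - eN (cst 1%E p : \bar R))%R%:E = +oo.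
  etransitivity; first exact: (integral_cst _ measurableT (1 - eN (1%E : \bar R))%R%:E).
  rewrite [X in (_ * X)%E](_ : _ = +oo); last first.
    rewrite -setXTT; transitivity (nu_part 0%N setT * G setT); first exact: product_measure1E.
    rewrite nu_part0_infinite (_ : G setT = 1) ?mule1//; exact: probability_setT.
  by rewrite mulry gtr0_sg ?mul1e// /= subr_gt0 -[ltRHS]expR0 ltr_expR oppr_lt0.
move/(integral_eN_eq0 mN N0); apply: filterS => w Nw fin.
suff : N w < +oo by rewrite Nw ltxx.
rewrite /N nneseries_esumT; last by move=> k; case: ifP.
rewrite (_ : \esum_(k in _) _ = \esum_(k in [set k | x (inr k) w == 0%N]) 1).
  by rewrite -counting_esum /counting asboolT// ltry.
rewrite [RHS]esum_mkcond; apply: eq_esum => k _.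
by congr (if _ then _ else _); apply/idP/idP => [?|/set_mem//]; exact/mem_set.
Qed.

(** The number of points located at [q] is Poisson with mean zero, since a diffuse
    law does not charge [q]. *)
Lemma ordinary_location_ae (q : Psi) : {ae P, forall w, forall k, psi (inr k) w <> q}.
Proof.
pose S : set (measurableTypeR R * Psi) := setT `*` [set q].
have mS : measurable S by exact: measurableX.
have S0 : (nu \x G) S = 0.
  transitivity (nu setT * G [set q]); first exact: product_measure1E.
  by rewrite G_diffuse mule0.
have [pp _] := crm_poisson Hcrm.
have := pp S 0%N mS; rewrite S0 /= /poisson_prob ltxx diracE mem_set// => PN.
have mC := measurable_point_count (R := R) mpt mS.
exists (~` [set w | point_count R pt S w = 0%:E]); split.
- apply: measurableC; rewrite (_ : [set w | _] = point_count R pt S @^-1` [set 0%:E])//.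
  exact: measurable_preimage.
- rewrite probability_setC; last first.
    rewrite (_ : [set w | _] = point_count R pt S @^-1` [set 0%:E])//.
    exact: measurable_preimage.
  by rewrite (_ : P _ = 1)// subee.
move=> w /=; apply: contra_not => E k pk.
move: E; rewrite point_countE /psum (nneseriesD1 (n := k))//.
rewrite indicE mem_set//= => E.
have : (0 : \bar R) < 1 + \sum_(0 <= j <oo | j != k) (\1_S (pt j w))%:E.
  by apply: (lt_le_trans lte01); rewrite leeDl// nneseries_ge0.
by rewrite E ltxx.
Qed.

(** The law is constructed on an extension of the given probability space: its
    ordinary points are the ordinary points with mark zero, of which there are
    infinitely many and which are enumerated increasingly, and its fixed-location
    weights are independent variables that are adjoined. *)
Lemma thinned_crm_law (J : finType) (psi0 : J -> Psi)
    (F0 : J -> probability (measurableTypeR R) R) :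
  injective psi0 -> (forall j, F0 j [set t : R | (t < 0)%R] = 0) ->
  exists Q : probability (measure_space Psi R) R, crm_law Q psi0 F0 (nu_part 0%N \x G).
Proof.
move=> psi0_inj F0_neg.
case: (independent_extension F0 P) => d1 [] Omega1 [] P1 [] pi [] t [] mpi mt ext.
have mE E : measurable E -> measurable (pi @^-1` E).
  exact: measurable_preimage.
have Ppi E : measurable E -> P1 (pi @^-1` E) = P E.
  move=> mE'; have := ext E (fun=> setT) mE' (fun=> measurableT).
  rewrite (_ : [set w | _] = setT); last by apply/seteqP; split.
  rewrite setIT => ->; rewrite big1 ?mule1// => j _; exact: probability_setT.
have tlaw j B : measurable B -> P1 (t j @^-1` B) = F0 j B.
  move=> mB; have := ext setT (fun i => if i == j then B else setT) measurableT _.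
  rewrite preimage_setT setTI (_ : [set w | _] = t j @^-1` B); last first.
    apply/seteqP; split => w /=; first by move=> /(_ j); rewrite eqxx.
    by move=> Bw i; case: eqP => [->|].
  move=> ->; last by move=> i; case: eqP.
  rewrite (_ : P setT = 1); last exact: probability_setT.
  rewrite mul1e (bigD1 j)//= eqxx big1 ?mule1// => i /negbTE ->.
  exact: probability_setT.
pose b k w := x (inr k) w == 0%N.
have mb k : measurable [set w | b k w].
  rewrite (_ : [set w | _] = x (inr k) @^-1` [set 0%N]); last first.
    by apply/seteqP; split => w /eqP.
  exact: measurable_preimage.
pose s j w := nth_true (b ^~ w) j.
have ms j k : measurable [set w | s j w = k] by exact: measurable_nth_true.
pose theta0 (i : J + nat) w : measurableTypeR R :=
  match i with inl j => t j w | inr k => theta (inr (s k (pi w))) (pi w) end.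
pose psi1 (i : J + nat) w : Psi :=
  match i with inl j => psi0 j | inr k => psi (inr (s k (pi w))) (pi w) end.
have mtheta0 i : measurable_fun setT (theta0 i).
  case: i => [j|k]; first exact: mt.
  apply: (measurableT_comp (f := fun w => theta (inr (s k w)) w)) => //.
  apply: (measurable_at_index (q := fun k => theta (inr k))) => // l.
  exact: crm_theta_measurable Hcrm _.
have mpsi1 i : measurable_fun setT (psi1 i).
  case: i => [j|k]; first exact: measurable_cst.
  apply: (measurableT_comp (f := fun w => psi (inr (s k w)) w)) => //.
  apply: (measurable_at_index (q := fun k => psi (inr k))) => // l.
  exact: crm_psi_measurable Hcrm _.
pose q k w := pt (s k w) w.
have mq k : measurable_fun setT (q k) by exact: (measurable_at_index (q := pt)).
pose q1 k w := (theta0 (inr k) w, psi1 (inr k) w).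
have q1E k w : q1 k w = q k (pi w) by [].
have mq1 k : measurable_fun setT (q1 k).
  exact: measurable_fun_pair.
have inf1 := ae_pullback mpi Ppi infinitely_many_zero_marks.
apply: (crm_law_exists singletons (P := P1) (theta := theta0) (psi := psi1)).
split => //.
- move=> [j|k] /=.
    have mneg := @measurable_negative R.
    exists (t j @^-1` [set t : R | (t < 0)%R]); split.
    + exact: measurable_preimage.
    + by rewrite tlaw ?F0_neg.
    + by move=> w /= /negP; rewrite -ltNge.
  have := ae_pullback mpi Ppi (ae_countable (crm_theta_ge0 Hcrm)).
  by apply: filterS => w; exact.
- apply: poisson_of_laplace => // f mf f0.
  rewrite -(mark_part_laplace 0%N mf f0).
  pose S w : \bar R := \sum_(0 <= k <oo) (if x (inr k) w == 0%N then f (pt k w) else 0).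
  have mS : measurable_fun setT S.
    apply: (@ge0_emeasurable_sum _ _ _ _ (fun k w => if x (inr k) w == 0%N then f (pt k w) else 0) xpredT).
      by move=> k w _ _; case: ifP.
    move=> k _; apply: measurable_fun_ifT => //.
      by apply: (measurable_fun_bool true); rewrite setTI; exact: mb.
    exact: (measurableT_comp mf (mpt k)).
  rewrite -(integral_law (f := fun w => (eN (S w))%:E) mpi Ppi); last 2 first.
  + by apply/measurable_EFinP; exact: (measurableT_comp measurable_eN mS).
  + by move=> w; rewrite lee_fin eN_ge0.
  apply: ge0_ae_eq_integral => //.
  + by apply/measurable_EFinP; apply: (measurableT_comp measurable_eN); exact: measurable_psum.
  + apply/measurable_EFinP; apply: (measurableT_comp measurable_eN).
    exact: (measurableT_comp mS mpi).
  + by move=> w _; rewrite lee_fin eN_ge0.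
  + by move=> w _; rewrite lee_fin eN_ge0.
  + move: inf1; apply: filterS => w infw _; congr (eN _)%:E.
    rewrite /psum /S -(sum_nth_true (f := fun k => f (pt k (pi w))) infw)//.
- move=> E FE.
  have [E0 [mE0 E0E]] : exists E0, measurable E0 /\ E None = pi @^-1` E0.
    have := FE None; rewrite /=; move: (E None).
    apply: smallest_sub.
      split.
      + by exists set0; rewrite preimage_set0.
      + move=> A [A0 [mA0 ->]]; exists (~` A0); split; first exact: measurableC.
        by rewrite setTD preimage_setC.
      + move=> A HA; have /choice[A0 HA0] := HA.
        exists (\bigcup_k A0 k); split.
          by apply: bigcup_measurable => k _; case: (HA0 k).
        by rewrite preimage_bigcup; apply: eq_bigcup => // k _; case: (HA0 k).
    move=> A [S [mS [B mB <-]]].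
    exists (point_count R q S @^-1` B); split; last by rewrite setTI.
    apply: measurable_preimage => //.
    exact: (measurable_point_count (R := R) mq mS).
  have /choice[B HB] : forall j, exists B, measurable B /\ E (Some j) = t j @^-1` B.
    by move=> j; have [B mB <-] := FE (Some j); exists B; rewrite setTI.
  rewrite (_ : \bigcap_(i in [set: option J]) E i = pi @^-1` E0 `&` [set w | forall j, B j (t j w)]).
    rewrite ext//; last by move=> j; case: (HB j).
    rewrite prod_option EFinM E0E Ppi// fineK ?fin_num_measure//; congr (_ * _).
    rewrite -prodEFin; apply: eq_bigr => j _.
    have [mB ->] := HB j.
    by rewrite tlaw// fineK// fin_num_measure.
  apply/seteqP; split => w.
    move=> H; split; first by rewrite -E0E; exact: H.
    by move=> j; have [_ EB] := HB j; have := H (Some j) Logic.I; rewrite EB.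
  move=> [E0w Bw] [j|] _; last by rewrite E0E.
  by have [_ ->] := HB j; exact: Bw.
- have inj1 := ae_pullback mpi Ppi (crm_distinct Hcrm).
  have off1 := ae_pullback mpi Ppi (ae_countable (fun j => ordinary_location_ae (psi0 j))).
  move: inf1 inj1 off1; apply: filterS3 => w infw injw offw [j|k] [j'|k'] /=.
  + by move/psi0_inj => ->.
  + by move=> H; exfalso; apply: (offw j (s k' (pi w))).
  + by move=> H; exfalso; apply: (offw j' (s k (pi w))).
  + by move/injw => [] /(nth_true_inj infw) ->.
Qed.

(** The normalizing constants of the posteriors. *)
Let Znew n := \int[nu]_t (h n t)%:E.
Let Zfix k n := \int[F k]_t (h n t)%:E.

Let mhE n : measurable_fun (setT : set (measurableTypeR R)) (fun t => (h n t)%:E).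
Proof. by apply/measurable_EFinP; exact: mh. Qed.

Let Znew0 n : 0 <= Znew n.
Proof. by apply: integral_ge0 => t _; rewrite lee_fin. Qed.

Lemma Znew_fin n : (0 < n)%N -> Znew n < +oo.
Proof.
move=> n0; apply: le_lt_trans h_summable.
apply: (@le_trans _ _ (\sum_(1 <= i < n.+1) Znew i)).
  by rewrite big_nat_recr//= leeDr// sume_ge0.
by apply: nneseries_lim_ge => k _ _; exact: Znew0.
Qed.

Lemma Zfix_fin k n : Zfix k n < +oo.
Proof.
have h01 t : (0 <= h n t <= 1)%R by rewrite h0 (pmf_le1 h0 h1).
have /andP[_ b] := expectation_le1 (F k) (mh n) h01.
by rewrite (le_lt_trans b)// ltry.
Qed.

(** The weights are integrated first: for them Bayes' rule holds at each
    location. *)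
Lemma integral_mark_mean n (u : measurableTypeR R * Psi -> R) :
  measurable_fun setT u -> (forall p, 0 <= u p)%R ->
  \int[nu \x G]_p (h n p.1 * u p)%:E = \int[G]_q \int[nu]_t (h n t * u (t, q))%:E.
Proof.
move=> mu u0; rewrite fubini_tonelli2//.
- apply/measurable_EFinP; apply: measurable_funM => //.
  exact: (measurableT_comp (mh n) measurable_fst).
- by move=> p; rewrite lee_fin mulr_ge0.
Qed.

Lemma integral_mark_cst n (c : R) : (0 <= c)%R ->
  \int[nu \x G]_p (h n p.1 * c)%:E = c%:E * Znew n.
Proof.
move=> c0; rewrite (integral_mark_mean n (u := cst c))//.
transitivity (\int[G]_q (cst (c%:E * Znew n) q)).
  apply: eq_integral => q _; under eq_integral do rewrite mulrC EFinM.
  by rewrite ge0_integralZl_EFin// => t _; rewrite lee_fin.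
etransitivity; first exact: integral_cst.
by rewrite -[RHS]mule1; congr (_ * _); exact: probability_setT.
Qed.

Lemma integral_onem_mixture (u : nat -> measurableTypeR R * Psi -> R) :
  (forall n, measurable_fun setT (u n)) -> (forall n p, 0 <= u n p <= 1)%R ->
  \int[nu \x G]_p (1 - mixture h p.1 (u ^~ p))%:E =
  \sum_(0 <= n <oo) \int[nu \x G]_p (h n p.1 * (1 - u n p))%:E.
Proof.
move=> mu u01; rewrite -integral_nneseries//.
- by apply: eq_integral => p _; rewrite onem_mixture.
- move=> n; apply/measurable_EFinP; apply: measurable_funM.
    exact: (measurableT_comp (mh n) measurable_fst).
  exact: measurable_funB.
- by move=> n p _; have /andP[? ?] := u01 n p; rewrite lee_fin mulr_ge0// subr_ge0.
Qed.

(** Fixed factors equal to [1] drop out of the marked Laplace functional. *)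
Lemma ordinary_marked_laplace (g : nat -> \bar R) : (forall n, 0 <= g n) ->
  \int[P]_w (eN (\sum_(0 <= j <oo) g (x (inr j) w)))%:E =
  (eN (\sum_(0 <= n <oo) (1 - eN (g n))%R%:E * Znew n))%:E.
Proof.
move=> g0.
have := marked_laplace Hcrm mh h0 h1 Hx (phi := fun _ _ _ => 1%R) (g := fun _ n => g n) _ _ _ (fun _ => g0).
under eq_integral do rewrite big1// mul1r.
move=> -> //; last by move=> k t m; rewrite ler01 lexx.
rewrite big1 ?mul1r; last first.
  move=> k _; under eq_integral do rewrite mixture_cst1//.
  by rewrite integral_cst1.
congr (eN _)%:E; rewrite (integral_onem_mixture (u := fun n _ => eN (g n)))//; last first.
  by move=> n p; rewrite eN_ge0 eN_le1.
apply: eq_eseriesr => n _; rewrite integral_mark_cst// subr_ge0 eN_le1//.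
Qed.

(** With an infinite value on the mark [n] the Laplace functional becomes the
    probability that no ordinary point has the mark [n], which is [e^-0]. *)
Lemma ordinary_mark_ae : {ae P, forall w, forall k, 0 < Znew (x (inr k) w)}.
Proof.
suff H n : {ae P, forall w, ~ (0 < Znew n) -> forall k, x (inr k) w <> n}.
  have := ae_countable H; apply: filterS => w Hw k; apply: contrapT => nZ.
  exact: (Hw _ nZ k).
have [Zn|nZ] := pselect (0 < Znew n); first by apply: aeW => w; case.
have Zn0 : Znew n = 0 by apply/eqP; move/negP: nZ; rewrite lt_neqAle Znew0 andbT eq_sym negbK.
pose g m : \bar R := if m == n then +oo else 0.
have g0 m : 0 <= g m by rewrite /g; case: eqP.
pose N w := \sum_(0 <= j <oo) g (x (inr j) w).
have N0 w : 0 <= N w by exact: nneseries_ge0.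
have mN : measurable_fun setT N.
  apply: (@ge0_emeasurable_sum _ _ _ _ (fun j w => g (x (inr j) w)) xpredT) => //.
  by move=> j _; exact: (measurableT_comp (f := g)).
have meN : measurable_fun setT (fun w => eN (N w)) by exact: (measurableT_comp measurable_eN mN).
have EN1 : \int[P]_w (eN (N w))%:E = 1.
  rewrite ordinary_marked_laplace// eseries0 ?eN0// => m _ _.
  by rewrite /g; have [->|mn] := eqVneq m n; [rewrite Zn0 mule0|rewrite eN0 subrr mul0e].
have E0 : \int[P]_w (1 - eN (N w))%:E = 0.
  have := expectationB P (f := cst 1%R) (g := fun w => eN (N w)).
  rewrite EN1 integral_cst1 subee// => -> //.
  - by move=> w; rewrite ler01 lexx.
  - by move=> w; rewrite eN_ge0 eN_le1.
have abs0 : \int[P]_w `|(1 - eN (N w))%:E| = 0.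
  rewrite -E0; apply: eq_integral => w _.
  by rewrite gee0_abs// lee_fin subr_ge0 eN_le1.
have m1N : measurable_fun setT (fun w => (1 - eN (N w))%:E).
  by apply/measurable_EFinP; exact: measurable_funB.
move/(ae_eq_integral_abs P measurableT m1N): abs0.
apply: filterS => w /(_ Logic.I) /= [] /eqP; rewrite subr_eq0 => /eqP Nw _ k xk.
suff NE : N w = +oo by move: Nw; rewrite NE => /eqP; rewrite oner_eq0.
apply/eqP; rewrite -leye_eq /N (nneseriesD1 (n := k))// xk /g eqxx.
by rewrite leeDl// nneseries_ge0// => j _ _; case: eqP.
Qed.

Lemma fixed_mark_ae : {ae P, forall w, forall k, 0 < Zfix k (x (inl k) w)}.
Proof.
apply: ae_countable => k.
suff H n : {ae P, forall w, ~ (0 < Zfix k n) -> x (inl k) w <> n}.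
  have := ae_countable H; apply: filterS => w Hw; apply: contrapT => nZ.
  exact: (Hw _ nZ).
have [Zn|nZ] := pselect (0 < Zfix k n); first by apply: aeW => w; case.
have Zn0 : Zfix k n = 0.
  apply/eqP; move/negP: nZ; rewrite lt_neqAle integral_ge0 ?andbT 1?eq_sym ?negbK//.
  by move=> t _; rewrite lee_fin.
exists (x (inl k) @^-1` [set n]); split.
- exact: measurable_preimage.
- have sT : sigma_family setT (fun i w => (theta i w, psi i w)) setT.
    rewrite /sigma_family; set GG := [set E | _].
    by have [s0 sC _] := smallest_sigma_algebra setT GG; have := sC _ s0; rewrite setD0.
  have := proj2 Hx [:: inl k] (fun=> n) setT isT sT.
  rewrite setTI (_ : [set w | _] = x (inl k) @^-1` [set n]); last first.
    apply/seteqP; split => w /=; first by move=> /(_ (inl k)); rewrite mem_seq1 eqxx; exact.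
    by move=> xn i; rewrite mem_seq1 => /eqP ->.
  move=> ->; under eq_integral do rewrite big_seq1.
  rewrite -[RHS]Zn0.
  exact: (expectation_law (crm_theta_measurable Hcrm (inl k)) (crm_theta_fix Hcrm k) (mh n) (h0 n)).
- by move=> w /=; apply: contra_notP => xn _.
Qed.

(** The number of ordinary points with a nonzero mark is Poisson with finite mean
    [L]. Its Laplace transform at [c] tends to the probability that it is finite
    as [c] tends to zero, and equals [e^(-(1 - e^-c) L)], which tends to one. *)
Lemma finitely_many_marks_ae : {ae P, forall w, finite_set [set k | x (inr k) w != 0%N]}.
Proof.
pose c m : R := harmonic m.
pose g m n : \bar R := if n == 0%N then 0 else (c m)%:E.
have c0 m : (0 <= c m)%R by rewrite harmonic_ge0.
have g0 m n : 0 <= g m n by rewrite /g; case: eqP; rewrite ?lee_fin.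
pose N w : \bar R := \sum_(0 <= j <oo) (if x (inr j) w == 0%N then 0 else 1).
have N0 w : 0 <= N w by apply: nneseries_ge0 => j _ _; case: eqP.
have mN : measurable_fun setT N.
  apply: (@ge0_emeasurable_sum _ _ _ _ (fun j w => if x (inr j) w == 0%N then 0 else 1) xpredT) => //.
    by move=> j w _ _; case: eqP.
  by move=> j _; apply: (measurableT_comp (f := fun n => if n == 0%N then 0 else 1 : \bar R)).
pose L := \sum_(1 <= n <oo) Znew n.
have L0 : 0 <= L by apply: nneseries_ge0.
have Lfin : L \is a fin_num by rewrite ge0_fin_numE.
have lap m : \int[P]_w (eN ((c m)%:E * N w))%:E = (eN (((1 - expR (- c m)) * fine L)%:E))%:E.
  transitivity (\int[P]_w (eN (\sum_(0 <= j <oo) g m (x (inr j) w)))%:E).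
    apply: eq_integral => w _; rewrite /N -nneseriesZl; last by move=> j _; case: eqP.
    by congr (eN _)%:E; apply: eq_eseriesr => j _; rewrite /g; case: eqP; rewrite ?mule0 ?mule1.
  rewrite ordinary_marked_laplace//; congr (eN _)%:E.
  rewrite nneseries_recl//; last first.
    by move=> n _; rewrite mule_ge0// lee_fin subr_ge0 eN_le1.
  rewrite {1}/g eqxx eN0 subrr mul0e add0e EFinM fineK// /L -nneseriesZl//.
  congr (limn _); apply/funext => K; apply: eq_big_nat => n /andP[n1 _].
  by rewrite /g; case: eqP n1 => [->|].
pose S := [set w | N w < +oo].
have mS : measurable S.
  by rewrite /S -[X in measurable X]setTI; exact: emeasurable_fun_infty_o.
have l1 : \int[P]_w (eN ((c m)%:E * N w))%:E @[m --> \oo] --> \int[P]_w (\1_S w)%:E.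
  apply: cvg_integral01.
  - by move=> m; apply: (measurableT_comp measurable_eN); exact: measurable_funeM.
  - by move=> m w; rewrite eN_ge0 eN_le1// mule_ge0// lee_fin.
  - move=> w; rewrite indicE; have [Nw|Nw] := boolP (N w < +oo).
      rewrite mem_set//; have := N0 w; case: (N w) Nw => [r _ _|//|//].
      rewrite [X in _ --> X](_ : _ = expR (- (0 * r)))%R; last by rewrite mul0r oppr0 expR0.
      apply: (@cvg_comp _ _ _ _ (fun t => expR (- (t * r))%R) _ (nbhs 0%R)).
        exact: cvg_harmonic.
      apply: continuous_cvg; first exact: continuous_expR.
      by apply: cvgN; apply: cvgMl; exact: cvg_id.
    rewrite memNset; last exact/negP.
    have -> : N w = +oo by apply/eqP; rewrite -leye_eq leNgt.
    rewrite (_ : (fun m => _) = fun=> 0%R); first exact: cvg_cst.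
    by apply/funext => m; rewrite mulry gtr0_sg ?mul1e// harmonic_gt0.
have l2 : (eN (((1 - expR (- c m)) * fine L)%:E))%:E @[m --> \oo] --> (1 : \bar R).
  apply: cvg_EFin; first exact: nearW.
  rewrite [X in _ --> X](_ : _ = expR (- ((1 - expR (- 0)) * fine L)))%R; last first.
    by rewrite oppr0 expR0 subrr mul0r oppr0 expR0.
  apply: (@cvg_comp _ _ _ _ (fun t => expR (- ((1 - expR (- t)) * fine L)))%R _ (nbhs 0%R)).
    exact: cvg_harmonic.
  apply: continuous_cvg; first exact: continuous_expR.
  apply: cvgN; apply: cvgMl; apply: cvgB; first exact: cvg_cst.
  apply: continuous_cvg; first exact: continuous_expR.
  by apply: cvgN; exact: cvg_id.
have PS : P S = 1.
  rewrite (funext lap) in l1; have := cvg_unique _ l1 l2.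
  by rewrite integral_indic// setIT => ->.
exists (~` S); split; first exact: measurableC.
  by rewrite probability_setC// PS subee.
move=> w /=; apply: contra_not => Nw; apply: contrapT => inf.
move: Nw; rewrite /S /= /N nneseries_esumT; last by move=> j; case: eqP.
rewrite (_ : \esum_(k in _) _ = \esum_(k in [set k | x (inr k) w != 0%N]) 1).
  by rewrite -counting_esum /counting asboolF.
rewrite [RHS]esum_mkcond; apply: eq_esum => k _.
case: eqP => xk; first by rewrite memNset//= xk eqxx.
by rewrite mem_set//; apply/eqP.
Qed.

Hypothesis F_nneg : forall k, F k [set t : R | (t < 0)%R] = 0.
Hypothesis nu_nneg : nu [set t : R | (t < 0)%R] = 0.

(** * The posterior kernel *)

Let off_fixed : set Psi := ~` range psi_fix.

Let measurable_off_fixed : measurable off_fixed.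
Proof.
apply: measurableC; apply: countable_measurable => //.
by apply: finite_set_countable; apply: finite_image; exact: finite_finset.
Qed.

(** The atoms of an observation that come from ordinary points. *)
Let new_atoms (m : measure_space Psi R) := [set q | atom m q /\ off_fixed q].

(** The observations for which all the posteriors exist. Almost all observations
    are such, because marks with zero normalizing constant do not occur and only
    finitely many marks are nonzero. *)
Definition regular_observation : set (measure_space Psi R) :=
  [set m | (forall k, exists n : nat, ev m [set psi_fix k] = n%:R%:E /\ 0 < Zfix k n) /\
    finite_set (new_atoms m) /\
    forall q, new_atoms m q -> exists n : nat, ev m [set q] = n%:R%:E /\ 0 < Znew n].

Lemma measurable_regular_observation : measurable regular_observation.
Proof.
pose B : set (\bar R) := \bigcup_(n in [set n | 0 < Znew n]) [set n%:R%:E].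
have mB : measurable B by apply: bigcup_measurable => n _; exact: emeasurable_set1.
have mcount (C : set (\bar R)) : measurable C ->
    measurable_fun setT (fun m : measure_space Psi R => atom_count m off_fixed C).
  move=> mC; exact: (measurable_functional (inr (exist (fun AB => measurable AB.1 /\ measurable AB.2)
      (off_fixed, C) (conj measurable_off_fixed mC)))).
rewrite (_ : regular_observation =
  (\bigcap_(k in [set: I]) \bigcup_(n in [set n | 0 < Zfix k n])
    [set m : measure_space Psi R | [set n%:R%:E] (ev m [set psi_fix k])]) `&`
  [set m : measure_space Psi R | atom_count m off_fixed setT < +oo] `&`
  (fun m : measure_space Psi R => atom_count m off_fixed (~` B)) @^-1` [set 0]).
  apply: measurableI; last first.
    by rewrite -[X in measurable X]setTI; apply: mcount => //; exact: measurableC.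
  apply: measurableI; last first.
    rewrite -[X in measurable X]setTI; apply: emeasurable_fun_infty_o => //.
    exact: mcount.
  apply: fin_bigcap_measurable; first exact: finite_finset.
  move=> k _; apply: bigcup_measurable => n _; apply: measurable_mass => //.
have atomsE m : [set p | [/\ off_fixed p, atom m p & [set: \bar R] (ev m [set p])]] = new_atoms m.
  by apply/seteqP; split => [q []//|q [? ?]].
apply/seteqP; split => m.
  move=> [Hf [Hn Hb]]; split; first split.
  - by move=> k _; have [n [mn Zn]] := Hf k; exists n.
  - by rewrite /= /atom_count atomsE /counting asboolT// ltry.
  - apply/counting_eq0/seteqP; split => // q [oq aq nB]; apply: nB.
    by have [n [mn Zn]] := Hb q (conj aq oq); exists n.
move=> [[Hf Hn] /counting_eq0 Hb]; split; last split.
- by move=> k; have [n Zn mn] := Hf k Logic.I; exists n.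
- move: Hn; rewrite /= /atom_count atomsE /counting; case: asboolP => //.
- move=> q [aq oq]; have [[n Zn mn]|nB] := pselect (B (ev m [set q])); first by exists n.
  by suff : (set0 : set Psi) q by []; rewrite -Hb.
Qed.

(** The asserted form of the conditional law, given the observation [m]. *)
Definition posterior_law (m : measure_space Psi R) (Q : set (measure_space Psi R) -> \bar R) :=
  exists (x_fix : I -> nat) (Knew : nat) (psi_new : 'I_Knew -> Psi) (x_new : 'I_Knew -> nat)
    (F_post_fix : I -> probability (measurableTypeR R) R)
    (F_post_new : 'I_Knew -> probability (measurableTypeR R) R),
  [/\ forall k, ev m [set psi_fix k] = (x_fix k)%:R%:E,
      [/\ injective psi_new, range psi_new = new_atoms m &
          forall k, ev m [set psi_new k] = (x_new k)%:R%:E],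
      (forall k, is_posterior (F k) (h (x_fix k)) (F_post_fix k)) /\
      (forall k, is_posterior nu (h (x_new k)) (F_post_new k)) &
      crm_law Q (join_families psi_fix psi_new) (join_families F_post_fix F_post_new)
        (nu_part 0%N \x G)].

(** An atom has a positive mass, and positive marks have finite rates. *)
Let new_atom_fin (m : measure_space Psi R) q (n : nat) : new_atoms m q -> ev m [set q] = n%:R%:E ->
  Znew n < +oo.
Proof.
move=> [aq _] mq; apply: Znew_fin.
by move: aq; rewrite /atom mq lte_fin ltr0n.
Qed.

Lemma posterior_law_exists m : regular_observation m ->
  exists Q : probability (measure_space Psi R) R, posterior_law m Q.
Proof.
move=> [Hf [Hn Hb]].
pose s := finmap.enum_fset (fset_set (new_atoms m)).
have sP q : (q \in s) = (q \in new_atoms m) by rewrite -in_fset_set.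
pose psi_new (i : 'I_(size s)) := tnth (in_tuple s) i.
have new_in i : new_atoms m (psi_new i) by apply/set_mem; rewrite -sP mem_tnth.
have psi_new_inj : injective psi_new by apply/tuple_uniqP; exact: finmap.fset_uniq.
have psi_new_range : range psi_new = new_atoms m.
  apply/seteqP; split => [_ [i _ <-]//|q nq].
  have /tnthP[i qi] : q \in in_tuple s by rewrite sP; exact/mem_set.
  by exists i.
have /choice[x_fix Hx_fix] := Hf.
have /choice[x_new Hx_new] : forall i, exists n : nat, ev m [set psi_new i] = n%:R%:E /\ 0 < Znew n.
  by move=> i; exact: Hb.
have /choice[F_post_fix Hfix] : forall k, exists Q : probability (measurableTypeR R) R,
    is_posterior (F k) (h (x_fix k)) Q.
  move=> k; apply: posterior_exists => //; have [_ Zk] := Hx_fix k.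
  by rewrite Zk; exact: Zfix_fin.
have /choice[F_post_new Hnew] : forall i, exists Q : probability (measurableTypeR R) R,
    is_posterior nu (h (x_new i)) Q.
  move=> i; apply: posterior_exists => //; have [mi Zi] := Hx_new i.
  by rewrite Zi; exact: new_atom_fin mi.
have [Q HQ] : exists Q : probability (measure_space Psi R) R, crm_law Q
    (join_families psi_fix psi_new) (join_families F_post_fix F_post_new) (nu_part 0%N \x G).
  apply: thinned_crm_law.
  - have off i k : psi_new i <> psi_fix k by move=> ik; case: (new_in i) => _; apply; exists k.
    move=> [k|i] [k'|i'] //=.
    + by move/(crm_psi_fix_inj Hcrm) => ->.
    + by move/esym => /off.
    + by move/off.
    + by move/psi_new_inj => ->.
  - move=> [k|i] /=; first exact: (is_posterior_nneg (mh _) (F_nneg k) (Hfix k)).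
    exact: (is_posterior_nneg (mh _) nu_nneg (Hnew i)).
exists Q, x_fix, (size s), psi_new, x_new, F_post_fix, F_post_new; split => //.
- by move=> k; case: (Hx_fix k).
- by split => // i; case: (Hx_new i).
Qed.

(** Off the regular observations any value does. *)
Definition posterior_kernel (m : measure_space Psi R) : probability (measure_space Psi R) R :=
  match pselect (regular_observation m) with
  | left reg => projT1 (cid (posterior_law_exists reg))
  | right _ => dirac ((mzero : {measure set Psi -> \bar R}) : measure_space Psi R)
  end.

Lemma posterior_kernelP m : regular_observation m -> posterior_law m (posterior_kernel m).
Proof.
rewrite /posterior_kernel; case: pselect => // reg _.
exact: (projT2 (cid (posterior_law_exists reg))).
Qed.

Section marked_path.
Context (w : Omega) (m : measure_space Psi R).
Hypothesis psi_inj : injective (psi ^~ w).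
Hypothesis m_sum : atomic_sum (fun i => (x i w)%:R%R) (psi ^~ w) m.

Let x_ge0 i : (0 <= ((x i w)%:R : R))%R. Proof. exact: ler0n. Qed.

Lemma mass_mark i : ev m [set psi i w] = (x i w)%:R%:E.
Proof. exact: (mass_at singletons x_ge0 psi_inj m_sum). Qed.

Lemma new_atoms_marks : new_atoms m = (fun j => psi (inr j) w) @` [set j | x (inr j) w != 0%N].
Proof.
apply/seteqP; split => [q [aq oq]|_ [j /= xj <-]].
  have [[i _ iq]|nq] := pselect (range (psi ^~ w) q); last first.
    by move: aq; rewrite /atom (mass_off singletons m_sum nq) ltxx.
  case: i iq => [k|j] iq; first by case: oq; exists k => //; rewrite -iq (crm_psi_fix Hcrm).
  exists j => //=; move: aq; rewrite /atom -iq mass_mark lte_fin ltr0n.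
  by case: (x _ w).
split; first by rewrite /atom mass_mark lte_fin ltr0n lt0n.
move=> [k _]; rewrite -(crm_psi_fix Hcrm k w) => /psi_inj //.
Qed.

Lemma regular_of_marks : (forall k, 0 < Zfix k (x (inl k) w)) ->
  (forall j, 0 < Znew (x (inr j) w)) -> finite_set [set j | x (inr j) w != 0%N] ->
  regular_observation m.
Proof.
move=> Hfix Hnew fin; split; last split.
- by move=> k; exists (x (inl k) w); rewrite -(crm_psi_fix Hcrm k w) mass_mark.
- by rewrite new_atoms_marks; exact: finite_image.
- by rewrite new_atoms_marks => _ [j _ <-]; exists (x (inr j) w); rewrite mass_mark.
Qed.

End marked_path.

(** * Bayes' rule for Laplace functionals *)

Section laplace_of_posterior.
Context (s : seq (@functional_index R dPsi Psi)).

Let e2 (q : Psi) (t : R) : R := eN (total_contribution s (t : measurableTypeR R, q)).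

Let e201 q t : (0 <= e2 q t <= 1)%R.
Proof. by rewrite eN_ge0 eN_le1// total_contribution_ge0. Qed.

Let measurable_e2 : measurable_fun setT (fun p : measurableTypeR R * Psi => e2 p.2 p.1).
Proof.
rewrite (_ : (fun p => _) = fun p : measurableTypeR R * Psi => eN (total_contribution s p)).
  exact: (measurableT_comp measurable_eN (measurable_total_contribution s)).
by apply/funext => -[].
Qed.

Let measurable_e2_at q : measurable_fun (setT : set (measurableTypeR R)) (e2 q).
Proof. exact: (measurableT_comp measurable_e2 (measurable_pair2 q)). Qed.

(** The factors that an atom with mark [n] and the unseen atoms contribute to the
    Laplace functional of the posterior. The value of [new_factor] at [0] lets
    products over the new atoms be taken over all ordinary points. *)
Let fix_factor k n := posterior_mean (F k) (h n) (e2 (psi_fix k)).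
Let new_factor n q := if n == 0%N then 1%R else posterior_mean nu (h n) (e2 q).
Let ordinary_factor := eN (\int[nu_part 0%N \x G]_p (1 - eN (total_contribution s p))%R%:E).

Let new_factor01 n q : (0 <= new_factor n q <= 1)%R.
Proof.
rewrite /new_factor; case: eqP => [_|/eqP n0]; first by rewrite ler01 lexx.
apply: (posterior_mean01 (mh n) (h0 n) (measurable_e2_at q) (e201 q)).
by apply: Znew_fin; rewrite lt0n.
Qed.

Let fix_factor01 k n : (0 <= fix_factor k n <= 1)%R.
Proof.
exact: (posterior_mean01 (mh n) (h0 n) (measurable_e2_at _) (e201 _) (Zfix_fin k n)).
Qed.

Let measurable_new_factor n : measurable_fun setT (new_factor n).
Proof.
rewrite /new_factor; case: eqP => _; first exact: measurable_cst.
apply: measurable_funM => //; apply: (measurableT_comp (fine_measurable _)) => //.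
apply: (@measurable_fun_fubini_tonelli_G _ _ _ _ _ nu
  (fun p : measurableTypeR R * Psi => (h n p.1 * e2 p.2 p.1)%:E)).
- apply/measurable_EFinP; apply: measurable_funM => //.
  exact: (measurableT_comp (mh n) measurable_fst).
- by move=> p; rewrite lee_fin mulr_ge0//; case/andP: (e201 p.2 p.1).
Qed.

(** The value depends on [m] only, not on the enumeration of the new atoms nor on
    the choice of the posteriors, and is measurable in [m]. *)
Lemma posterior_law_laplace m (Q : probability (measure_space Psi R) R) :
  regular_observation m -> posterior_law m Q ->
  \int[Q]_y (eN (\sum_(j <- s) functional j y))%:E =
  ((\prod_k fix_factor k (mark m (psi_fix k))) *
    eN (\esum_(q in new_atoms m) lN (new_factor (mark m q) q)) * ordinary_factor)%:E.
Proof.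
move=> [_ [fin_new _]] [] x_fix [] Knew [] psi_new [] x_new [] F_post_fix [] F_post_new
  [m_fix [psi_new_inj psi_new_range m_new] [post_fix post_new] HQ].
rewrite (crm_law_laplace s singletons HQ) /crm_transform big_sumType /= -!mulrA.
congr (_ * (_ * _))%:E.
- apply: eq_bigr => k _; rewrite (markE (m_fix k)).
  rewrite -[RHS]/(fine (fix_factor k (x_fix k))%:E); congr fine.
  exact: (is_posterior_mean (mh _) (h0 _) (measurable_e2_at _) (e201 _) (post_fix k)).
- rewrite -psi_new_range esum_image; last by move=> i j _ _; exact: psi_new_inj.
  have lN0 q n : 0 <= lN (new_factor n q) by rewrite lN_ge0//; case/andP: (new_factor01 n q).
  rewrite esum_finType//.
  rewrite eN_sum//; apply: eq_bigr => i _; rewrite (markE (m_new i)).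
  rewrite lNK; last by case/andP: (new_factor01 (x_new i) (psi_new i)).
  have new_i : new_atoms m (psi_new i) by rewrite -psi_new_range; exists i.
  rewrite /new_factor; case: eqP => [xi0|_].
    by case: new_i; rewrite /atom m_new xi0 ltxx.
  rewrite -[RHS]/(fine (posterior_mean nu (h (x_new i)) (e2 (psi_new i)))%:E); congr fine.
  exact: (is_posterior_mean (mh _) (h0 _) (measurable_e2_at _) (e201 _) (post_new i)).
Qed.

Lemma measurable_posterior_laplace :
  measurable_fun setT (fun m => \int[posterior_kernel m]_y (eN (\sum_(j <- s) functional j y))%:E).
Proof.
have lN0 n q : 0 <= lN (new_factor n q) by rewrite lN_ge0//; case/andP: (new_factor01 n q).
rewrite [X in measurable_fun _ X](_ : _ = fun m => if m \in regular_observation then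
    ((\prod_k fix_factor k (mark m (psi_fix k))) *
    eN (if m \in regular_observation then
      \esum_(q in new_atoms m) lN (new_factor (mark m q) q) else 0) * ordinary_factor)%:E
  else (eN (\sum_(j <- s) functional j ((mzero : {measure set Psi -> \bar R}) : measure_space Psi R)))%:E).
  apply: measurable_fun_ifT.
  - exact: measurable_mem measurable_regular_observation.
  - apply/measurable_EFinP; apply: measurable_funM => //; apply: measurable_funM.
      apply: measurable_fun_prod => k.
      apply: (measurable_at_index (q := fun n _ => fix_factor k n) (s := fun m => mark m (psi_fix k))) => // n.
      exact: measurable_mark.
    apply: (measurableT_comp measurable_eN).
    apply: (@measurable_atom_sum _ _ _ off_fixed measurable_off_fixed _ measurable_regular_observation
      _ _ (fun n q => lN (new_factor n q))) => //.
    + by move=> m [_ []].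
    + by move=> m q [_ [_ H]] /H [n [mn _]]; exists n.
    + by move=> n; exact: (measurableT_comp measurable_lN (measurable_new_factor n)).
  - exact: measurable_cst.
apply/funext => m; case: ifPn => [/set_mem reg|/negP nreg].
  by rewrite (mem_set reg); exact: (posterior_law_laplace reg (posterior_kernelP reg)).
rewrite /posterior_kernel; case: pselect => [reg|_]; first by exfalso; apply: nreg; exact/mem_set.
rewrite integral_dirac//; first by rewrite diracT mul1e.
apply/measurable_EFinP; apply: (measurableT_comp measurable_eN).
by apply: emeasurable_sum => j; exact: measurable_functional.
Qed.

Variable s1 : seq (@functional_index R dPsi Psi).

Let e1 n q : R := eN (total_contribution s1 (n%:R%R : measurableTypeR R, q)).

Let e101 n q : (0 <= e1 n q <= 1)%R.
Proof. by rewrite eN_ge0 eN_le1// total_contribution_ge0. Qed.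

Let measurable_contribution_at n : measurable_fun setT
  (fun q => total_contribution s1 (n%:R%R : measurableTypeR R, q)).
Proof. exact: (measurableT_comp (measurable_total_contribution s1) (measurable_pair1 _)). Qed.

Let lN_new0 n q : 0 <= lN (new_factor n q).
Proof. by rewrite lN_ge0//; case/andP: (new_factor01 n q). Qed.

Let eN_lN_new n q : eN (lN (new_factor n q)) = new_factor n q.
Proof. by rewrite lNK//; case/andP: (new_factor01 n q). Qed.

(** The factors of fixed locations, and the terms of ordinary points, in the
    joint Laplace functional of the observation and the prior, and in that of
    the observation and the posterior. *)
Let prior_phi k (t : measurableTypeR R) n : R := (e1 n (psi_fix k) * e2 (psi_fix k) t)%R.
Let post_phi k (_ : measurableTypeR R) n : R := (e1 n (psi_fix k) * fix_factor k n)%R.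
Let prior_g (p : measurableTypeR R * Psi) n : \bar R :=
  total_contribution s1 (n%:R%R : measurableTypeR R, p.2) + total_contribution s p.
Let post_g (p : measurableTypeR R * Psi) n : \bar R :=
  total_contribution s1 (n%:R%R : measurableTypeR R, p.2) + lN (new_factor n p.2).

Let prior_phi01 k t n : (0 <= prior_phi k t n <= 1)%R. Proof. exact: mul01. Qed.
Let post_phi01 k t n : (0 <= post_phi k t n <= 1)%R. Proof. exact: mul01. Qed.
Let prior_g0 p n : 0 <= prior_g p n.
Proof. by rewrite adde_ge0// total_contribution_ge0. Qed.
Let post_g0 p n : 0 <= post_g p n.
Proof. by rewrite adde_ge0// total_contribution_ge0. Qed.

Let measurable_prior_phi k n : measurable_fun setT ((prior_phi k) ^~ n).
Proof. by apply: measurable_funM. Qed.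

Let measurable_prior_g n : measurable_fun setT (prior_g ^~ n).
Proof.
apply: emeasurable_funD; last exact: measurable_total_contribution.
exact: (measurableT_comp (measurable_contribution_at n) measurable_snd).
Qed.

Let measurable_post_g n : measurable_fun setT (post_g ^~ n).
Proof.
apply: emeasurable_funD.
  exact: (measurableT_comp (measurable_contribution_at n) measurable_snd).
exact: (measurableT_comp (measurableT_comp measurable_lN (measurable_new_factor n)) measurable_snd).
Qed.

Let prior_gE p n : eN (prior_g p n) = (e1 n p.2 * e2 p.2 p.1)%R.
Proof. by rewrite eND ?total_contribution_ge0//; case: p. Qed.

Let post_gE p n : eN (post_g p n) = (e1 n p.2 * new_factor n p.2)%R.
Proof. by rewrite eND ?total_contribution_ge0// eN_lN_new. Qed.

(** Bayes' rule at a fixed location, averaged over the observation. *)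
Let fixed_bayes k : \int[F k]_t (mixture h t (prior_phi k t))%:E =
  \int[F k]_t (mixture h t (post_phi k t))%:E.
Proof.
have expand (v : measurableTypeR R -> nat -> R) : (forall n, measurable_fun setT (v ^~ n)) ->
    (forall t n, 0 <= v t n <= 1)%R ->
    \int[F k]_t (mixture h t (v t))%:E = \sum_(0 <= n <oo) \int[F k]_t (h n t * v t n)%:E.
  move=> mv v01; rewrite -integral_nneseries//.
  - by apply: eq_integral => t _; rewrite mixtureE.
  - by move=> n; apply/measurable_EFinP; apply: measurable_funM; [exact: mh|exact: mv].
  - by move=> n t _; rewrite lee_fin mulr_ge0//; case/andP: (v01 t n).
rewrite !expand//; apply: eq_eseriesr => n _.
apply: (posterior_meanC (mh n) (h0 n) (measurable_e2_at _) (e201 _) _ (Zfix_fin k n)).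
by case/andP: (e101 n (psi_fix k)).
Qed.

(** The mark [0] yields the rate of the unseen points; for each nonzero mark,
    Bayes' rule holds at each location. *)
Let ordinary_bayes :
  \int[nu \x G]_p (1 - mixture h p.1 (fun n => eN (prior_g p n)))%R%:E =
  \int[nu_part 0%N \x G]_p (1 - eN (total_contribution s p))%R%:E +
  \int[nu \x G]_p (1 - mixture h p.1 (fun n => eN (post_g p n)))%R%:E.
Proof.
have term0 (u : nat -> measurableTypeR R * Psi -> R) n : (forall p, 0 <= u n p <= 1)%R ->
    0 <= \int[nu \x G]_p (h n p.1 * (1 - u n p))%:E.
  move=> u01; apply: integral_ge0 => p _; have /andP[? ?] := u01 p.
  by rewrite lee_fin mulr_ge0// subr_ge0.
rewrite (integral_onem_mixture (u := fun n p => eN (prior_g p n))); last 2 first.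
- by move=> n; exact: (measurableT_comp measurable_eN (measurable_prior_g n)).
- by move=> n p; rewrite eN_ge0 eN_le1.
rewrite (integral_onem_mixture (u := fun n p => eN (post_g p n))); last 2 first.
- by move=> n; exact: (measurableT_comp measurable_eN (measurable_post_g n)).
- by move=> n p; rewrite eN_ge0 eN_le1.
rewrite [LHS]nneseries_recl; last 2 first.
- by move=> n _; apply: (term0 (fun n p => eN (prior_g p n))) => p; rewrite eN_ge0 eN_le1.
- by [].
rewrite [X in _ = _ + X]nneseries_recl; last 2 first.
- by move=> n _; apply: (term0 (fun n p => eN (post_g p n))) => p; rewrite eN_ge0 eN_le1.
- by [].
have e10 q : e1 0%N q = 1%R by rewrite /e1 total_contribution_null ?eN0.
congr (_ + _).
  rewrite integral_nu_part//.
  - by apply: eq_integral => p _; rewrite prior_gE e10 mul1r; case: p.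
  - apply/measurable_EFinP; apply: measurable_funB => //; exact: (measurableT_comp measurable_eN (measurable_total_contribution s)).
  - by move=> p; rewrite lee_fin subr_ge0 eN_le1// total_contribution_ge0.
rewrite [X in X + _](_ : _ = 0) ?add0e; last first.
  rewrite integral0_eq// => p _.
  by rewrite post_gE e10 mul1r /new_factor eqxx subrr mulr0.
congr (limn _); apply/funext => K; apply: eq_big_nat => n /andP[n1 _].
rewrite (integral_mark_mean n (u := fun p => (1 - eN (prior_g p n))%R)); last 2 first.
- by apply: measurable_funB => //; exact: (measurableT_comp measurable_eN (measurable_prior_g n)).
- by move=> p; rewrite subr_ge0 eN_le1.
rewrite (integral_mark_mean n (u := fun p => (1 - eN (post_g p n))%R)); last 2 first.
- by apply: measurable_funB => //; exact: (measurableT_comp measurable_eN (measurable_post_g n)).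
- by move=> p; rewrite subr_ge0 eN_le1.
apply: eq_integral => q _.
under eq_integral do rewrite prior_gE/=.
under [RHS]eq_integral do rewrite post_gE/=.
rewrite /new_factor; case: eqP n1 => [->//|_ n1].
exact: (posterior_mean_onem (mh n) (h0 n) (measurable_e2_at _) (e201 _) (e101 n q) (Znew_fin n1)).
Qed.

Let unit_marked (phi : I -> measurableTypeR R -> nat -> R)
    (g : measurableTypeR R * Psi -> nat -> \bar R) :
  (forall k n, unit_fun ((phi k) ^~ n)) ->
  (forall n, measurable_fun setT (g ^~ n)) -> (forall p n, 0 <= g p n) ->
  unit_fun (fun w => ((\prod_k phi k (theta (inl k) w) (x (inl k) w)) *
     eN (\sum_(0 <= j <oo) g (pt j w) (x (inr j) w)))%R).
Proof.
move=> uphi mg g0; apply: unit_mul; first exact: (unit_fixed_marks Hcrm Hx uphi).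
apply: unit_eN; last by move=> w; exact: nneseries_ge0.
apply: (@ge0_emeasurable_sum _ _ _ _ (fun j w => g (pt j w) (x (inr j) w)) xpredT) => //.
by move=> j _; exact: (measurable_ordinary_mark Hcrm Hx j mg).
Qed.

Let unit_prior := unit_marked (phi := prior_phi)
  (fun k n => conj (measurable_prior_phi k n) (prior_phi01 k ^~ n)) measurable_prior_g prior_g0.

Let unit_post := unit_marked (phi := post_phi)
  (fun k n => conj (@measurable_cst _ _ _ _ _ _) (post_phi01 k ^~ n)) measurable_post_g post_g0.

(** Averaged over the marks, both sides become Laplace functionals of the prior
    atoms, which agree by Bayes' rule. *)
Lemma marks_bayes :
  \int[P]_w ((\prod_k prior_phi k (theta (inl k) w) (x (inl k) w)) *
     eN (\sum_(0 <= j <oo) prior_g (pt j w) (x (inr j) w)))%R%:E =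
  \int[P]_w ((\prod_k post_phi k (theta (inl k) w) (x (inl k) w)) *
     eN (\sum_(0 <= j <oo) post_g (pt j w) (x (inr j) w)) * ordinary_factor)%R%:E.
Proof.
under [RHS]eq_integral do rewrite EFinM.
have [mpost post01] := unit_post.
rewrite ge0_integralZr//; last 3 first.
- exact/measurable_EFinP.
- by move=> w _; rewrite lee_fin; case/andP: (post01 w).
- by rewrite lee_fin eN_ge0.
rewrite (marked_laplace Hcrm mh h0 h1 Hx)//.
rewrite (marked_laplace Hcrm mh h0 h1 Hx)//.
rewrite -EFinM -mulrA; congr (_ * _)%:E.
  by apply: eq_bigr => k _; rewrite fixed_bayes.
rewrite ordinary_bayes eND.
- by rewrite mulrC.
- by apply: integral_ge0 => p _; rewrite lee_fin subr_ge0 eN_le1// total_contribution_ge0.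
- apply: integral_ge0 => p _; rewrite lee_fin subr_ge0.
  by apply: (proj2 (andP (mixture01 h0 h1 p.1 _))) => n; rewrite eN_ge0 eN_le1.
Qed.

Section path.
Context (w : Omega) (mX mTheta : measure_space Psi R).
Hypothesis theta_ge0 : forall i, (0 <= theta i w)%R.
Hypothesis psi_inj : injective (psi ^~ w).
Hypothesis X_sum : atomic_sum (fun i => (x i w)%:R%R) (psi ^~ w) mX.
Hypothesis Theta_sum : atomic_sum (theta ^~ w) (psi ^~ w) mTheta.

Let X_functionals : eN (\sum_(j <- s1) functional j mX) =
  ((\prod_k e1 (x (inl k) w) (psi_fix k)) *
   eN (\sum_(0 <= j <oo) total_contribution s1 ((x (inr j) w)%:R%R : measurableTypeR R, psi (inr j) w)))%R.
Proof.
have x0 i : (0 <= ((x i w)%:R : R))%R by exact: ler0n.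
rewrite (sum_functional singletons s1 x0 psi_inj X_sum) eND; last 2 first.
- by apply: sume_ge0 => k _; exact: total_contribution_ge0.
- by apply: nneseries_ge0 => j _ _; exact: total_contribution_ge0.
rewrite eN_sum; last by move=> k; exact: total_contribution_ge0.
by congr (_ * _)%R; apply: eq_bigr => k _; rewrite (crm_psi_fix Hcrm).
Qed.

Lemma joint_functionals_marks :
  (eN (\sum_(j <- s1) functional j mX) * eN (\sum_(j <- s) functional j mTheta))%R =
  ((\prod_k prior_phi k (theta (inl k) w) (x (inl k) w)) *
     eN (\sum_(0 <= j <oo) prior_g (pt j w) (x (inr j) w)))%R.
Proof.
rewrite X_functionals (sum_functional singletons s theta_ge0 psi_inj Theta_sum).
rewrite [X in (_ * X = _)%R]eND; last 2 first.
- by apply: sume_ge0 => k _; exact: total_contribution_ge0.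
- by apply: nneseries_ge0 => j _ _; exact: total_contribution_ge0.
rewrite [X in (_ * (X * _) = _)%R]eN_sum; last by move=> k; exact: total_contribution_ge0.
rewrite mulrACA -big_split -eND; last 2 first.
- by apply: nneseries_ge0 => j _ _; exact: total_contribution_ge0.
- by apply: nneseries_ge0 => j _ _; exact: total_contribution_ge0.
rewrite -nneseriesD; last 2 first.
- by move=> j _ _; exact: total_contribution_ge0.
- by move=> j _ _; exact: total_contribution_ge0.
by congr (_ * _)%R; apply: eq_bigr => k _ /=; rewrite (crm_psi_fix Hcrm).
Qed.

Lemma posterior_functionals_marks : regular_observation mX ->
  (eN (\sum_(j <- s1) functional j mX) *
   fine (\int[posterior_kernel mX]_m (eN (\sum_(j <- s) functional j m))%:E))%R =
  ((\prod_k post_phi k (theta (inl k) w) (x (inl k) w)) *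
     eN (\sum_(0 <= j <oo) post_g (pt j w) (x (inr j) w)) * ordinary_factor)%R.
Proof.
move=> reg; rewrite (posterior_law_laplace reg (posterior_kernelP reg)) /= X_functionals.
have -> : \esum_(q in new_atoms mX) lN (new_factor (mark mX q) q) =
    \sum_(0 <= j <oo) lN (new_factor (x (inr j) w) (psi (inr j) w)).
  rewrite (new_atoms_marks psi_inj X_sum) esum_image; last first.
    by move=> i j _ _ /psi_inj [].
  rewrite esum_mkcond -nneseries_esumT; last by move=> j; case: ifP.
  apply: eq_eseriesr => j _; rewrite (markE (mass_mark psi_inj X_sum (inr j))).
  case: ifPn => // /negP nj; rewrite /new_factor.
  suff -> : x (inr j) w = 0%N by rewrite /lN ltr01 ln1 oppr0.
  by apply/eqP; rewrite -[_ == _]negbK; apply/negP => xj; apply: nj; exact/mem_set.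
rewrite !mulrA; congr (_ * _)%R; rewrite -!mulrA.
rewrite mulrA mulrACA -eND; last 2 first.
- by apply: nneseries_ge0 => j _ _; exact: total_contribution_ge0.
- by apply: nneseries_ge0 => j _ _.
rewrite -nneseriesD//; last first.
  by move=> j _ _; exact: total_contribution_ge0.
congr (_ * _)%R; rewrite -big_split; apply: eq_bigr => k _ /=.
by rewrite -{2}(crm_psi_fix Hcrm k w) (markE (mass_mark psi_inj X_sum (inl k))).
Qed.

End path.

Context (X Theta : Omega -> measure_space Psi R).
Hypothesis mX : measurable_fun setT X.
Hypothesis mTheta : measurable_fun setT Theta.
Hypothesis X_sum : {ae P, forall w, atomic_sum (fun i => (x i w)%:R%R) (psi ^~ w) (X w)}.
Hypothesis Theta_sum : {ae P, forall w, atomic_sum (theta ^~ w) (psi ^~ w) (Theta w)}.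

Lemma regular_observation_ae : {ae P, forall w, regular_observation (X w)}.
Proof.
have good : {ae P, forall w, (forall k, 0 < Zfix k (x (inl k) w)) /\
    (forall j, 0 < Znew (x (inr j) w)) /\ finite_set [set j | x (inr j) w != 0%N]}.
  by move: fixed_mark_ae ordinary_mark_ae finitely_many_marks_ae; apply: filterS3.
move: X_sum good (crm_distinct Hcrm).
by apply: filterS3 => w Xw [Hf [Hn fin]] inj_w; exact: (regular_of_marks inj_w Xw).
Qed.

Lemma joint_laplace :
  \int[P]_w (eN (\sum_(j <- s1) functional j (X w)) *
             eN (\sum_(j <- s) functional j (Theta w)))%:E =
  \int[P]_w (eN (\sum_(j <- s1) functional j (X w)) *
             fine (\int[posterior_kernel (X w)]_m (eN (\sum_(j <- s) functional j m))%:E))%:E.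
Proof.
have mexp (Y : Omega -> measure_space Psi R) s' : measurable_fun setT Y ->
    measurable_fun setT (fun w => eN (\sum_(j <- s') functional j (Y w))).
  move=> mY; apply: (measurableT_comp measurable_eN); apply: emeasurable_sum => j.
  exact: (measurableT_comp (measurable_functional j) mY).
have theta0 := ae_countable (crm_theta_ge0 Hcrm).
transitivity (\int[P]_w ((\prod_k prior_phi k (theta (inl k) w) (x (inl k) w)) *
     eN (\sum_(0 <= j <oo) prior_g (pt j w) (x (inr j) w)))%R%:E).
  apply: ae_eq_integral => //.
  - by apply/measurable_EFinP; apply: measurable_funM; exact: mexp.
  - by apply/measurable_EFinP; exact: (proj1 unit_prior).
  - have good : {ae P, forall w, atomic_sum (fun i => (x i w)%:R%R) (psi ^~ w) (X w) /\
        atomic_sum (theta ^~ w) (psi ^~ w) (Theta w)}.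
      by move: X_sum Theta_sum; apply: filterS2.
    move: (crm_distinct Hcrm) theta0 good; apply: filterS3 => w inj_w t0 [Xw Tw] _.
    by rewrite (joint_functionals_marks t0 inj_w Xw Tw).
rewrite marks_bayes; apply: ae_eq_integral => //.
- apply/measurable_EFinP; apply: measurable_funM => //.
  exact: (proj1 unit_post).
- apply/measurable_EFinP; apply: measurable_funM; first exact: mexp.
  apply: (measurableT_comp (fine_measurable _)) => //.
  exact: (measurableT_comp measurable_posterior_laplace mX).
- move: (crm_distinct Hcrm) X_sum regular_observation_ae.
  apply: filterS3 => w inj_w Xw reg _.
  by rewrite (posterior_functionals_marks inj_w Xw reg).
Qed.

End laplace_of_posterior.

(** * The conditional law *)

Lemma measurable_posterior_kernel C : measurable C ->
  measurable_fun setT (fun m => posterior_kernel m C).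
Proof.
move=> mC; rewrite (_ : (fun m => _) = fun m => \int[posterior_kernel m]_y (\1_C y)%:E); last first.
  by apply/funext => m; rewrite integral_indic// setIT.
apply: (measure_space_ind (H := [set f | measurable_fun setT
  (fun m => \int[posterior_kernel m]_y (f y)%:E)])) mC => /=.
- move=> f g [mf f01] [mg g01] _ Hf Hg.
  rewrite (_ : (fun m => _) = fun m => \int[posterior_kernel m]_y (f y)%:E -
      \int[posterior_kernel m]_y (g y)%:E); first exact: emeasurable_funB.
  by apply/funext => m; exact: expectationB.
- move=> u f uu [mf f01] uf Hu; apply: (emeasurable_fun_cvg _ _ Hu) => m _.
  apply: cvg_integral01 => //; first by move=> n; case: (uu n).
  by move=> n y; case: (uu n).
- exact: measurable_posterior_laplace.
Qed.

(** The result for a likelihood that is a probability mass function at every real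
    weight. *)
Lemma crm_posterior (X Theta : Omega -> measure_space Psi R) :
  measurable_fun setT X -> measurable_fun setT Theta ->
  {ae P, forall w, atomic_sum (fun i => (x i w)%:R%R) (psi ^~ w) (X w)} ->
  {ae P, forall w, atomic_sum (theta ^~ w) (psi ^~ w) (Theta w)} ->
  exists kappa : R.-pker (measure_space Psi R) ~> (measure_space Psi R),
    regular_conditional_distribution P X Theta kappa /\
    {ae P, forall w, posterior_law (X w) (kappa (X w))}.
Proof.
move=> mX mTheta X_sum Theta_sum.
have [kappa kappaE] := kernel_of_probabilities measurable_posterior_kernel.
exists kappa; split.
  move=> C D mC mD; under eq_integral do rewrite kappaE.
  apply: regular_conditional_distribution_laplace => //.
    exact: measurable_posterior_kernel.
  by move=> s1 s2; exact: joint_laplace.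
move: (regular_observation_ae X_sum); apply: filterS => w reg.
by rewrite (_ : (kappa (X w) : set _ -> \bar R) = posterior_kernel (X w));
  [exact: posterior_kernelP|apply/funext => U; exact: kappaE].
Qed.

End thinning.

(** * Likelihoods given on nonnegative weights only *)

Section nonnegative_weights.
Context {R : realType}.

(** Negative weights receive the mark [0], which makes the likelihood a
    probability mass function everywhere without changing it where the weights
    live. *)
Definition extend_pmf (h : nat -> R -> R) n t : R :=
  if (0 <= t)%R then h n t else (n == 0%N)%:R.

Context (h : nat -> R -> R).
Hypothesis mh : forall n, measurable_fun setT (h n).
Hypothesis h0 : forall n t, (0 <= t)%R -> (0 <= h n t)%R.
Hypothesis h1 : forall t, (0 <= t)%R -> \sum_(0 <= n <oo) (h n t)%:E = 1.

Lemma extend_pmfE n t : (0 <= t)%R -> extend_pmf h n t = h n t.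
Proof. by rewrite /extend_pmf => ->. Qed.

Lemma measurable_extend_pmf n : measurable_fun setT (extend_pmf h n).
Proof. by apply: measurable_fun_ifT => //; exact: measurable_fun_ler. Qed.

Lemma extend_pmf_ge0 n t : (0 <= extend_pmf h n t)%R.
Proof. by rewrite /extend_pmf; case: ifPn => // t0; exact: h0. Qed.

Lemma extend_pmf_sum t : \sum_(0 <= n <oo) (extend_pmf h n t)%:E = 1.
Proof.
have [t0|t0] := leP 0%R t.
  by rewrite -(h1 t0); apply: eq_eseriesr => n _; rewrite extend_pmfE.
rewrite (nneseriesD1 (n := 0%N))//; last by move=> k _; rewrite lee_fin extend_pmf_ge0.
rewrite /extend_pmf leNgt t0 eqxx eseries0 ?adde0// => k _ /= /negbTE k0.
by rewrite k0.
Qed.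

Context (M : {measure set (measurableTypeR R) -> \bar R}).
Hypothesis M_nneg : M [set t : R | (t < 0)%R] = 0.

Lemma integral_extend_pmf n B : measurable B ->
  \int[M]_(t in B) (extend_pmf h n t)%:E = \int[M]_(t in B) (h n t)%:E.
Proof.
move=> mB; apply: ae_eq_integral => //.
- by apply/measurable_funTS/measurable_EFinP; exact: measurable_extend_pmf.
- by apply/measurable_funTS/measurable_EFinP; exact: mh.
exists [set t : R | (t < 0)%R]; split => //; first exact: measurable_negative.
move=> t /=; rewrite ltNge; apply: contra_notN => t0 _.
by rewrite extend_pmfE.
Qed.

Lemma is_posterior_extend_pmf n Q :
  is_posterior M (extend_pmf h n) Q -> is_posterior M (h n) Q.
Proof.
rewrite /is_posterior integral_extend_pmf// => -[Z HQ]; split => // B mB.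
by rewrite HQ// integral_extend_pmf.
Qed.

End nonnegative_weights.

Lemma conditionally_independent_marks_extend {R : realType} dPsi (Psi : measurableType dPsi)
    d (Omega : measurableType d) (P : probability Omega R) (I : countType)
    (theta : I -> Omega -> measurableTypeR R) (psi : I -> Omega -> Psi)
    (h : nat -> R -> R) (x : I -> Omega -> nat) :
  (forall n, measurable_fun setT (h n)) ->
  (forall i, measurable_fun setT (theta i)) -> (forall i, measurable_fun setT (psi i)) ->
  (forall i, {ae P, forall w, (0 <= theta i w)%R}) ->
  conditionally_independent_marks P theta psi h x ->
  conditionally_independent_marks P theta psi (extend_pmf h) x.
Proof.
move=> mh mtheta mpsi theta0 [mx Hx]; split => // s n E us FE; rewrite Hx//.
have mE : measurable E.
  move: FE; apply: smallest_sub; first exact: sigma_algebra_measurable.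
  move=> A [i [_ [B mB <-]]].
  apply: (measurable_fun_pair (mtheta i) (mpsi i)) => //.
apply: ae_eq_integral => //.
- apply/measurable_funTS/measurable_EFinP/measurable_fun_prod => i.
  exact: (measurableT_comp (mh _) (mtheta i)).
- apply/measurable_funTS/measurable_EFinP/measurable_fun_prod => i.
  exact: (measurableT_comp (measurable_extend_pmf mh _) (mtheta i)).
move: (ae_countable theta0); apply: filterS => w t0 _.
by congr EFin; apply: eq_bigr => i _; rewrite extend_pmfE.
Qed.

(** * The posterior of a completely random measure *)

Theorem theorem3p1
  (R : realType)
  (dPsi : measure_display) (Psi : measurableType dPsi)
  (Psi_singletons : forall p : Psi, measurable [set p])
  (d : measure_display) (Omega : measurableType d) (P : probability Omega R)
  (Kfix : nat) (psi_fix : 'I_Kfix -> Psi)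
  (F_fix : 'I_Kfix -> probability (measurableTypeR R) R)
  (F_fix_nneg : forall k, F_fix k [set t : R | (t < 0)%R] = 0)
  (nu : {sigma_finite_measure set (measurableTypeR R) -> \bar R})
  (nu_nneg : nu [set t : R | (t < 0)%R] = 0)
  (nu_infinite : nu setT = +oo)
  (G : probability Psi R)
  (G_diffuse : forall p, G [set p] = 0)
  (Theta : Omega -> measure_space Psi R)
  (Theta_crm : completely_random P Theta)
  (theta : 'I_Kfix + nat -> Omega -> measurableTypeR R)
  (psi : 'I_Kfix + nat -> Omega -> Psi)
  (Theta_atoms : crm_atoms P psi_fix F_fix (nu \x G) theta psi)
  (Theta_sum : {ae P, forall w, atomic_sum (theta ^~ w) (psi ^~ w) (Theta w)})
  (h : nat -> R -> R)
  (h_measurable : forall n, measurable_fun setT (h n))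
  (h_ge0 : forall n t, (0 <= t)%R -> (0 <= h n t)%R)
  (h_sum : forall t, (0 <= t)%R -> \sum_(0 <= n <oo) (h n t)%:E = 1)
  (x : 'I_Kfix + nat -> Omega -> nat)
  (x_marks : conditionally_independent_marks P theta psi h x)
  (X : Omega -> measure_space Psi R)
  (X_measurable : measurable_fun setT X)
  (X_sum : {ae P, forall w,
     atomic_sum (fun i => (x i w)%:R%R) (psi ^~ w) (X w)})
  (h_summable : \sum_(1 <= n <oo) \int[nu]_t (h n t)%:E < +oo) :
  exists kappa : R.-pker (measure_space Psi R) ~> (measure_space Psi R),
    regular_conditional_distribution P X Theta kappa /\
    {ae P, forall w,
      exists (x_fix : 'I_Kfix -> nat)
        (Knew : nat) (psi_new : 'I_Knew -> Psi) (x_new : 'I_Knew -> nat)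
        (F_post_fix : 'I_Kfix -> probability (measurableTypeR R) R)
        (F_post_new : 'I_Knew -> probability (measurableTypeR R) R)
        (nu_post : {sigma_finite_measure set (measurableTypeR R) -> \bar R}),
      [/\ forall k, ev (X w) [set psi_fix k] = (x_fix k)%:R%:E,
          [/\ injective psi_new,
              range psi_new = [set p | atom (X w) p /\ ~ range psi_fix p] &
              forall k, ev (X w) [set psi_new k] = (x_new k)%:R%:E],
          [/\ forall k, is_posterior (F_fix k) (h (x_fix k)) (F_post_fix k),
              forall k, is_posterior nu (h (x_new k)) (F_post_new k) &
              forall B, measurable B ->
                nu_post B = \int[nu]_(t in B) (h 0%N t)%:E] &
          crm_law (kappa (X w))
            (join_families psi_fix psi_new)
            (join_families F_post_fix F_post_new)
            (nu_post \x G)]}.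
Proof.
have theta0 := crm_theta_ge0 Theta_atoms.
have marks' := conditionally_independent_marks_extend h_measurable
  (crm_theta_measurable Theta_atoms) (crm_psi_measurable Theta_atoms) theta0 x_marks.
have summable' : \sum_(1 <= n <oo) \int[nu]_t (extend_pmf h n t)%:E < +oo.
  by under eq_eseriesr do rewrite integral_extend_pmf//.
have [kappa [rcd post]] := crm_posterior Psi_singletons G_diffuse Theta_atoms
  (measurable_extend_pmf h_measurable) (extend_pmf_ge0 h_ge0) (extend_pmf_sum h_ge0 h_sum)
  marks' nu_infinite summable' F_fix_nneg nu_nneg X_measurable
  (proj1 Theta_crm) X_sum Theta_sum.
exists kappa; split => //; move: post; apply: filterS => w.
move=> [] x_fix [] Knew [] psi_new [] x_new [] F_post_fix [] F_post_new [H1 H2 [H3 H4] H5].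
exists x_fix, Knew, psi_new, x_new, F_post_fix, F_post_new.
exists (nu_part nu (measurable_extend_pmf h_measurable) (extend_pmf_ge0 h_ge0)
  (extend_pmf_sum h_ge0 h_sum) 0%N).
split => //; split.
- by move=> k; exact: (is_posterior_extend_pmf h_measurable (F_fix_nneg k)).
- by move=> k; exact: (is_posterior_extend_pmf h_measurable nu_nneg).
- by move=> B mB; exact: integral_extend_pmf.
Qed.
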